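(* For every odd prime $p$, $$S_{2p}\equiv-p\pmod{p^2}.$$ Consequently, $$\chi'(K_{2p})=\chi'_{\ell}(K_{2p})=\chi'_{\mathrm P}(K_{2p})=2p-1.$$ Here $S_n$, $\chi'$, $\chi'_\ell$, $\chi'_{\mathrm P}$ are as defined in the context.
   Context: Signed count. Let $n$ be even and order the vertices of $K_n$ as $0<1<\dots<n-1$. For a perfect matching $M$ let $\operatorname{cr}(M)$ be the number of unordered pairs of edges $\{a,c\},\{b,d\}\in M$ with $a<b<c<d$ (crossing pairs), and put $\varepsilon(M)=(-1)^{\operatorname{cr}(M)}$. A one-factorization of a graph is a partition of its edge set into perfect matchings (an unordered collection, whose members are called factors). For a one-factorization $\mathcal F$ put $\varepsilon(\mathcal F)=\prod_{M\in\mathcal F}\varepsilon(M)$. Define $S_n=\sum_{\mathcal F}\varepsilon(\mathcal F)$, the sum over all one-factorizations of $K_n$. Coloring indices of a graph $G$. $\chi'(G)$ is the ordinary edge chromatic index. $\chi'_\ell(G)$ is the least integer $k$ such that whenever each edge is assigned a list of $k$ colors, the edges can be properly colored from their lists. The edge-paintability index $\chi'_{\mathrm P}(G)$ is the least $k$ for which Painter has a winning strategy in the following game: each edge starts with $k$ tokens; in each round Lister marks a nonempty set of uncolored edges and removes one token from each of them; Painter then colors a matching consisting of marked edges (these edges are then colored permanently). After Painter's move, Lister wins if some uncolored edge has no token left. Painter wins if every edge is eventually colored. *)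

(* Defs.v *)
From mathcomp Require Import all_boot all_order all_algebra.

Set Implicit Arguments.
Unset Strict Implicit.
Unset Printing Implicit Defensive.

Record sgraph := SGraph {
  vertex :> finType;
  adj : rel vertex;
  adj_sym : symmetric adj;
  adj_irrefl : irreflexive adj
}.

Definition edges (G : sgraph) : {set {set G}} :=
  [set [set uv.1; uv.2] | uv in [set uv : G * G | adj uv.1 uv.2]].

Definition neq_rel (n : nat) : rel 'I_n := fun i j => i != j.

Lemma neq_rel_sym n : symmetric (@neq_rel n).
Proof. by move=> i j; rewrite /neq_rel eq_sym. Qed.

Lemma neq_rel_irrefl n : irreflexive (@neq_rel n).
Proof. by move=> i; rewrite /neq_rel eqxx. Qed.

Definition complete_graph (n : nat) : sgraph :=
  SGraph (@neq_rel_sym n) (@neq_rel_irrefl n).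

Notation "''K_' n" := (complete_graph n)
  (at level 8, n at level 2, format "''K_' n").

Definition matching (G : sgraph) (M : {set {set G}}) : bool :=
  (M \subset edges G) && trivIset M.

Definition perfect_matching (G : sgraph) (M : {set {set G}}) : bool :=
  (M \subset edges G) && partition M [set: G].

Definition one_factorization (G : sgraph) (F : {set {set {set G}}}) : bool :=
  partition F (edges G) && [forall M in F, perfect_matching M].

(** The pair [P] of edges is [{{a, c}, {b, d}}] with [a < b < c < d]. *)
Definition crossing (n : nat) (P : {set {set 'K_n}}) : bool :=
  [exists a : 'I_n, exists b : 'I_n, exists c : 'I_n, exists d : 'I_n,
    [&& a < b, b < c, c < d & P == [set [set a; c]; [set b; d]]]].

Definition cr (n : nat) (M : {set {set 'K_n}}) : nat :=
  #|[set P in powerset M | crossing P]|.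

Definition sign_matching (n : nat) (M : {set {set 'K_n}}) : int :=
  ((-1) ^+ cr M)%R.

Definition sign_factorization (n : nat) (F : {set {set {set 'K_n}}}) : int :=
  (\prod_(M in F) sign_matching M)%R.

Definition signed_count (n : nat) : int :=
  (\sum_(F : {set {set {set 'K_n}}} | one_factorization F)
     sign_factorization F)%R.

Definition is_least (P : nat -> Prop) (k : nat) : Prop :=
  P k /\ forall j, P j -> k <= j.

(** Colors are natural numbers. This loses no generality for list colorings,
    since only finitely many colors occur in the lists; and unlike a color type
    that may be empty, it is harmless for graphs without edges. *)
Definition proper_edge_coloring (G : sgraph) (c : {set G} -> nat) : Prop :=
  forall e f, e \in edges G -> f \in edges G ->
    e != f -> ~~ [disjoint e & f] -> c e != c f.

Definition edge_colorable (G : sgraph) (k : nat) : Prop :=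
  exists2 c : {set G} -> nat, proper_edge_coloring c &
    forall e, e \in edges G -> c e < k.

Definition edge_choosable (G : sgraph) (k : nat) : Prop :=
  forall L : {set G} -> seq nat,
    (forall e, e \in edges G -> uniq (L e) /\ size (L e) = k) ->
    exists2 c : {set G} -> nat, proper_edge_coloring c &
      forall e, e \in edges G -> c e \in L e.

(** [painter_wins U t]: Painter has a winning strategy from the position, at the
    start of a round, in which [U] is the set of uncolored edges and every
    [e \in U] has [t e] tokens. Here [s A] is Painter's answer when Lister marks
    [A]. The first condition is the test made after Painter's previous move;
    imposing it also on the initial position only says that Painter does not win
    when uncolored edges start without tokens. Being inductive, the predicate
    requires that every play ends, hence with all edges colored. *)
Inductive painter_wins (G : sgraph) (U : {set {set G}}) (t : {set G} -> nat) :
    Prop :=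
  PainterWins (s : {set {set G}} -> {set {set G}}) of
    (forall e, e \in U -> 0 < t e) &
    (forall A, A != set0 -> A \subset U -> s A \subset A /\ matching (s A)) &
    (forall A, A != set0 -> A \subset U ->
       painter_wins (U :\: s A) (fun e => t e - (e \in A))).

Definition edge_paintable (G : sgraph) (k : nat) : Prop :=
  painter_wins (edges G) (fun=> k).

Definition is_chromatic_index (G : sgraph) : nat -> Prop :=
  is_least (edge_colorable G).

Definition is_list_chromatic_index (G : sgraph) : nat -> Prop :=
  is_least (edge_choosable G).

Definition is_paintability_index (G : sgraph) : nat -> Prop :=
  is_least (edge_paintable G).

(* Main.v *)
(** A one-factorization is represented by the set of fixed-point-free involutions
    given by its factors. Comparing two orders of the vertices, every pair of vertices
    contributes to the signs of all factors but one; so the sign of a one-factorization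
    does not depend on the order, and relabelings preserve it. Take [Z_p * {0, 1}] as the
    vertex set. Under the [p ^ 2] translations of the two copies, only the
    one-factorizations fixed by some diagonal translation [(1, k)], [k != 0], matter modulo
    [p ^ 2]; they contribute [(p - 1) p A ^ 2], where [A] is the sum of the signs of the
    permutations [q] of [Z_p] with [q 0 = 0] and [q (- d) = q d + d]. Times the Vandermonde
    determinant of [Z_p], [A] is a sum of Vandermonde determinants over all maps with these
    two properties; in their Leibniz expansions, power sums over [Z_p] kill all
    permutations but the odd ones, and [A ^ 2 = 1] in [Z_p] follows.

    For the indices, consider the product of [x_e - x_f] over the pairs of adjacent edges of
    [K_n]. By interpolation its coefficient at the monomial with all exponents [n - 2] is,
    up to a nonzero factor, the sum of its values at the proper edge colorings with [n - 1]
    colors. A count of inversions between half-edges identifies these values, up to a common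
    factor, with the signs of the one-factorizations, so the sum is a multiple of [S_n].
    When it is nonzero, Painter wins with [n - 1] tokens per edge, by Schauz's form of the
    Alon-Tarsi argument. *)

(* A nontrivial stabilizer contains no shift of a single copy, so it has one slope [k]; the [p - 1]
   slopes are conjugate. A factorization fixed by the diagonal shift consists of [p - 1] of the [p]
   translation-invariant matchings between the copies and of the [p] translates of one further
   factor. The missing matching accounts for the factor [p]; the further factor is an independent
   choice of one permutation [q] per copy, whence a square.

   The obstacle in [A] is the bijectivity of [q]. The Vandermonde determinant removes it: it
   vanishes on maps that are not injective, so the sum may run over all maps with the functional
   equation, whose values at one element of each pair [{d, -d}] are free, and the Leibniz expansion
   splits into one-variable sums over [Z_p]. The exponents at [d] and [-d] add up to [p] on average,
   and these sums vanish below [p]; so only permutations with all such sums equal to [p], the odd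
   ones, survive. *)
Require Import Defs.
From mathcomp Require Import all_boot all_order all_algebra all_fingroup all_solvable finfield.
From mathcomp Require Import zify ring.

Set Implicit Arguments.
Unset Strict Implicit.
Unset Printing Implicit Defensive.

Import GRing.Theory Num.Theory.

Local Open Scope ring_scope.

(** * Signs of matchings *)

Section PairProducts.

Variables (T : finType) (R : comPzSemiRingType).

Lemma prod_key_order (k k' : T -> nat) (s : T -> T -> R) :
  (forall x y, s x y = s y x) ->
  (forall x y, s x y != 1 -> (k x == k y) = (k' x == k' y)) ->
  \prod_(z : T * T | (k z.1 < k z.2)%N) s z.1 z.2 =
  \prod_(z : T * T | (k' z.1 < k' z.2)%N) s z.1 z.2.
Proof.
move=> s_sym s_eq; rewrite big_mkcond [RHS]big_mkcond /=.
(* Pairs that the two keys order oppositely are swapped. The tie condition makes [f] an involution;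
   where it fails, [s] is 1. *)
pose sw (z : T * T) := ((k z.1 == k z.2) == (k' z.1 == k' z.2)) &&
  ((k z.1 < k z.2)%N != (k' z.1 < k' z.2)%N).
pose f z := if sw z then (z.2, z.1) else z.
have fK : involutive f.
  move=> [x y]; rewrite /f; case swz: (sw (x, y)); last by rewrite swz.
  suff -> : sw (y, x) by [].
  move: swz; rewrite /sw /= ![k y == _]eq_sym ![k' y == _]eq_sym.
  case/andP=> /eqP e1 d; rewrite e1 eqxx /=; move: e1 d.
  by case: (ltngtP (k x) (k y)); case: (ltngtP (k' x) (k' y)).
rewrite [RHS](reindex_inj (inv_inj fK)) /=.
apply: eq_bigr => -[x y] _; rewrite /f /sw /=.
have [s1|/s_eq e1] := eqVneq (s x y) 1.
  by case: (_ && _) => /=; rewrite ?(s_sym y x) s1 !if_same.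
rewrite e1 eqxx /=; move: e1.
by case: (ltngtP (k x) (k y)); case: (ltngtP (k' x) (k' y)) => //= a b _;
  rewrite ?(s_sym y x) ?a ?b ?ltnn // ltnNge ltnW.
Qed.

End PairProducts.

Section MatchingSign.

Variable V : finType.
Implicit Types (m : {perm V}) (k g : V -> nat).

Definition fpf_involution m := [forall v, (m v != v) && (m (m v) == v)].

Lemma fpf_neq m v : fpf_involution m -> m v != v.
Proof. by move/forallP/(_ v)/andP => []. Qed.

Lemma fpfK m : fpf_involution m -> involutive m.
Proof. by move=> fm v; apply/eqP; move/forallP/(_ v)/andP: fm => []. Qed.

Definition inversion_sign k v w : int := if (k w < k v)%N then -1 else 1.

(** Each crossing is counted once, through the left ends of its two edges in increasing order. *)
Definition match_sign k m : int :=
  (-1) ^+ #|[set z : V * V |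
    [&& k z.1 < k z.2, k z.2 < k (m z.1) & k (m z.1) < k (m z.2)]%N]|.

Lemma prod_fpf_involution (R : comPzSemiRingType) m k (f : V -> R) :
  fpf_involution m -> injective k ->
  \prod_v f v = \prod_(v | (k v < k (m v))%N) (f v * f (m v)).
Proof.
move=> fm k_inj; rewrite (bigID (fun v => (k v < k (m v))%N)) /= big_split /=.
congr (_ * _); rewrite (reindex_inj (@perm_inj _ m)) /=.
apply: eq_bigl => v; rewrite fpfK // -leqNgt leq_eqVlt; case: eqP => //= /k_inj/eqP.
by rewrite eq_sym (negPf (fpf_neq v fm)).
Qed.

Definition edge_key g m :=
  forall v w, (g v == g w) = (w == v) || (w == m v).

(** If the edges are listed one after another in the order of [g], the right side counts the
    inversions between ends of different edges. Any order of the edges gives the same sign. *)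
Lemma match_signE k g m : injective k -> fpf_involution m -> edge_key g m ->
  match_sign k m =
    \prod_(z : V * V | (g z.1 < g z.2)%N) inversion_sign k z.1 z.2.
Proof.
move=> k_inj fm gm; pose c v w := inversion_sign k v w.
have g_m v : g (m v) = g v by apply/esym/eqP; rewrite gm eqxx orbT.
(* For left ends [v], [w] of two edges this is the product of the four inversion signs between them:
   -1 exactly at a crossing, and symmetric because exchanging the edges flips four signs. *)
pose s v w : int := if [&& v != w, k v < k (m v) & k w < k (m w)]%N then
  c v w * c v (m w) * (c (m v) w * c (m v) (m w)) else 1.
have c_anti v w : v != w -> c w v = - c v w.
  move=> vw; rewrite /c /inversion_sign; case: ltngtP => // /k_inj /eqP.
  by rewrite (negPf vw).
have s_sym v w : s v w = s w v.
  rewrite /s [w == v]eq_sym [(k w < _)%N && _]andbC.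
  case: ifP => // /and3P[wv h1 h2].
  have vmw : v != m w by apply: contraTneq h1 => ->; rewrite fpfK // -leqNgt ltnW.
  have wmv : w != m v by apply: contraTneq h2 => ->; rewrite fpfK // -leqNgt ltnW.
  have mm : m v != m w by rewrite (inj_eq perm_inj).
  rewrite eq_sym in wmv.
  by rewrite (c_anti v w) // (c_anti v (m w)) // (c_anti (m v) w) // (c_anti (m v) (m w)) //;
    ring.
transitivity (\prod_(z : V * V | (k z.1 < k z.2)%N) s z.1 z.2).
  rewrite /match_sign -prodr_const big_mkcond [RHS]big_mkcond /=.
  apply: eq_bigr => -[v w] _; rewrite inE /= /s /c /inversion_sign.
  have [vw|] := boolP (k v < k w)%N; last by [].

  have v_w : v != w by apply: contraTneq vw => ->; rewrite ltnn.
  have : k (m v) != k (m w) by rewrite (inj_eq k_inj) (inj_eq perm_inj).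
  rewrite v_w; move: (k v) (k w) (k (m v)) (k (m w)) vw => x y x' y' xy.
  move=> ne; have [h1|h1] := ltnP x x' => /=; last first.
    by case: ifP => // /andP[h2 _]; move: (ltn_trans xy h2); rewrite ltnNge h1.
  have [h2|h2] := ltnP y y' => /=; last first.
    by case: ifP => // /andP[h3 h4]; move: (ltn_trans h3 h4); rewrite ltnNge h2.
  rewrite (ltnNge y x) (ltnW xy) (ltnNge y' x) (ltnW (ltn_trans xy h2)) /= !mul1r.
  have [h3|h3] := ltnP y x' => /=; last by rewrite ltnNge (ltnW (leq_ltn_trans h3 h2)).
  by case: ltngtP ne.
rewrite (prod_key_order (k' := g)) //; last first.
  move=> v w; rewrite /s; case: ifP => [/and3P[vw h1 h2] _|]; last by rewrite eqxx.
  rewrite gm (inj_eq k_inj) (negPf vw) eq_sym (negPf vw) /=.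
  by apply/esym/negbTE; apply: contraTneq h2 => ->; rewrite fpfK // -leqNgt ltnW.
rewrite big_mkcond [RHS]big_mkcond /=.
have prodE (F : V -> V -> int) : \prod_(z : V * V) F z.1 z.2 = \prod_v \prod_w F v w.
  by rewrite pair_bigA.
rewrite (prodE (fun v w => if (g v < g w)%N then s v w else 1)) /=.
rewrite (prodE (fun v w => if (g v < g w)%N then c v w else 1)) /=.
rewrite [RHS](prod_fpf_involution _ fm k_inj) [RHS]big_mkcond.
apply: eq_bigr => v _; rewrite g_m -big_split /=; case: ifP => [h1|h1]; last first.
  by apply: big1 => w _; rewrite /s h1 /= andbF; case: ifP.
rewrite [RHS](prod_fpf_involution _ fm k_inj) [RHS]big_mkcond /=.
apply: eq_bigr => w _; rewrite g_m /s h1 /=.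
have [gvw|_] := boolP (g v < g w)%N; last by rewrite !mulr1 if_same.
have -> : v != w by apply: contraTneq gvw => ->; rewrite ltnn.
by rewrite /=; case: (k w < _)%N => //; ring.
Qed.

End MatchingSign.

(** * Change of the vertex order and relabeling *)

Section RelativeSign.

Variable V : finType.
Implicit Types (m : {perm V}) (k : V -> nat).

Definition relative_sign k k' v w : int :=
  inversion_sign k v w * inversion_sign k' v w.

Lemma inversion_signC k v w : k v != k w ->
  inversion_sign k w v = - inversion_sign k v w.
Proof. by rewrite /inversion_sign; case: ltngtP. Qed.

Lemma inversion_sign_sqr k v w : inversion_sign k v w * inversion_sign k v w = 1.
Proof. by rewrite /inversion_sign; case: ifP. Qed.

Lemma relative_signC k k' v w : injective k -> injective k' ->
  relative_sign k k' v w = relative_sign k k' w v.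
Proof.
move=> k_inj k'_inj; have [->|vw] := eqVneq v w => //.
rewrite /relative_sign (inversion_signC (v := w)) ?(inversion_signC (v := w) (k := k')).
- by rewrite mulrNN.
- by rewrite (inj_eq k'_inj) eq_sym.
- by rewrite (inj_eq k_inj) eq_sym.
Qed.

Lemma relative_sign_sqr k k' v w : relative_sign k k' v w * relative_sign k k' v w = 1.
Proof. by rewrite /relative_sign mulrACA !inversion_sign_sqr. Qed.

Lemma match_sign_sqr k m : match_sign k m * match_sign k m = 1.
Proof. by rewrite /match_sign -expr2 sqrr_sign. Qed.

Lemma edge_key_min k m : injective k -> fpf_involution m ->
  edge_key (fun v => minn (k v) (k (m v))) m.
Proof.
move=> k_inj fm v w; apply/eqP/idP => [|/orP[]/eqP->]; last by rewrite fpfK // minnC.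
  have kE x y : (k x = k y) -> x = y by apply: k_inj.
  rewrite /minn; case: ifP => _; case: ifP => _ /kE.
  - by move->; rewrite eqxx.
  - by move->; rewrite fpfK // eqxx orbT.
  - by move->; rewrite eqxx orbT.
  - by move/perm_inj->; rewrite eqxx.
by [].
Qed.

(** Both signs are expanded by [match_signE] with one common edge key. The resulting product of
    relative signs is symmetric, so the edge key may be traded for [k]. *)
Lemma match_sign_relative k k' m :
  injective k -> injective k' -> fpf_involution m ->
  match_sign k m * match_sign k' m =
  \prod_(z : V * V | (k z.1 < k z.2)%N)
     (if z.2 == m z.1 then 1 else relative_sign k k' z.1 z.2).
Proof.
move=> k_inj k'_inj fm.
have [g gm] : exists g, edge_key g m by eexists; exact: edge_key_min k_inj fm.
rewrite (match_signE k_inj fm gm) (match_signE k'_inj fm gm) -big_split /=.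
rewrite -(@prod_key_order _ _ g k
  (fun v w => if w == m v then 1 else relative_sign k k' v w)).
- apply: eq_bigr => -[v w] /= h; case: eqP => // e.
  by move: h; rewrite e ltn_neqAle gm eqxx orbT.
- move=> v w; rewrite (relative_signC w v) //; congr (if _ then _ else _).
  by apply/eqP/eqP => ->; rewrite fpfK.
- move=> v w; have [_|wm _] := eqVneq w (m v); first by rewrite eqxx.
  by rewrite gm (inj_eq k_inj) (negPf wm) orbF eq_sym.
Qed.

Lemma prod_relative_sign_reindex k k' l (s : {perm V}) :
  injective k -> injective k' -> injective l ->
  \prod_(z : V * V | (l z.1 < l z.2)%N) relative_sign k k' (s z.1) (s z.2) =
  \prod_(z : V * V | (l z.1 < l z.2)%N) relative_sign k k' z.1 z.2.
Proof.
move=> k_inj k'_inj l_inj; pose f (z : V * V) := (s z.1, s z.2).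
have f_inj : injective f by move=> [a b] [c d] [/perm_inj-> /perm_inj->].
rewrite [RHS](@prod_key_order _ _ l (l \o s^-1)%g (relative_sign k k')).
- by rewrite [RHS](reindex_inj f_inj) /=; apply: eq_bigl => z; rewrite !permK.
- by move=> x y; apply: relative_signC.
- by move=> x y _; rewrite /= !(inj_eq l_inj) (inj_eq perm_inj).
Qed.

(** The inversion sign of [s] in the order [k]. It is multiplicative, independent of [k] and -1 at
    transpositions, hence the usual sign. *)
Definition key_perm_sign k (s : {perm V}) : int :=
  \prod_(z : V * V | (k z.1 < k z.2)%N) relative_sign k (k \o s) z.1 z.2.

Lemma key_perm_signM k (s t : {perm V}) : injective k ->
  key_perm_sign k (s * t)%g = key_perm_sign k s * key_perm_sign k t.
Proof.
move=> k_inj; rewrite /key_perm_sign.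
rewrite -[X in _ * X](@prod_relative_sign_reindex _ _ _ s) //; last first.
  exact: inj_comp k_inj perm_inj.
rewrite -big_split /=; apply: eq_bigr => -[v w] _.
rewrite /relative_sign /inversion_sign /= !permM.
by rewrite -mulrA; congr (_ * _); case: (k (s w) < k (s v))%N; rewrite ?mulN1r ?opprK ?mul1r.
Qed.

Lemma key_perm_sign_eq k k' (s : {perm V}) : injective k -> injective k' ->
  key_perm_sign k s = key_perm_sign k' s.
Proof.
move=> k_inj k'_inj.
have ks_inj : injective (k \o s) by apply: inj_comp k_inj perm_inj.
have k's_inj : injective (k' \o s) by apply: inj_comp k'_inj perm_inj.
suff e : key_perm_sign k s * key_perm_sign k' s = 1.
  have sqr : key_perm_sign k' s * key_perm_sign k' s = 1.
    by rewrite -big_split big1 //= => z _; rewrite relative_sign_sqr.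
  by rewrite -[LHS]mulr1 -sqr mulrA e mul1r.
rewrite [X in _ * X](@prod_key_order _ _ k' k (relative_sign k' (k' \o s))); first last.
- by move=> x y _; rewrite !inj_eq.
- by move=> x y; apply: relative_signC.
rewrite -big_split /=.
transitivity (\prod_(z : V * V | (k z.1 < k z.2)%N) (relative_sign k k' z.1 z.2 *
   relative_sign k k' (s z.1) (s z.2))).
  by apply: eq_bigr => z _; rewrite mulrACA.
rewrite big_split /= prod_relative_sign_reindex // -big_split big1 //= => z _.
exact: relative_sign_sqr.
Qed.

Lemma key_perm_sign_tperm k x y : injective k -> x != y ->
  key_perm_sign k (tperm x y) = -1.
Proof.
move=> k_inj xy.
(* In an order that starts with [x], [y], the transposition inverts only the pair [(x, y)]. *)
pose k' v := if v == x then 0%N else if v == y then 1%N else (k v).+2.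
have k'x : k' x = 0%N by rewrite /k' eqxx.
have k'y : k' y = 1%N by rewrite /k' eqxx eq_sym (negPf xy).
have k'z z : z != x -> z != y -> k' z = (k z).+2.
  by rewrite /k' => /negPf-> /negPf->.
have k'_inj : injective k'.
  by move=> v w; rewrite /k'; do ![case: ifP => [/eqP->|_]] => // -[] /k_inj.
rewrite (key_perm_sign_eq _ k_inj k'_inj) /key_perm_sign (bigD1 (x, y)) /=; last first.
  by rewrite k'x k'y.
rewrite big1 => [|[v w] /= /andP[vw ne]].
  by rewrite /relative_sign /inversion_sign /= tpermL tpermR k'x k'y.
rewrite /relative_sign /inversion_sign /= ltnNge (ltnW vw) /= mul1r; case: ifP => //.
move: vw ne; rewrite xpair_eqE.
by case: (tpermP x y v) => [->|->|/eqP vx /eqP vy];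
  case: (tpermP x y w) => [->|->|/eqP wx /eqP wy];
  rewrite ?k'x ?k'y ?k'z ?eqxx // !ltnS => h1 h2; rewrite ltnNge ltnW.
Qed.

Lemma prod_relative_sign_perm k (s : {perm V}) : injective k ->
  \prod_(z : V * V | (k z.1 < k z.2)%N) relative_sign k (k \o s) z.1 z.2
  = (-1) ^+ s.
Proof.
move=> k_inj; rewrite -/(key_perm_sign k s).
case: (prod_tpermP s) => ts -> {s}; elim: ts => [_|[x y] ts IH] /=.
  rewrite big_nil odd_perm1 /key_perm_sign big1 // => z _.
  by rewrite /relative_sign /inversion_sign /= !perm1; case: ifP.
case/andP=> xy /IH{}IH; rewrite big_cons key_perm_signM // IH.
by rewrite key_perm_sign_tperm // odd_permM odd_tperm xy signr_addb expr1.
Qed.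

Lemma match_signJ k m (s : {perm V}) : match_sign k (m ^ s)%g = match_sign (k \o s) m.
Proof.
rewrite /match_sign; set A := [set z | _]; set B := [set z | _].
suff -> : A = [set (s z.1, s z.2) | z in B].
  by rewrite card_imset // => -[a b] [c d] [/perm_inj-> /perm_inj->].
apply/setP => -[a b]; apply/idP/imsetP => [|[[c d]]]; rewrite !inE.
  move=> h; exists (s^-1 a, s^-1 b)%g; last by rewrite /= !permKV.
  have mE x : (m ^ s)%g x = s (m ((s^-1)%g x)) by rewrite -{1}(permKV s x) permJ.
  by move: h; rewrite inE /= !permKV !mE.
by move=> h [-> ->]; rewrite /= !permJ.
Qed.

End RelativeSign.

Section OneFactorizations.

Variable V : finType.
Implicit Types (m : {perm V}) (k : V -> nat) (F : {set {perm V}}).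

Definition one_fact F :=
  [forall m in F, fpf_involution m] &&
  [forall u, forall v, (u != v) ==> (#|[set m in F | m u == v]| == 1%N)].

Definition fact_sign k F : int := \prod_(m in F) match_sign k m.

Lemma one_fact_fpf F m : one_fact F -> m \in F -> fpf_involution m.
Proof. by case/andP => /forall_inP h _; apply: h. Qed.

Lemma one_fact_card1 F u v : one_fact F -> u != v -> #|[set m in F | m u == v]| = 1%N.
Proof. by case/andP => _ /forallP/(_ u)/forallP/(_ v)/implyP h /h/eqP. Qed.

Lemma one_fact_inj F m m' u : one_fact F -> m \in F -> m' \in F -> m u = m' u -> m = m'.
Proof.
move=> oF mF m'F e; have mu : u != m u by rewrite eq_sym (fpf_neq _ (one_fact_fpf oF mF)).
have /eqP/cards1P[x sE] := one_fact_card1 oF mu.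
have : m \in [set m0 in F | m0 u == m u] by rewrite inE mF eqxx.
have : m' \in [set m0 in F | m0 u == m u] by rewrite inE m'F e eqxx.
by rewrite sE !inE => /eqP-> /eqP->.
Qed.

Lemma one_fact_ex F u v : one_fact F -> u != v -> exists2 m, m \in F & m u = v.
Proof.
move=> oF /(one_fact_card1 oF)/eqP/cards1P[m e].
have : m \in [set m in F | m u == v] by rewrite e set11.
by rewrite inE => /andP[mF /eqP h]; exists m.
Qed.

Lemma one_factP F :
  (forall m, m \in F -> fpf_involution m) ->
  (forall u v, u != v -> exists2 m, m \in F & m u = v) ->
  (forall m m' u, m \in F -> m' \in F -> m u = m' u -> m = m') ->
  one_fact F.
Proof.
move=> fF exF injF; apply/andP; split; first by apply/forall_inP.
apply/forallP => u; apply/forallP => v; apply/implyP => /exF[m mF e].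
apply/cards1P; exists m; apply/setP => m'; rewrite !inE.
apply/andP/eqP => [[m'F /eqP e']|->]; last by rewrite e.
by apply: (injF _ _ u) => //; rewrite e e'.
Qed.

Lemma card_one_fact F (u : V) : one_fact F -> #|F| = #|V|.-1.
Proof.
move=> oF; rewrite -(@card_in_imset _ _ (fun m : {perm V} => m u)); last first.
  by move=> m m' mF m'F; apply: one_fact_inj oF mF m'F.
rewrite (_ : [set _ | _ in _] = [set~ u]) ?cardsC1 //.
apply/setP => v; rewrite !inE; apply/imsetP/idP => [[m mF ->]|].
  exact: fpf_neq (one_fact_fpf oF mF).
by rewrite eq_sym => /(one_fact_ex oF)[m mF <-]; exists m.
Qed.

Lemma fact_sign_sqr k F : fact_sign k F * fact_sign k F = 1.
Proof. by rewrite -big_split big1 //= => m _; rewrite match_sign_sqr. Qed.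

Lemma fact_sign_key F k k' : ~~ odd #|V| -> one_fact F ->
  injective k -> injective k' -> fact_sign k F = fact_sign k' F.
Proof.
move=> evV oF k_inj k'_inj.
suff e : fact_sign k F * fact_sign k' F = 1.
  by rewrite -[LHS]mulr1 -(fact_sign_sqr k' F) mulrA e mul1r.
have [u _|V0] := pickP (mem V); last first.
  rewrite -big_split big1 //= => m _; rewrite match_sign_relative //.
    by rewrite big1 // => -[v]; have := V0 v; rewrite inE.
  by apply/forallP => v; have := V0 v; rewrite inE.
rewrite -big_split /=.
under eq_bigr => m mF do rewrite match_sign_relative ?(one_fact_fpf oF mF) //.
rewrite exchange_big big1 //= => -[v w] /= vw.
have v_w : v != w by apply: contraTneq vw => ->; rewrite ltnn.
have [m0 m0F e0] := one_fact_ex oF v_w.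
rewrite (bigD1 m0) //= e0 eqxx mul1r (eq_bigr (fun=> relative_sign k k' v w)); last first.
  move=> m /andP[mF ne]; case: eqP => // e; case/eqP: ne.
  by apply: (one_fact_inj (u := v) oF) => //; rewrite -e e0.
rewrite prodr_const.
(* The relative sign of [v], [w] enters [#|V| - 2] times, an even number. *)
have -> : #|[pred i in F | i != m0]| = #|V|.-2.
  rewrite -(card_one_fact u oF) (cardD1 m0 (mem F)) m0F /=.
  by apply: eq_card => m; rewrite !inE andbC.
have : (1 < #|V|)%N by apply/card_gt1P; exists v, w.
case: #|V| evV => [|[|n]] //=; rewrite negbK => evn _.
rewrite -[n]odd_double_half (negPf evn) add0n -muln2 mulnC exprM expr2.
by rewrite relative_sign_sqr expr1n.
Qed.

Lemma fpf_involutionJ m (s : {perm V}) : fpf_involution (m ^ s)%g = fpf_involution m.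
Proof.
suff h m' t : fpf_involution m' -> fpf_involution (m' ^ t)%g.
  by apply/idP/idP => [/(h _ s^-1%g)|/h//]; rewrite conjgK.
move=> fm; apply/forallP => v; rewrite -[v](permKV t) !permJ (inj_eq perm_inj).
by rewrite fpf_neq // fpfK // eqxx.
Qed.

Lemma one_factJ F (s : {perm V}) : one_fact F -> one_fact (F :^ s)%g.
Proof.
move=> oF; apply: one_factP => [m|u v uv|m m' u].
- by case/imsetP => m' /(one_fact_fpf oF) fm ->; rewrite fpf_involutionJ.
- have [|m mF e] := @one_fact_ex F (s^-1 u)%g (s^-1 v)%g oF.
    by rewrite (inj_eq perm_inj).
  by exists (m ^ s)%g; rewrite ?memJ_conjg // -(permKV s u) permJ e permKV.
case/imsetP => n nF -> /imsetP[n' n'F ->].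
rewrite -(permKV s u) !permJ => /perm_inj e; congr (_ ^ _)%g.
exact: one_fact_inj oF nF n'F e.
Qed.

Lemma one_factJE F (s : {perm V}) : one_fact (F :^ s)%g = one_fact F.
Proof.
by apply/idP/idP => [oF|/one_factJ//]; rewrite -(conjsgK s F); apply: one_factJ.
Qed.

Lemma fact_signJ F k (s : {perm V}) : ~~ odd #|V| -> one_fact F -> injective k ->
  fact_sign k (F :^ s)%g = fact_sign k F.
Proof.
move=> evV oF k_inj; rewrite /fact_sign big_imset /=; last first.
  by move=> m m' _ _; apply: conjg_inj.
rewrite (eq_bigr (match_sign (k \o s))) => [|m _]; last by rewrite match_signJ.
by apply: fact_sign_key => //; apply: inj_comp k_inj perm_inj.
Qed.

(** Over all pairs of vertices the relative signs of [k] and [k \o s] multiply to the sign of [s];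
    [match_sign_relative] omits the edges of [m], which the last factor restores. *)
Lemma match_signJ_edges m k (s : {perm V}) : injective k -> fpf_involution m ->
  match_sign k (m ^ s)%g = match_sign k m * (-1) ^+ s *
    \prod_(v | (k v < k (m v))%N) relative_sign k (k \o s) v (m v).
Proof.
move=> k_inj fm; have ks_inj : injective (k \o s) := inj_comp k_inj perm_inj.
set Q := \prod_(v | _) _.
have := match_sign_relative k_inj ks_inj fm; rewrite -match_signJ.
set P := \prod_(z | _) _ => eP.
have <- : P * Q = (-1) ^+ s.
  rewrite -(prod_relative_sign_perm s k_inj) /P /Q.
  rewrite [RHS](bigID (fun z : V * V => z.2 == m z.1)) mulrC /=; congr (_ * _).
    rewrite [RHS](reindex_onto (fun v => (v, m v)) (fun z => z.1)) /=.
      by apply: eq_bigl => v; rewrite !eqxx !andbT.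
    by move=> [v w] /= /andP[_ /eqP->].
  by rewrite [RHS]big_mkcondr /=; apply: eq_bigr => z _; case: eqP.
have QQ : Q * Q = 1 by rewrite -big_split big1 //= => v _; rewrite relative_sign_sqr.
by rewrite -mulrA -mulrA QQ mulr1 -eP mulrA match_sign_sqr mul1r.
Qed.

End OneFactorizations.

(** * Translations of two copies of Z_p *)

Lemma orbit_sum_dvd (gT : finGroupType) (D G : {group gT}) (T : finType)
    (to : action D T) (A : {set T}) (f : T -> int) :
  [acts G, on A | to] ->
  (forall x g, x \in A -> g \in G -> f (to x g) = f x) ->
  (forall x, x \in A -> 'C_G[x | to]%g = 1%g) ->
  (#|G|%:Z %| \sum_(x in A) f x)%Z.
Proof.
move=> actsA f_inv free; rewrite (set_partition_big _ (orbit_partition actsA)) /=.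
apply: rpred_sum => _ /imsetP[x xA ->].
have -> : \sum_(y in orbit to G x) f y = f x *+ #|G|.
  have <- : #|orbit to G x| = #|G|.
    by rewrite -(card_orbit_in_stab to x (acts_dom actsA)) free // cards1 muln1.
  by rewrite -sumr_const; apply: eq_bigr => _ /imsetP[g gG ->]; apply: f_inv.
by rewrite -mulr_natl natz dvdz_mulr.
Qed.

Section FixedElements.

Variables (V : finType) (p : nat).
Hypothesis p_pr : prime p.
Implicit Types (m s : {perm V}) (F : {set {perm V}}).

(** [A] is a union of edges of [m]. The parity is read off a product of -1 over [A], grouped along
    these edges. *)
Lemma fpf_even_stable m (A : {set V}) : fpf_involution m ->
  (forall v, (m v \in A) = (v \in A)) -> ~~ odd #|A|.
Proof.
move=> fm stab; have k_inj : injective (fun v : V => enum_rank v : nat).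
  by move=> v w /ord_inj /enum_rank_inj.
have : \prod_v (if v \in A then -1 else 1 : int) = 1.
  rewrite (prod_fpf_involution _ fm k_inj) big1 // => v _.
  by rewrite stab; case: ifP.
by rewrite -big_mkcond /= prodr_const -signr_odd; case: odd.
Qed.

Lemma card_fixed_mod F s : (s ^+ p = 1)%g -> (F :^ s)%g = F ->
  #|F| = #|[set m in F | m ^ s == m]%g| %[mod p].
Proof.
move=> sp sF; have pG : (p.-group <[s]>)%g.
  by rewrite /pgroup -orderE (@pnat_dvd _ p) ?pnat_id // order_dvdn sp.
have acts : [acts <[s]>, on F | 'J]%g.
  by rewrite astabsJ cycle_subG; apply/normP.
rewrite (pgroup_fix_mod pG acts); congr (_ %% _)%N; apply: eq_card => m.
rewrite in_setI inE; congr (_ && _); rewrite afixJ cent_cycle.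
apply/cent1P/eqP => [c|c]; last by rewrite /commute conjgC c.
by rewrite conjgE c mulKg.
Qed.

End FixedElements.

Section TwoCopies.

Variable p : nat.
Hypotheses (p_pr : prime p) (p_odd : odd p).

Local Notation V := ('F_p * bool)%type.
Implicit Types (i j d x y : 'F_p) (b : bool) (v w : V) (F : {set {perm V}}).

Lemma Fp_ltn x : (x < p)%N.
Proof. by rewrite -[X in (_ < X)%N](Fp_cast p_pr) ltn_ord. Qed.

Lemma Fp_mulrn_eq0 x : x *+ p = 0.
Proof. by rewrite -mulr_natr (pcharf0 (pchar_Fp p_pr)) mulr0. Qed.

Lemma Fp_natr_val x : (x : nat)%:R = x.
Proof. exact: natr_Zp. Qed.

Lemma Fp_add_eq0 x : (x + x == 0) = (x == 0).
Proof.
apply/eqP/eqP => [xx|->]; last by rewrite addr0.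
have pE : p = (p./2).*2.+1 by rewrite -[LHS]odd_double_half p_odd.
have : x *+ (p./2).*2.+1 = 0 by rewrite -pE Fp_mulrn_eq0.
by rewrite mulrS -addnn mulrnDr -mulrnDl xx mul0rn addr0.
Qed.

Lemma card_two_copies : #|[the finType of V]| = (2 * p)%N.
Proof. by rewrite card_prod card_Fp // card_bool mulnC. Qed.

Lemma card_two_copies_even : ~~ odd #|[the finType of V]|.
Proof. by rewrite card_two_copies oddM. Qed.

Definition two_copies_key v : nat := (v.1 + p * v.2)%N.

Lemma two_copies_key_inj : injective two_copies_key.
Proof.
move=> [x b] [y c]; rewrite /two_copies_key /= => e.
have [hx hy] := (Fp_ltn x, Fp_ltn y).
have bc : b = c by clear p_odd; case: b c e => [] [] //=; lia.
by move: e; rewrite bc => /addIn /val_inj ->.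
Qed.

Definition shift_fun i j v : V := (v.1 + (if v.2 then j else i), v.2).

Lemma shift_fun_inj i j : injective (shift_fun i j).
Proof.
move=> [x b] [y c] e; have /= bc := congr1 snd e; have /= := congr1 fst e.
by rewrite bc => /addIr ->.
Qed.

Definition shift i j : {perm V} := perm (@shift_fun_inj i j).

Lemma shiftE i j v : shift i j v = (v.1 + (if v.2 then j else i), v.2).
Proof. by rewrite permE. Qed.

Lemma shiftM i j i' j' : (shift i j * shift i' j')%g = shift (i + i') (j + j').
Proof.
by apply/permP => v; rewrite permM !shiftE /= -addrA; case: ifP.
Qed.

Lemma shift0 : shift 0 0 = 1%g.
Proof. by apply/permP => -[x b]; rewrite shiftE perm1 if_same addr0. Qed.

Lemma shiftX i j n : (shift i j ^+ n)%g = shift (i *+ n) (j *+ n).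
Proof. by elim: n => [|n IH]; rewrite ?shift0 // expgS IH shiftM -!mulrS. Qed.

Lemma shiftXp i j : (shift i j ^+ p)%g = 1%g.
Proof. by rewrite shiftX !Fp_mulrn_eq0 shift0. Qed.

Lemma shift_diag i : shift i i = (shift 1%R 1%R ^+ i)%g.
Proof. by rewrite shiftX !Fp_natr_val. Qed.

Lemma shiftV i j : (shift i j)^-1%g = shift (- i) (- j).
Proof. by apply/eqP; rewrite eq_invg_mul shiftM !subrr shift0. Qed.

Definition scale_fun c v : V := if v.2 then (c * v.1, v.2) else v.

Lemma scale_fun_inj c : c != 0 -> injective (scale_fun c).
Proof.
move=> c0 [x b] [y b']; rewrite /scale_fun /= => e.
have bb : b = b' by have := congr1 snd e; case: (b); case: (b').
by subst b'; case: b e => e; have /= := congr1 fst e; [move/(mulfI c0) -> | move->].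
Qed.

Definition scale c (c0 : c != 0) : {perm V} := perm (scale_fun_inj c0).

Lemma shift_scale c (c0 : c != 0) i j : (shift i j ^ scale c0)%g = shift i (c * j).
Proof.
rewrite conjgE; apply: (mulgI (scale c0)); rewrite mulgA mulgV mul1g.
apply/permP => -[x b]; rewrite !permM !shiftE !permE /scale_fun /=.
by case: b => /=; rewrite ?mulrDr.
Qed.

Definition cross_fun i v : V := (if v.2 then v.1 - i else v.1 + i, ~~ v.2).

Lemma cross_funK i : involutive (cross_fun i).
Proof. by move=> [x []]; rewrite /cross_fun /= ?subrK ?addrK. Qed.

Definition cross i : {perm V} := perm (inv_inj (cross_funK i)).

Lemma crossE i v : cross i v = (if v.2 then v.1 - i else v.1 + i, ~~ v.2).
Proof. by rewrite permE. Qed.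

Lemma cross_fpf i : fpf_involution (cross i).
Proof.
apply/forallP => -[x b]; rewrite !permE cross_funK eqxx andbT /cross_fun /=.
by rewrite xpair_eqE; case: b; rewrite andbF.
Qed.

Lemma crossJ k i j : (cross k ^ shift i j)%g = cross (k + j - i).
Proof.
rewrite conjgE; apply: (mulgI (shift i j)); rewrite mulgA mulgV mul1g.
by apply/permP => -[x b]; rewrite !permM !(shiftE, crossE) /=; case: b => /=; congr (_, _);
  ring.
Qed.

Lemma cross_inj : injective cross.
Proof.
by move=> i j /permP/(_ (0, false)); rewrite !crossE /= !add0r => /(congr1 fst).
Qed.

(* A shift fixing one copy pointwise and no vertex of the other one centralizes
   some factor, which then pairs up the [p] vertices of the fixed copy. *)
Lemma not_fixed_half_shift F i j : one_fact F -> (i == 0) != (j == 0) ->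
  (F :^ shift i j)%g != F.
Proof.
move=> oF ij; apply/eqP => sF; have cF := card_fixed_mod p_pr (shiftXp i j) sF.
have [m] : exists m, m \in [set m in F | m ^ shift i j == m]%g.
  apply/card_gt0P; rewrite lt0n; apply: contra_eqN cF => /eqP->.
  rewrite (card_one_fact (0, false) oF) card_two_copies mod0n -/(dvdn _ _) -subn1.
  have pgt := prime_gt1 p_pr.
  by rewrite dvdn_subr ?dvdn_mull ?dvdn1 ?muln_gt0 //; lia.
rewrite inE => /andP[mF /eqP cm].
have fm := one_fact_fpf oF mF.
have mE v : m (shift i j v) = shift i j (m v) by rewrite -{1}cm permJ.
pose A := [set v | shift i j v == v].
have : ~~ odd #|A|.
  apply: (fpf_even_stable fm) => v; rewrite !inE -mE; exact: (inj_eq perm_inj).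
have -> : A = [set (x, i != 0) | x : 'F_p].
  apply/setP => -[x b]; rewrite inE shiftE xpair_eqE eqxx andbT /=.
  rewrite -subr_eq0 addrAC subrr add0r.
  apply/idP/imsetP => [|[y _ [_ ->]]].
    move=> h; exists x => //; congr (_, _); move: ij h.
    by case: (b); case: (i == 0); case: (j == 0).
  by case: (eqVneq i 0) ij => [->|_] /=; rewrite ?eqxx //; case: (j == 0).
by rewrite card_imset ?card_Fp ?p_odd // => x y [].
Qed.

End TwoCopies.

(** * Orbits under the [p ^ 2] shifts *)

Section ShiftOrbits.

Variable p : nat.
Hypotheses (p_pr : prime p) (p_odd : odd p).

Local Notation V := ('F_p * bool)%type.
Implicit Types (i j k : 'F_p) (F : {set {perm V}}).

Definition shifts : {set {perm V}} := [set shift z.1 z.2 | z : 'F_p * 'F_p].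

Lemma shifts_group_set : group_set shifts.
Proof.
apply/group_setP; split; first by apply/imsetP; exists (0, 0); rewrite ?shift0.
move=> _ _ /imsetP[[i j] _ ->] /imsetP[[i' j'] _ ->].
by apply/imsetP; exists (i + i', j + j'); rewrite ?shiftM.
Qed.

Canonical shifts_group := Group shifts_group_set.

Lemma shift_inj i j i' j' : shift i j = shift i' j' -> i = i' /\ j = j'.
Proof.
move=> /permP e; have := e (0, false); have := e (0, true); rewrite !shiftE /= !add0r.
by move=> /(congr1 fst) /= -> /(congr1 fst) /= ->.
Qed.

Lemma card_shifts : #|shifts| = (p ^ 2)%N.
Proof.
rewrite card_imset; first by rewrite card_prod card_Fp // mulnn.
by move=> [i j] [i' j'] /shift_inj [/= -> ->].
Qed.

Lemma shiftC i j i' j' : commute (shift i j) (shift i' j').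
Proof. by rewrite /commute !shiftM addrC [j' + j]addrC. Qed.

Lemma conjs_shiftC F i j i' j' :
  ((F :^ shift i j) :^ shift i' j')%g = ((F :^ shift i' j') :^ shift i j)%g.
Proof. by rewrite -!conjsgM shiftC. Qed.

Definition free_fact F :=
  [forall z : 'F_p * 'F_p, (F :^ shift z.1 z.2 == F)%g ==> (z == (0, 0))].

Lemma sum_free_fact_dvd :
  ((p ^ 2)%N%:Z %| \sum_(F | one_fact F && free_fact F)
     fact_sign (@two_copies_key p) F)%Z.
Proof.
pose A := [set F | one_fact F && free_fact F].
rewrite -card_shifts (eq_bigl (mem A)) => [|F]; last by rewrite !inE.
apply: (@orbit_sum_dvd _ _ shifts_group _ ('Js)%act).
- apply/actsP => _ /imsetP[[i j] _ ->] F /=; rewrite !inE.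
  have h F' i' j' : one_fact F' && free_fact F' ->
      one_fact (F' :^ shift i' j')%g && free_fact (F' :^ shift i' j')%g.
    case/andP=> oF /forallP fr; rewrite one_factJ //=; apply/forallP => z.
    rewrite conjs_shiftC (inj_eq (act_inj _ _)); exact: fr.
  apply/idP/idP => [/(h _ (- i) (- j))|/h//].
  by rewrite -conjsgM shiftM !subrr shift0 conjsg1.
- move=> F g; rewrite inE => /andP[oF _] _.
  exact: (fact_signJ _ (card_two_copies_even p_pr) oF (two_copies_key_inj p_pr)).
move=> F; rewrite inE => /andP[_ /forallP fr].
rewrite astab1Js; apply/trivgP/subsetP => g /setIP[/imsetP[z _ ->] /normP/eqP].
by move: (fr z) => /implyP h /h/eqP->; rewrite shift0 set11.
Qed.

(** The quotient of the two shifts fixes [F] as well and moves one copy only, which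
    [not_fixed_half_shift] forbids. *)
Lemma shift_fixed_unique F i j i' j' : one_fact F ->
  (F :^ shift i j = F)%g -> (F :^ shift i' j' = F)%g -> i = i' -> j = j'.
Proof.
move=> oF e e' ii; apply/eqP; apply: contraT => jj.
have := not_fixed_half_shift p_pr p_odd oF (i := i - i') (j := j - j').
rewrite ii subrr eqxx subr_eq0 (negPf jj) => /(_ isT)/eqP[].
rewrite -(subrr i) {2}ii -shiftM -shiftV conjsgM e -{1}e' -conjsgM mulgV conjsg1.
by [].
Qed.

(** A nontrivial stabilizer contains a shift with both components nonzero, and a power of it has
    first component 1. Its second component is then unique. *)
Lemma free_factP F : one_fact F ->
  (\sum_(k : 'F_p | k != 0%R) (F :^ shift 1%R k == F)%g = ~~ free_fact F)%N.
Proof.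
move=> oF; case: (boolP (free_fact F)) => [/forallP fr|].
  rewrite big1 // => k k0; move/implyP: (fr (1, k)); case: eqP => //= _ /(_ isT).
  by rewrite xpair_eqE (negPf k0) andbF.
rewrite negb_forall => /existsP[[i j]]; rewrite negb_imply /= => /andP[/eqP e ne].
have i0 : i != 0.
  apply: contraNneq ne => i0; apply: contraT; rewrite xpair_eqE i0 eqxx /= => j0.
  have := not_fixed_half_shift p_pr p_odd oF (i := i) (j := j).
  by rewrite e eqxx i0 eqxx (negPf j0) => /(_ isT).
have j0 : j != 0.
  apply: contraT => /negPn/eqP j0.
  have := not_fixed_half_shift p_pr p_odd oF (i := i) (j := j).
  by rewrite e eqxx j0 eqxx (negPf i0) => /(_ isT).
pose n : nat := i^-1.
have eX : (F :^ (shift i j ^+ n) = F)%g.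
  by elim: (n) => [|k IH]; rewrite ?conjsg1 // expgSr conjsgM IH.
have nE : n%:R = i^-1 by rewrite Fp_natr_val.
rewrite shiftX -mulr_natr -[j *+ n]mulr_natr nE divff // in eX.
have ji0 : j / i != 0 by rewrite mulf_neq0 ?invr_eq0.
rewrite (bigD1 (j / i)) //= eX eqxx big1 // => k /andP[_ kj].
by apply/eqP; rewrite eqb0; apply: contraNneq kj => ek; apply/eqP/(shift_fixed_unique oF ek eX).
Qed.

(** Multiplying the second copy by [k] conjugates [shift 1 1] into [shift 1 k], and relabelings
    preserve signs. *)
Lemma sum_fixed_scale k : k != 0 ->
  \sum_(F | one_fact F && (F :^ shift 1%R k == F)%g) fact_sign (@two_copies_key p) F =
  \sum_(F | one_fact F && (F :^ shift 1%R 1%R == F)%g) fact_sign (@two_copies_key p) F.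
Proof.
move=> k0; rewrite (reindex_inj (act_inj ('Js)%act (scale k0))) /=.
apply: eq_big => [F|F /andP[oF _]].
  have e : (scale k0 * shift 1%R k = shift 1%R 1%R * scale k0)%g.
    by rewrite [RHS]conjgC shift_scale mulr1.
  rewrite one_factJE; congr (_ && _); rewrite -conjsgM e conjsgM.
  exact: (inj_eq (act_inj ('Js)%act _)).
rewrite one_factJE in oF.
exact: (fact_signJ _ (card_two_copies_even p_pr) oF (two_copies_key_inj p_pr)).
Qed.

Lemma sum_one_fact_mod :
  ((p ^ 2)%N%:Z %| \sum_(F | one_fact F) fact_sign (@two_copies_key p) F -
    (\sum_(F | one_fact F && (F :^ shift 1%R 1%R == F)%g)
       fact_sign (@two_copies_key p) F) *+ p.-1)%Z.
Proof.
rewrite (bigID free_fact) /= -addrA; apply: rpredD; first exact: sum_free_fact_dvd.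
rewrite [X in X - _](_ : _ = \sum_(k : 'F_p | k != 0)
    \sum_(F | one_fact F && (F :^ shift 1%R k == F)%g) fact_sign (@two_copies_key p) F).
  rewrite (eq_bigr _ sum_fixed_scale) (eq_bigl (mem (predC1 (0 : 'F_p)))) //.
  by rewrite sumr_const cardC1 card_Fp // subrr rpred0.
rewrite (eq_bigr (fun k => \sum_(F | one_fact F) fact_sign (@two_copies_key p) F *+
    (F :^ shift 1%R k == F)%g)); last first.
  by move=> k _; rewrite big_mkcondr; apply: eq_bigr => F _; case: eqP.
rewrite exchange_big big_mkcondr /=; apply: eq_bigr => F oF.
by rewrite sumrMnr free_factP //; case: free_fact.
Qed.

End ShiftOrbits.

(** * One-factorizations fixed by the diagonal shift *)

Section FixedFactorizations.

Variable p : nat.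
Hypotheses (p_pr : prime p) (p_odd : odd p).

Local Notation V := ('F_p * bool)%type.
Implicit Types (i j k x : 'F_p) (b : bool) (m : {perm V}) (F : {set {perm V}}).

Local Notation tau := (shift 1%R 1%R : {perm V}).

Lemma commute_diag_shift m i : (m ^ tau)%g = m -> (m ^ shift i i)%g = m.
Proof.
by move=> c; rewrite shift_diag //; elim: (i : nat) => [|n IH];
  rewrite ?conjg1 // expgSr conjgM IH.
Qed.

Lemma conjs_diag_shift F i : (F :^ tau)%g = F -> (F :^ shift i i)%g = F.
Proof.
by move=> c; rewrite shift_diag //; elim: (i : nat) => [|n IH];
  rewrite ?conjsg1 // expgSr conjsgM IH.
Qed.

Lemma perm_diag_shift m x i b : (m ^ shift i i)%g = m ->
  m (x + i, b) = ((m (x, b)).1 + i, (m (x, b)).2).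
Proof.
move=> c; have -> : (x + i, b) = shift i i (x, b) by rewrite shiftE /= if_same.
by rewrite -{1}c permJ shiftE if_same.
Qed.

(** Such a factor is determined by the partner of [(0, false)]. If this partner lay in the same copy
    at distance [k], involutivity would give [k + k = 0], hence a fixed point. *)
Lemma fixed_is_cross m : fpf_involution m -> (m ^ tau)%g = m -> exists k, m = cross k.
Proof.
move=> fm cm; have mE x b := perm_diag_shift 0 b (commute_diag_shift x cm).
case e : (m (0, false)) => [k c]; exists k.
have mf x : m (x, false) = (x + k, c) by rewrite -[x]add0r mE e /= add0r addrC.
have := fpfK fm (0, false); rewrite e; case: c {e} mf => mf => [ek|].
  have mt x : m (x, true) = (x - k, false) by rewrite -[x](subrK k) -(mf (x - k)) fpfK // addrK.
  by apply/permP => -[x []]; rewrite crossE /= ?mf ?mt.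
rewrite mf => /(congr1 fst) /= /eqP; rewrite Fp_add_eq0 // => /eqP k0.
by have := fpf_neq (0, false) fm; rewrite mf k0 addr0 eqxx.
Qed.

Lemma cross_fixed k i : (cross k ^ shift i i)%g = cross k.
Proof. by rewrite crossJ addrK. Qed.

(** The number of fixed factors is [2 p - 1] modulo [p]. They are crosses, so there are at most [p]
    of them, hence exactly [p - 1]. *)
Lemma card_cross_fixed F : one_fact F -> (F :^ tau)%g = F ->
  #|[set k | cross k \notin F]| = 1%N.
Proof.
move=> oF sF; have := card_fixed_mod p_pr (shiftXp p_pr 1 1) sF.
have -> : [set m in F | m ^ tau == m]%g = @cross p @: [set k | cross k \in F].
  apply/setP => m; apply/idP/imsetP => [|[k]]; rewrite !inE.
    case/andP=> mF /eqP/(fixed_is_cross (one_fact_fpf oF mF))[k mk].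
    by exists k; rewrite // inE -mk.
  by move=> kF ->; rewrite kF cross_fixed eqxx.
rewrite card_imset; last exact: cross_inj.
rewrite (card_one_fact (0, false) oF) card_two_copies //.
have := cardsC [set k | cross k \in F]; rewrite card_Fp //.
rewrite (_ : ~: _ = [set k | cross k \notin F]); last by apply/setP => k; rewrite !inE.
move: #|_| #|_| => a c acp; have pgt := prime_gt1 p_pr.
have -> : ((2 * p).-1 = p.-1 + p)%N by lia.
rewrite modnDr modn_small; last by lia.
have [ap|pa] := ltnP c p; first by rewrite modn_small //; lia.
have -> : c = p by lia.
by rewrite modnn; lia.
Qed.

Definition base_fact F :=
  [&& one_fact F, (F :^ tau == F)%g & cross 0 \notin F].

(** Shifting the second copy by [k] moves the missing cross from [cross 0] to [cross k], so each of
    the [p] possible missing crosses contributes the same sum. *)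
Lemma sum_fixed_base :
  \sum_(F | one_fact F && (F :^ tau == F)%g) fact_sign (@two_copies_key p) F =
  (\sum_(F | base_fact F) fact_sign (@two_copies_key p) F) *+ p.
Proof.
transitivity (\sum_(k : 'F_p) \sum_(F | [&& one_fact F, (F :^ tau == F)%g & cross k \notin F])
    fact_sign (@two_copies_key p) F).
  rewrite (exchange_big_dep (fun F => one_fact F && (F :^ tau == F)%g)) /=; last first.
    by move=> k F _ /and3P[-> ->].
  apply: eq_bigr => F /andP[oF /eqP sF].
  rewrite -[LHS]mulr1n -(card_cross_fixed oF sF) -sumr_const.
  by apply: eq_bigl => k; rewrite inE oF sF eqxx.
set T := \sum_(F | base_fact F) _; have <- : \sum_(k : 'F_p) T = T *+ p.
  by rewrite sumr_const card_Fp.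
apply: eq_bigr => k _; rewrite /T.
rewrite (reindex_inj (act_inj ('Js)%act (shift 0 k))) /=.
apply: eq_big => [F|F /andP[oF _]].
  rewrite one_factJE /base_fact -conjs_shiftC (inj_eq (act_inj ('Js)%act _)).
  have -> : cross k = (cross 0 ^ shift 0 k)%g by rewrite crossJ add0r subr0.
  by rewrite memJ_conjg.
rewrite one_factJE in oF.
exact: (fact_signJ _ (card_two_copies_even p_pr) oF (two_copies_key_inj p_pr)).
Qed.

End FixedFactorizations.

(** * Pairs of starters and the factorizations that they generate *)

Section Starters.

Variable p : nat.
Hypotheses (p_pr : prime p) (p_odd : odd p).

Local Notation V := ('F_p * bool)%type.
Implicit Types (i j k d x y : 'F_p) (b : bool) (m : {perm V}) (F : {set {perm V}}).
Implicit Types (q r : {perm 'F_p}).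

Local Notation tau := (shift 1%R 1%R : {perm V}).

(* The pairs [{q d, q (-d)}] have every nonzero difference exactly once. *)
Definition starter q := (q 0 == 0) && [forall d, q (- d) == q d + d].

Lemma starter0 q : starter q -> q 0 = 0.
Proof. by case/andP => /eqP. Qed.

Lemma starterN q d : starter q -> q (- d) = q d + d.
Proof. by case/andP => _ /forallP/(_ d)/eqP. Qed.

Definition copies_fun q r (v : V) : V := ((if v.2 then r else q) v.1, v.2).

Lemma copies_fun_inj q r : injective (copies_fun q r).
Proof.
move=> [x b] [y c] e; have /= bc := congr1 snd e; have /= := congr1 fst e.
by rewrite bc => /perm_inj ->.
Qed.

Definition copies q r : {perm V} := perm (@copies_fun_inj q r).

Lemma copiesE q r x b : copies q r (x, b) = ((if b then r else q) x, b).
Proof. by rewrite permE. Qed.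

(** A reference matching without crossings in the order [two_copies_key]; the remaining factors are
    its images. *)
Definition nest_fun (v : V) : V := if v.1 == 0 then (0, ~~ v.2) else (- v.1, v.2).

Lemma nest_funK : involutive nest_fun.
Proof.
move=> [x b]; rewrite /nest_fun; have [->|x0] := eqVneq x 0.
  by rewrite /= negbK.
by rewrite /= oppr_eq0 (negPf x0) opprK.
Qed.

Definition nest : {perm V} := perm (inv_inj nest_funK).

Lemma nestE x b : nest (x, b) = if x == 0 then (0, ~~ b) else (- x, b).
Proof. by rewrite permE. Qed.

Lemma nest_fpf : fpf_involution nest.
Proof.
apply/forallP => v; rewrite !permE nest_funK eqxx andbT; case: v => x b.
rewrite /nest_fun /=; have [->|x0] := eqVneq x 0; rewrite xpair_eqE.
  by case: b; rewrite andbF.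
by rewrite eqxx andbT -subr_eq0 -opprD oppr_eq0 Fp_add_eq0.
Qed.

(** By the starter equation its edges inside the first copy are [{q d + i, q d + d + i}], likewise
    with [r] in the second; its one edge between the copies lies over [i]. *)
Definition slant q r i : {perm V} := (nest ^ (copies q r * shift i i))%g.

Lemma slant_fpf q r i : fpf_involution (slant q r i).
Proof. by rewrite fpf_involutionJ nest_fpf. Qed.

Lemma slantE q r i d b : starter q -> starter r ->
  slant q r i ((if b then r else q) d + i, b) =
    if d == 0 then (i, ~~ b) else ((if b then r else q) d + d + i, b).
Proof.
move=> sq sr; have -> : ((if b then r else q) d + i, b) = (copies q r * shift i i)%g (d, b).
  by rewrite permM copiesE shiftE /= if_same.
rewrite permJ nestE; case: (d == 0); rewrite permM copiesE shiftE /= if_same.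
  by case: b; rewrite /= starter0 // add0r.
by case: b; rewrite starterN.
Qed.

Lemma slant_base q r i b : starter q -> starter r -> slant q r i (i, b) = (i, ~~ b).
Proof.
move=> sq sr; have := slantE i 0 b sq sr; rewrite eqxx => <-.
by case: b; rewrite starter0 // add0r.
Qed.

Lemma slant_shift q r i j : (slant q r i ^ shift j j)%g = slant q r (i + j).
Proof. by rewrite /slant -conjgM -mulgA shiftM. Qed.

Lemma slant_level q r i x b c : starter q -> starter r ->
  slant q r i (x, b) = (x, c) -> i = x.
Proof.
move=> sq sr; pose s := if b then r else q.
have -> : x = s (s^-1%g (x - i)) + i by rewrite permKV subrK.
rewrite slantE // -/s; case: eqP => [-> _|/eqP d0 /(congr1 fst) /=].
  by rewrite /s; case: (b); rewrite starter0 // add0r.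
by rewrite addrAC -[RHS]addr0 => /addrI /eqP; rewrite (negPf d0).
Qed.

Definition assemble q r : {set {perm V}} :=
  [set cross k | k in predC1 0] :|: [set slant q r i | i : 'F_p].

Lemma cross_neq_slant q r k i : starter q -> starter r -> k != 0 -> cross k != slant q r i.
Proof.
move=> sq sr; apply: contraNneq => /permP/(_ (i, false)).
by rewrite crossE slant_base //= => /(congr1 fst) /= /eqP; rewrite -subr_eq0 addrAC subrr add0r.
Qed.

Lemma slant_inj q r : starter q -> starter r -> injective (slant q r).
Proof.
move=> sq sr i j e; apply/esym/(slant_level (q := q) (r := r) (b := false) (c := true)) => //.
by rewrite -e slant_base.
Qed.

(** Each vertex has [2 p - 1] possible partners, so at most [2 p - 1] factors reach all of them only
    if none is reached twice. *)
Lemma one_fact_card_le (F : {set {perm V}}) :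
  (forall m, m \in F -> fpf_involution m) ->
  (forall u v : V, u != v -> exists2 m, m \in F & m u = v) ->
  (#|F| <= (2 * p).-1)%N -> one_fact F.
Proof.
move=> fF exF cF; apply: one_factP => // m m' u mF m'F e.
have : [set~ u] \subset [set (fun m : {perm V} => m u) m | m in F].
  apply/subsetP => v; rewrite !inE eq_sym => /exF[n nF <-].
  by apply/imsetP; exists n.
move=> /subset_leq_card; rewrite cardsC1 card_two_copies // => le.
have /imset_injP inj : #|[set (fun m : {perm V} => m u) m | m in F]| == #|F|.
  by rewrite eqn_leq leq_imset_card (leq_trans cF).
exact: inj.
Qed.

Lemma card_assemble q r : (#|assemble q r| <= (2 * p).-1)%N.
Proof.
apply: leq_trans (leq_card_setU _ _) _.
have -> : ((2 * p).-1 = p.-1 + p)%N by have := prime_gt0 p_pr; lia.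
apply: leq_add; apply: leq_trans (leq_imset_card _ _) _; rewrite ?cardC1 card_Fp //.
Qed.

Lemma assemble_base q r : starter q -> starter r -> base_fact (assemble q r).
Proof.
move=> sq sr; apply/and3P; split.
- apply: one_fact_card_le (card_assemble q r).
    move=> m; rewrite inE => /orP[] /imsetP[k _ ->]; [exact: cross_fpf|exact: slant_fpf].
  move=> [x b] [y c] ne.
  case: (eqVneq b c) ne => [<-|bc] ne.
    have {}ne : x != y by apply: contraNneq ne => ->.
    (* The starter has the difference [y - x] at the point [s (y - x)]; this [i] translates that
       point to [x]. *)
    pose s := if b then r else q; pose i := x - s (y - x).
    exists (slant q r i); first by rewrite inE [X in _ || X]imset_f ?orbT.
    have xE : x = s (y - x) + i by rewrite addrC subrK.
    rewrite {1}xE slantE // subr_eq0 eq_sym (negPf ne) -/s; congr (_, _).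
    by rewrite addrAC -xE addrC subrK.
  have {bc} -> : c = ~~ b by case: b c bc {ne} => [] [].
  have [->|xy] := eqVneq y x.
    by exists (slant q r x); rewrite ?slant_base // inE [X in _ || X]imset_f ?orbT.
  exists (cross (if b then x - y else y - x)); last first.
    by rewrite crossE /=; congr (_, _); case: b {ne} => //=; ring.
  rewrite inE imset_f // !inE; case: b {ne}; rewrite subr_eq0 // eq_sym //.
- apply/eqP/setP => m; rewrite mem_conjg.
  have h n i : n \in assemble q r -> (n ^ shift i i)%g \in assemble q r.
    rewrite !inE => /orP[] /imsetP[k kin ->].
      by rewrite cross_fixed // imset_f.
    by rewrite slant_shift [X in _ || X]imset_f ?orbT.
  rewrite shiftV; apply/idP/idP => [/(h _ 1)|mA]; last exact: h.
  by rewrite -conjgM shiftM addNr shift0 conjg1.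
rewrite /assemble in_setU; apply/norP; split; apply/imsetP => -[k kin].
  by move/cross_inj => k0; move: kin; rewrite -k0 !inE eqxx.
move/permP => /(_ (k + q 1, false)).
rewrite crossE addr0 /= addrC (slantE k 1 false sq sr) oner_eq0.
by move/(congr1 snd).
Qed.

(** The factor through the two zeros is [slant q r 0], and for nonzero [d] the only vertex that it
    moves by [d] inside a copy is [q d], respectively [r d]. *)
Lemma assemble_inj q r q' r' : starter q -> starter r -> starter q' -> starter r' ->
  assemble q r = assemble q' r' -> q = q' /\ r = r'.
Proof.
move=> sq sr sq' sr' e.
have oF : one_fact (assemble q r) by case/and3P: (assemble_base sq sr).
have s0 : slant q r 0 = slant q' r' 0.
  apply: (one_fact_inj (u := (0, false)) oF).
  - by rewrite inE [X in _ || X]imset_f ?orbT.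
  - by rewrite e inE [X in _ || X]imset_f ?orbT.
  - by rewrite !slant_base.
suff h b : (if b then r else q) = (if b then r' else q').
  by split; [exact: (h false)|exact: (h true)].
apply/permP => d; have [->|d0] := eqVneq d 0.
  by case: b; rewrite !starter0.
set s := if b then r else q; set s' := if b then r' else q'.
have := slantE 0 d b sq sr; rewrite (negPf d0) -/s !addr0 s0.
pose a := s'^-1%g (s d); have sa : s d = s' a by rewrite permKV.
rewrite {1}sa; have := slantE 0 a b sq' sr'; rewrite -/s' !addr0 => ->.
case: eqP => [_ /(congr1 snd) /=|_ /(congr1 fst) /=]; first by case: (b).
by rewrite -sa => /addrI ad; rewrite sa ad.
Qed.

End Starters.

Section BaseFactorizations.

Variable p : nat.
Hypotheses (p_pr : prime p) (p_odd : odd p).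

Local Notation V := ('F_p * bool)%type.
Implicit Types (i j k d x y v w : 'F_p) (b : bool) (m : {perm V}) (F : {set {perm V}}).
Implicit Types (q r : {perm 'F_p}).

Local Notation tau := (shift 1%R 1%R : {perm V}).

Lemma base_cross_in F k : base_fact F -> k != 0 -> cross k \in F.
Proof.
case/and3P=> oF /eqP sF c0 k0; apply: contraT => ck.
have /eqP/cards1P[x e] := card_cross_fixed p_pr p_odd oF sF.
have : 0 \in [set k | cross k \notin F] by rewrite inE.
have : k \in [set k | cross k \notin F] by rewrite inE.
by rewrite e !inE => /eqP kx /eqP x0; move: k0; rewrite kx x0 eqxx.
Qed.

Section LevelFactor.

Variables (F : {set {perm V}}) (N : {perm V}).
Hypotheses (bF : base_fact F) (NF : N \in F) (N0 : N (0, false) = (0, true)).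

Let oF : one_fact F. Proof. by case/and3P: bF. Qed.
Let sF : (F :^ tau)%g = F. Proof. by case/and3P: bF => _ /eqP. Qed.

Lemma level_shift_in i : (N ^ shift i i)%g \in F.
Proof. by rewrite -(conjs_diag_shift i sF) memJ_conjg. Qed.

Lemma level_shiftE i x b :
  (N ^ shift i i)%g (x + i, b) = ((N (x, b)).1 + i, (N (x, b)).2).
Proof.
have -> : (x + i, b) = shift i i (x, b) by rewrite shiftE /= if_same.
by rewrite permJ shiftE if_same.
Qed.

(** If a nonzero diagonal shift fixed [N], all of them would, and [N] would be a cross through the
    two zeros: the excluded [cross 0]. *)
Lemma level_shift_neq i : (N ^ shift i i)%g = N -> i = 0.
Proof.
move=> e; apply/eqP; apply: contraT => i0.
have eX n : (N ^ (shift i i ^+ n))%g = N.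
  by elim: n => [|n IH]; rewrite ?conjg1 // expgSr conjgM IH.
have e1 : (N ^ tau)%g = N.
  rewrite -[RHS](eX (i^-1 : 'F_p)) shiftX -[i *+ _]mulr_natr Fp_natr_val.
  by rewrite divff.
have [k Nk] := fixed_is_cross p_pr p_odd (one_fact_fpf oF NF) e1.
have k0 : k = 0 by move: N0; rewrite Nk crossE /= add0r => /(congr1 fst).
by case/and3P: bF => _ _; rewrite -k0 -Nk NF.
Qed.

(** Take the factor through [(0, b)] and [(d, b)]. As [p] is odd, it has an edge between the copies.
    This edge joins equal coordinates, since otherwise the factor would be a cross; so the factor is
    a translate of [N]. *)
Lemma level_diff_ex d b : d != 0 -> exists v, N (v, b) = (v + d, b).
Proof.
move=> d0; have ne : (0, b) != (d, b) by rewrite xpair_eqE eq_sym (negPf d0).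
have [m mF m0] := one_fact_ex oF ne; have fm := one_fact_fpf oF mF.
have [x mx] : exists x, (m (x, false)).2 = true.
  apply/existsP; apply: contraT; rewrite negb_exists => /forallP h.
  pose A := [set u : V | ~~ u.2].
  have hA u : u \in A -> m u \in A.
    by rewrite !inE; case: u => u [] //= _; move: (h u); case: (m _).2.
  have : ~~ odd #|A|.
    apply: (fpf_even_stable fm) => u; apply/idP/idP => [/hA|/hA//].
    by rewrite fpfK.
  have -> : A = [set (u, false) | u : 'F_p].
    apply/setP => -[u c]; rewrite inE; apply/idP/imsetP => [|[w _ /(congr1 snd) /= ->]] //.
    by case: c => // _; exists u.
  by rewrite card_imset ?card_Fp ?p_odd // => u w /(congr1 fst).
case e : (m (x, false)) mx => [y c] /= cE; rewrite cE {cE} in e.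
have [yx|yx] := eqVneq y x; last first.
  have mc : m = cross (y - x).
    apply: (one_fact_inj (u := (x, false)) oF mF).
      by apply: base_cross_in; rewrite // subr_eq0.
    by rewrite e crossE /= addrC subrK.
  by move: m0; rewrite mc crossE => /(congr1 snd) /=; case: (b).
have mN : m = (N ^ shift x x)%g.
  apply: (one_fact_inj (u := (x, false)) oF mF (level_shift_in x)).
  by have := level_shiftE x 0 false; rewrite add0r N0 e yx /= add0r => ->.
exists (- x); have := level_shiftE x (- x) b; rewrite addNr -mN m0.
case: (N _) => u c' e2; have /= du := congr1 fst e2; have /= bc := congr1 snd e2.
by rewrite du bc addrC addrK.
Qed.

(** A second place with difference [d] would make [N] share an edge with a proper translate of
    itself, and so coincide with it. *)
Lemma level_diff_inj d b v w :
  N (v, b) = (v + d, b) -> N (w, b) = (w + d, b) -> v = w.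
Proof.
move=> Nv Nw; apply/esym/eqP; rewrite -subr_eq0; apply/eqP/level_shift_neq.
apply: (one_fact_inj (u := (w, b)) oF (level_shift_in _) NF).
have e : w = v + (w - v) by rewrite addrC subrK.
have := level_shiftE (w - v) v b; rewrite -e Nv Nw /= => ->.
by rewrite addrAC -e.
Qed.

Lemma level_starter b : exists2 q, starter q &
  forall d, d != 0 -> N (q d, b) = (q d + d, b).
Proof.
(* [f d] is the point that [N] moves by [d]. The remaining point 0, matched across the copies,
   becomes the value at 0. *)
pose f d := if d == 0 then 0 else odflt 0 [pick v | N (v, b) == (v + d, b)].
have fE d : d != 0 -> N (f d, b) = (f d + d, b).
  move=> d0; rewrite /f (negPf d0); case: pickP => [v /eqP //|h].
  by have [v /eqP] := level_diff_ex b d0; rewrite h.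
have f0 : f 0 = 0 by rewrite /f eqxx.
have Nb : N (0, b) = (0, ~~ b).
  by case: b {f fE f0} => //; rewrite -N0 fpfK // (one_fact_fpf oF NF).
have f_neq0 d : d != 0 -> f d != 0.
  move=> d0; apply/eqP => fd; have := fE _ d0; rewrite fd Nb => /(congr1 snd) /=.
  by case: (b).
have f_inj : injective f.
  move=> d e; have [->|d0] := eqVneq d 0; have [->|e0] := eqVneq e 0 => //; rewrite ?f0.
  - by move=> h; have := f_neq0 _ e0; rewrite -h eqxx.
  - by move=> h; have := f_neq0 _ d0; rewrite h eqxx.
  move=> h; have := fE _ d0; rewrite h fE // => /(congr1 fst) /= /addrI.
  by [].
exists (perm f_inj) => [|d d0]; last by rewrite permE fE.
rewrite /starter permE f0 eqxx; apply/forallP => d; rewrite !permE.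
have [->|d0] := eqVneq d 0; first by rewrite oppr0 f0 addr0.
have Nd0 : - d != 0 by rewrite oppr_eq0.
apply/eqP/(level_diff_inj (b := b) (fE _ Nd0)).
by rewrite -(fE _ d0) fpfK ?addrK // (one_fact_fpf oF NF).
Qed.

End LevelFactor.

Lemma assemble_onto F : base_fact F -> exists q r,
  [/\ starter q, starter r & F = assemble q r].
Proof.
move=> bF; have oF : one_fact F by case/and3P: bF.
have sF : (F :^ tau)%g = F by case/and3P: bF => _ /eqP.
have [N NF N0] := one_fact_ex (u := (0, false)) (v := (0, true)) oF isT.
have [q sq qE] := level_starter bF NF N0 false.
have [r sr rE] := level_starter bF NF N0 true.
exists q, r; split=> //; apply/esym/eqP.
have oA : one_fact (assemble q r) by case/and3P: (assemble_base p_pr p_odd sq sr).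
rewrite eqEcard (card_one_fact (0, false) oF) (card_one_fact (0, false) oA) leqnn andbT.
have NE : N = slant q r 0.
  apply/permP => -[x b]; pose s := if b then r else q.
  have -> : x = s (s^-1%g x) + 0 by rewrite addr0 permKV.
  rewrite slantE // -/s; move: (s^-1%g x) => d; rewrite !addr0.
  have [->|d0] := eqVneq d 0.
    rewrite /s; case: (b) => /=; rewrite starter0 //.
    by rewrite -N0 fpfK // (one_fact_fpf oF NF).
  by rewrite /s; case: (b); [rewrite rE|rewrite qE].
apply/subsetP => m; rewrite inE => /orP[] /imsetP[k kin ->].
  by apply: base_cross_in => //; move: kin; rewrite inE.
by rewrite -[k]add0r -slant_shift -NE level_shift_in.
Qed.

Lemma sum_base_fact (f : {set {perm V}} -> int) :
  \sum_(F | base_fact F) f F =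
  \sum_(z : {perm 'F_p} * {perm 'F_p} | starter z.1 && starter z.2)
    f (assemble z.1 z.2).
Proof.
pose S := [set z : {perm 'F_p} * {perm 'F_p} | starter z.1 && starter z.2].
rewrite [RHS](eq_bigl (mem S)) => [|z]; last by rewrite !inE.
rewrite -(big_imset (h := fun z : {perm 'F_p} * {perm 'F_p} => assemble z.1 z.2) f) /=.
  apply: eq_bigl => F; apply/idP/imsetP => [/assemble_onto[q [r [sq sr ->]]]|[z]].
    by exists (q, r); rewrite // inE sq sr.
  by rewrite inE => /andP[sq sr] ->; apply: assemble_base.
move=> [q r] [q' r']; rewrite !inE /= => /andP[sq sr] /andP[sq' sr'].
by case/(assemble_inj p_pr p_odd sq sr sq' sr') => -> ->.
Qed.

End BaseFactorizations.

(** * The sign of an assembled factorization *)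

Section SignOfStarters.

Variable p : nat.
Hypotheses (p_pr : prime p) (p_odd : odd p).

Local Notation V := ('F_p * bool)%type.
Local Notation key := (@two_copies_key p).
Implicit Types (i j k d x y : 'F_p) (b : bool) (q r : {perm 'F_p}).

Lemma odd_copies q r : (copies q r : bool) = q (+) r :> bool.
Proof.
have M q1 r1 q2 r2 : (copies q1 r1 * copies q2 r2)%g = copies (q1 * q2) (r1 * r2).
  by apply/permP => -[x b]; rewrite permM !copiesE; case: b; rewrite permM.
have one : copies 1 1 = 1%g :> {perm V}.
  by apply/permP => -[x b]; rewrite copiesE perm1; case: b; rewrite perm1.
have Ml q1 q2 : copies (q1 * q2) 1 = (copies q1 1 * copies q2 1)%g by rewrite M mulg1.
have Mr q1 q2 : copies 1 (q1 * q2) = (copies 1 q1 * copies 1 q2)%g by rewrite M mulg1.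
have tl x y : copies (tperm x y) 1 = tperm (x, false) (y, false) :> {perm V}.
  apply/permP => -[z []]; rewrite copiesE ?perm1; first by rewrite tpermD // xpair_eqE andbF.
  case: tpermP => [->|->|/eqP h1 /eqP h2]; rewrite ?tpermL ?tpermR //.
  by rewrite tpermD // xpair_eqE eqxx andbT eq_sym.
have tr x y : copies 1 (tperm x y) = tperm (x, true) (y, true) :> {perm V}.
  apply/permP => -[z []]; rewrite copiesE ?perm1; last by rewrite tpermD // xpair_eqE andbF.
  case: tpermP => [->|->|/eqP h1 /eqP h2]; rewrite ?tpermL ?tpermR //.
  by rewrite tpermD // xpair_eqE eqxx andbT eq_sym.
rewrite -[q in LHS]mulg1 -[r in LHS]mul1g -M odd_permM; congr (_ (+) _).
  case: (prod_tpermP q) => ts -> _ {q}; elim: ts => [|[x y] ts IH].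
    by rewrite big_nil one !odd_perm1.
  by rewrite big_cons Ml !odd_permM IH tl !odd_tperm xpair_eqE eqxx andbT.
case: (prod_tpermP r) => ts -> _ {r}; elim: ts => [|[x y] ts IH].
  by rewrite big_nil one !odd_perm1.
by rewrite big_cons Mr !odd_permM IH tr !odd_tperm xpair_eqE eqxx andbT.
Qed.

Lemma odd_shift i j : (shift i j : bool) = false.
Proof.
(* A shift has odd order dividing [p], so it is a square. *)
have -> : shift i j = ((shift i j ^+ (uphalf p)) * (shift i j ^+ (uphalf p)))%g.
  rewrite -expgD addnn; have -> : ((uphalf p).*2 = p.+1)%N by lia.
  by rewrite expgS shiftXp // mulg1.
by rewrite odd_permM addbb.
Qed.

Lemma Fp_oppE x : x != 0 -> (- x : 'F_p) = (p - x)%N :> nat.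
Proof.
move=> x0; have x_gt0 : (0 < x)%N by rewrite lt0n; apply: contraNneq x0 => h; apply/eqP/val_inj.
move: (Fp_cast p_pr) (Fp_ltn p_pr x) x_gt0; rewrite /=.
by move: (nat_of_ord x) => a -> *; rewrite modn_small; lia.
Qed.

Lemma match_sign_nest : match_sign key (nest p) = 1.
Proof.
rewrite /match_sign (_ : [set z | _] = set0) ?cards0 //.
apply/setP => -[[x b] [y c]]; rewrite !inE !nestE /two_copies_key.
have [hx hy] := (Fp_ltn p_pr x, Fp_ltn p_pr y); have pgt := prime_gt1 p_pr.
move: (- x) (- y) (@Fp_oppE x) (@Fp_oppE y) => nx ny nxE nyE.
apply/negbTE/negP; have [x0|x0] := eqVneq x 0; have [y0|y0] := eqVneq y 0 => /=;
  rewrite ?nxE ?nyE ?x0 ?y0 //; case: b c => [] [] /=; clear p_odd; lia.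
Qed.

Lemma inversion_sign_copies x y : inversion_sign key (x, false) (y, true) = 1.
Proof.
rewrite /inversion_sign /two_copies_key ltnNge (_ : (_ <= _)%N) //=.
by have := Fp_ltn p_pr x; clear p_odd; lia.
Qed.

Lemma inversion_sign_same x y b :
  inversion_sign key (x, b) (y, b) = inversion_sign (@nat_of_ord _) x y.
Proof. by rewrite /inversion_sign /two_copies_key ltn_add2r. Qed.

(** Shifting the second copy is an even permutation and keeps the order of the ends of each edge, as
    these lie in different copies. *)
Lemma match_sign_cross k : match_sign key (cross k) = match_sign key (cross 0).
Proof.
have -> : cross k = (cross 0 ^ shift 0 k)%g by rewrite crossJ add0r subr0.
rewrite match_signJ_edges ?cross_fpf //; last exact: two_copies_key_inj.
rewrite odd_shift mulr1 big1 ?mulr1 // => -[x []].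
  rewrite crossE /two_copies_key; move: (x - 0) (Fp_ltn p_pr (x - 0)) => y hy /=.
  by clear p_odd; lia.
move=> _; rewrite crossE /relative_sign inversion_sign_copies mul1r.
by rewrite -(inversion_sign_copies (x + 0) (x + 0 + k)) /inversion_sign /= !shiftE.
Qed.

Lemma match_sign_slant q r i : starter q -> starter r ->
  match_sign key (slant q r i) = (-1) ^+ q * (-1) ^+ r *
    \prod_(v : V | (key v < key (nest p v))%N)
       relative_sign key (key \o (copies q r * shift i i)%g) v (nest p v).
Proof.
move=> sq sr; rewrite match_signJ_edges ?nest_fpf //; last exact: two_copies_key_inj.
by rewrite match_sign_nest mul1r odd_permM odd_shift addbF odd_copies signr_addb.
Qed.

(** For an edge [{x, -x}] of [nest] the product over all translations depends on [x] only, because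
    the starter equation fixes the difference of the two images. It occurs in both copies and
    cancels; the edge between the copies always keeps its order. *)
Lemma prod_relative_sign_nest q r : starter q -> starter r ->
  \prod_i \prod_(v : V | (key v < key (nest p v))%N)
       relative_sign key (key \o (copies q r * shift i i)%g) v (nest p v) = 1.
Proof.
move=> sq sr; pose G (v : V) := if (key v < key (nest p v))%N then \prod_i
  relative_sign key (key \o (copies q r * shift i i)%g) v (nest p v) else 1.
transitivity (\prod_v G v); first by rewrite exchange_big big_mkcond.
have -> : \prod_(v : V) G v = \prod_x \prod_b G (x, b).
  by rewrite pair_bigA; apply: eq_bigr => -[x b].
pose D x : int := \prod_y (inversion_sign (@nat_of_ord _) x (- x) *
  inversion_sign (@nat_of_ord _) y (y + x)).
have GE x b : x != 0 -> G (x, b) = if ((x : nat) < (- x : 'F_p))%N then D x else 1.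
  move=> x0; rewrite /G nestE (negPf x0) /two_copies_key ltn_add2r; case: ifP => // _.
  pose s := if b then r else q.
  rewrite /D [RHS](reindex_inj (addrI (s x))) /=; apply: eq_bigr => i _.
  have relE g v w : relative_sign key (key \o g) v w =
    inversion_sign key v w * inversion_sign key (g v) (g w) by [].
  have sN : s (- x) = s x + x by rewrite /s; case: (b); rewrite starterN.
  rewrite relE !permM !copiesE !shiftE /= !if_same -/s sN !inversion_sign_same.
  by rewrite [s x + x + i]addrAC.
apply: big1 => x _; rewrite big_bool [LHS]/=; have [->|x0] := eqVneq x 0.
  have -> : G (0, true) = 1.
    by rewrite /G nestE eqxx /two_copies_key /= muln0 muln1.
  rewrite mul1r /G nestE eqxx; case: ifP => // _; apply: big1 => i _.
  rewrite /relative_sign inversion_sign_copies mul1r.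
  rewrite -(inversion_sign_copies (q 0 + i) (r 0 + i)) /inversion_sign /=.
  by rewrite !permM !copiesE !shiftE.
rewrite !GE //; case: ifP => // _; rewrite -big_split big1 //= => y _.
by rewrite mulrACA !inversion_sign_sqr.
Qed.

(** The [p - 1] crosses have equal signs, which cancel; over the [p] slanted factors the signs of
    [q] and [r] occur to the odd power [p]. *)
Lemma fact_sign_assemble q r : starter q -> starter r ->
  fact_sign key (assemble q r) = (-1) ^+ q * (-1) ^+ r.
Proof.
move=> sq sr; rewrite /fact_sign /assemble.
set A := [set cross k | k in _]; set B := [set _ | _ : _].
rewrite (eq_bigl (mem [predU A & B])) => [|m]; last by rewrite !inE.
rewrite bigU /=; last first.
  rewrite disjoint_subset; apply/subsetP => _ /imsetP[k kin ->]; rewrite !inE.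
  apply/imsetP => -[i _ e]; move: kin; rewrite inE => kin.
  by have := cross_neq_slant i sq sr kin; rewrite e eqxx.
rewrite !big_imset /=; [|by move=> i j _ _; apply: slant_inj|by move=> i j _ _;
  apply: cross_inj].
rewrite (eq_bigr (fun=> match_sign key (cross 0))) => [|k _]; last exact: match_sign_cross.
rewrite prodr_const cardC1 card_Fp //.
have -> : match_sign key (cross 0) ^+ p.-1 = 1.
  have -> : p.-1 = (2 * (p./2))%N by lia.
  by rewrite exprM expr2 match_sign_sqr expr1n.
rewrite mul1r (eq_bigr _ (fun i _ => match_sign_slant i sq sr)) big_split /=.
rewrite prod_relative_sign_nest // mulr1 prodr_const card_Fp //.
move: (odd_perm q) (odd_perm r) => a b; have -> : p = (2 * p./2 + 1)%N by lia.
by rewrite exprD exprM expr2 mulrACA -!expr2 !sqrr_sign mulr1 expr1n mul1r expr1.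
Qed.

End SignOfStarters.

(** * The signed number of starters *)

Section PrimeFieldSums.

Variable p : nat.
Hypotheses (p_pr : prime p) (p_odd : odd p).
Implicit Types (x y d : 'F_p).

Lemma Fp_fermat x : x != 0 -> x ^+ p.-1 = 1.
Proof.
move=> x0; apply: (mulfI x0); rewrite -exprS prednK ?prime_gt0 // mulr1.
by rewrite -[X in _ ^+ X](card_Fp p_pr) expf_card.
Qed.

Lemma Fp_sum_pow_lt m : (m < p.-1)%N -> \sum_(x : 'F_p) x ^+ m = 0.
Proof.
case: m => [_|m ltm].
  by rewrite (eq_bigr (fun=> 1)) // sumr_const card_Fp // Fp_mulrn_eq0.
(* [X ^ m.+1 - 1] has fewer than [p - 1] roots. Substituting [g * x] for [x] multiplies the sum by a
   factor other than 1. *)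
have [g g0 gm] : exists2 g : 'F_p, g != 0 & g ^+ m.+1 != 1.
  apply/exists_inP; apply: contraLR ltm; rewrite negb_exists => /forallP h.
  rewrite -leqNgt -(card_Fp p_pr) -(cardC1 0) cardE.
  apply: max_unity_roots; rewrite ?enum_uniq //.
  apply/allP => x; rewrite mem_enum inE => x0; rewrite unity_rootE.
  by move: (h x); rewrite x0 /= negbK.
set S := \sum_x _; have : g ^+ m.+1 * S = S.
  rewrite big_distrr /= [RHS](reindex_inj (mulfI g0)) /=.
  by apply: eq_bigr => x _; rewrite exprMn.
move/eqP; rewrite -subr_eq0 -[X in _ - X]mul1r -mulrBl mulf_eq0 subr_eq0 (negPf gm).
by move/eqP.
Qed.

Lemma Fp_sum_pow_pred : \sum_(x : 'F_p) x ^+ p.-1 = -1.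
Proof.
rewrite (bigD1 0) //= expr0n; have -> : (p.-1 == 0)%N = false by have := prime_gt1 p_pr; lia.
rewrite add0r (eq_bigr (fun=> 1)) => [|x x0]; last exact: Fp_fermat.
rewrite (eq_bigl (mem (predC1 (0 : 'F_p)))) // sumr_const cardC1 card_Fp //.
apply/eqP; rewrite -addr_eq0 -mulrSr prednK ?prime_gt0 //.
by rewrite (Fp_mulrn_eq0 p_pr).
Qed.

(** In [x] the summand has degree at most [a + b - 1], with coefficient [b d] there; among the
    powers up to [p - 1] only the last has a nonzero sum, namely -1. *)
Lemma Fp_sum_difference d a b : (a + b <= p)%N ->
  \sum_x x ^+ a * ((x + d) ^+ b - x ^+ b) =
  if (a + b == p)%N then - (b%:R * d) else 0.
Proof.
move=> ab.
have -> : \sum_x x ^+ a * ((x + d) ^+ b - x ^+ b) =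
    \sum_(k < b) (d ^+ (b - k) *+ 'C(b, k)) * \sum_x x ^+ (a + k).
  under [RHS]eq_bigr => k _ do rewrite mulr_sumr.
  rewrite exchange_big /=; apply: eq_bigr => x _.
  rewrite [x + d]addrC exprDn big_ord_recr /= subnn expr0 mul1r binn mulr1n addrK mulr_sumr.
  by apply: eq_bigr => k _; rewrite exprD !mulrnAr mulrnAl; congr (_ *+ _); ring.
case: b ab => [|b] ab.
  rewrite big_ord0; case: ifP => //; rewrite mul0r oppr0 //.
rewrite big_ord_recr /= big1 ?add0r => [|k _]; last first.
  by rewrite Fp_sum_pow_lt ?mulr0 //; have := ltn_ord k; lia.
case: eqP => abp; last by rewrite Fp_sum_pow_lt ?mulr0 //; lia.
have -> : (a + b = p.-1)%N by lia.
by rewrite Fp_sum_pow_pred subSnn expr1 binSn mulrN1 mulr_natl.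
Qed.

(** The representatives [1, ..., (p - 1) / 2] of the pairs [{x, -x}]; see [halfE]. *)
Definition half x := ((x : nat) < (- x : 'F_p))%N.

Lemma half0 : half 0 = false.
Proof. by rewrite /half oppr0 ltnn. Qed.

Lemma halfN x : x != 0 -> half (- x) = ~~ half x.
Proof.
move=> x0; rewrite /half opprK -leqNgt ltn_neqAle andb_idl // => _.
apply: contraNneq x0 => /val_inj e; rewrite -Fp_add_eq0 //.
by rewrite -{1}e addNr.
Qed.

Lemma half_neq0 x : half x -> x != 0.
Proof. by apply: contraTneq => ->; rewrite half0. Qed.

Lemma halfE x : half x = (0 < x < (p./2).+1)%N.
Proof.
have [->|x0] := eqVneq x 0; first by rewrite half0.
have x_gt0 : (0 < x)%N by rewrite lt0n; apply: contraNneq x0 => h; apply/eqP/val_inj.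
rewrite /half Fp_oppE // x_gt0; have := Fp_ltn p_pr x; lia.
Qed.

Lemma prod_half (R : comPzSemiRingType) (F : 'F_p -> R) :
  \prod_(x | x != 0) F x = \prod_(x | half x) (F x * F (- x)).
Proof.
rewrite (bigID half) big_split /=; congr (_ * _).
  by apply: eq_bigl => x; rewrite andb_idl //; apply: half_neq0.
rewrite (reindex_inj oppr_inj); apply: eq_bigl => x; rewrite oppr_eq0.
by have [->|x0] := eqVneq x 0; rewrite ?half0 // halfN // negbK.
Qed.

Lemma Fp_prod_below h : (h < p)%N -> \prod_(x : 'F_p | (0 < x < h.+1)%N) x = (h`!)%:R.
Proof.
move=> hp; elim: h hp => [_|h IH hp].
  by rewrite big1 // => x; lia.
have hE : (h.+1%:R : 'F_p) = h.+1 :> nat by rewrite val_Fp_nat // modn_small.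
rewrite (bigD1 h.+1%:R) /=; last by rewrite hE; lia.
rewrite factS natrM -IH; last by lia.
congr (_ * _); apply: eq_bigl => x; rewrite -(inj_eq val_inj) /= hE; lia.
Qed.

Lemma card_half : #|[set x | half x]| = p./2.
Proof.
(* The cardinality is read off the exponents of 2 in the product of the constant 2. *)
have := @prod_half _ (fun=> 2 : int); rewrite (eq_bigl (mem (predC1 (0 : 'F_p)))) //.
rewrite prodr_const cardC1 card_Fp //; set c := #|_|.
rewrite (eq_bigl (mem [set x | half x])) => [|x]; last by rewrite !inE.
rewrite prodr_const -/c -expr2 -exprM => /(@ieexprIn _ _ _ _) e.
have := e isT isT; lia.
Qed.

Lemma prod_half_fact : \prod_(x | half x) x = (p./2)`!%:R.
Proof.
rewrite -(Fp_prod_below (h := p./2)); last by have := prime_gt1 p_pr; lia.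
by apply: eq_bigl => x; rewrite halfE.
Qed.

Lemma Fp_wilson : \prod_(x : 'F_p | x != 0) x = -1.
Proof.
have -> : \prod_(x : 'F_p | x != 0) x = ((p.-1)`!)%:R.
  rewrite -Fp_prod_below; last by have := prime_gt0 p_pr; lia.
  apply: eq_bigl => x; rewrite (prednK (prime_gt0 p_pr)) (Fp_ltn p_pr x) andbT lt0n.
  by apply/idP/idP; apply: contraNneq => h; [apply/eqP/val_inj | rewrite h].
apply/eqP; rewrite -addr_eq0 -mulrSr.
rewrite -(dvdn_pcharf (pchar_Fp p_pr)).
by rewrite -Wilson ?prime_gt1.
Qed.

Lemma prod_half_sqr : (\prod_(x : 'F_p | half x) x) ^+ 2 = - (-1) ^+ (p./2).
Proof.
have e : (-1) ^+ (p./2) * (\prod_(x : 'F_p | half x) x) ^+ 2 = -1.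
  have toS (F : 'F_p -> 'F_p) : \prod_(x | half x) F x = \prod_(x in [set x | half x]) F x.
    by apply: eq_bigl => x; rewrite inE.
  rewrite -[RHS]Fp_wilson prod_half -card_half -prodrXl !toS -prodrN.
  by apply: eq_bigr => x _; rewrite mulrN expr2.
by rewrite -[LHS](signrMK p./2) e mulrN1.
Qed.

End PrimeFieldSums.

(** * Permutations of [Z_p] that commute with negation *)

Section OddPermutations.

Variable p : nat.
Hypotheses (p_pr : prime p) (p_odd : odd p).
Implicit Types (x y d : 'F_p) (s : {perm 'F_p}).

Local Notation V := ('F_p * bool)%type.
Local Notation key := (@two_copies_key p).

Definition odd_map s := [forall x, s (- x) == - s x].

Lemma odd_mapN s x : odd_map s -> s (- x) = - s x.
Proof. by move/forallP/(_ x)/eqP. Qed.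

Lemma odd_map0 s : odd_map s -> s 0 = 0.
Proof.
move=> so; apply/eqP; rewrite -Fp_add_eq0 //.
by rewrite -{1}[0]oppr0 odd_mapN // addNr.
Qed.

Lemma odd_map_eq0 s x : odd_map s -> (s x == 0) = (x == 0).
Proof. by move=> so; rewrite -{1}(odd_map0 so) (inj_eq perm_inj). Qed.

Lemma odd_mapV s : odd_map s -> odd_map s^-1%g.
Proof.
move=> so; apply/forallP => x; apply/eqP/(@perm_inj _ s).
by rewrite odd_mapN // !permKV.
Qed.

Definition half_abs x := if half x then x else - x.

Lemma half_abs_half x : x != 0 -> half (half_abs x).
Proof.
by move=> x0; rewrite /half_abs; case: ifP => // /negbT; rewrite halfN // p_odd.
Qed.

Lemma half_absN x : half_abs (- x) = half_abs x.
Proof.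
have [->|x0] := eqVneq x 0; first by rewrite oppr0.
by rewrite /half_abs halfN // opprK; case: half.
Qed.

Lemma half_abs_id x : half x -> half_abs x = x.
Proof. by rewrite /half_abs => ->. Qed.

Lemma half_abs_abs s x : odd_map s -> half_abs (s (half_abs x)) = half_abs (s x).
Proof.
by move=> so; rewrite {2}/half_abs; case: ifP => // _; rewrite odd_mapN // half_absN.
Qed.

(* A permutation commuting with negation centralizes the nested matching, so the
   relative signs of the edges of the latter multiply to the sign of the former. *)
Lemma odd_map_sign_half s : odd_map s ->
  (-1) ^+ s = \prod_(x | half x) (if half (s x) then 1 else -1) :> int.
Proof.
move=> so; have key_inj := two_copies_key_inj p_pr.
have nestJ : (nest p ^ copies s 1)%g = nest p.
  rewrite conjgE; apply: (mulgI (copies s 1)); rewrite mulgA mulgV mul1g.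
  apply/permP => -[x b]; rewrite !permM !copiesE !nestE.
  have e : ((if b then 1%g else s) x == 0) = (x == 0).
    by case: b; rewrite ?perm1 // odd_map_eq0.
  rewrite e {e}; case: eqP => _; rewrite copiesE.
    by case: b => /=; rewrite ?perm1 ?odd_map0.
  by case: b => /=; rewrite ?perm1 ?odd_mapN.
have := match_signJ_edges (copies s 1) key_inj (nest_fpf p_pr p_odd).
rewrite nestJ match_sign_nest // mul1r odd_copies odd_perm1 addbF.
set Q := \prod_(v | _) _ => sQ.
have -> : (-1) ^+ s = Q.
  by rewrite -[Q](signrMK s) -sQ mulr1.
rewrite /Q big_mkcond /= [RHS]big_mkcond /=.
pose G (v : V) := if (key v < key (nest p v))%N then
  relative_sign key (key \o copies s 1) v (nest p v) else 1.
transitivity (\prod_x \prod_b G (x, b)); first by rewrite pair_bigA; apply: eq_bigr => -[x b].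
apply: eq_bigr => x _; rewrite big_bool [LHS]/=.
have relE g v w : relative_sign key (key \o g) v w =
  inversion_sign key v w * inversion_sign key (g v) (g w) by [].
have cT y : copies s 1 (y, true) = (y, true) by rewrite copiesE perm1.
have cF y : copies s 1 (y, false) = (s y, false) by rewrite copiesE.
have [->|x0] := eqVneq x 0.
  rewrite half0 /G !nestE eqxx !relE [~~ false]/= [~~ true]/= !cT !cF odd_map0 //.
  rewrite !inversion_sign_copies // mulr1 if_same mulr1.
  by rewrite /two_copies_key /= muln0 muln1.
rewrite /G !nestE (negPf x0) !relE !cT !cF !inversion_sign_same.
rewrite inversion_sign_sqr if_same mul1r.
rewrite /two_copies_key ltn_add2r odd_mapN // -/(half x); case: ifP => // hx.
rewrite /inversion_sign ltnNge ltnW // mul1r.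
have sx0 : s x != 0 by rewrite odd_map_eq0.
by have := halfN p_pr p_odd sx0; rewrite {1}/half opprK => ->; case: half.
Qed.

(** The map [x] to [half_abs (s x)] permutes the half, and by [odd_map_sign_half] the signs that it
    drops multiply to the sign of [s]. *)
Lemma odd_map_prod_half s : odd_map s ->
  \prod_(x | half x) s x = (-1) ^+ s * \prod_(x | half x) x.
Proof.
move=> so.
have -> : (-1) ^+ s = \prod_(x | half x) (if half (s x) then 1 else -1) :> 'F_p.
  have := congr1 (fun z : int => z%:~R : 'F_p) (odd_map_sign_half so).
  rewrite rmorphXn rmorphN1 rmorph_prod => ->; apply: eq_bigr => x _.
  by case: half; rewrite ?rmorphN1 ?rmorph1.
have -> : \prod_(x | half x) x = \prod_(x | half x) half_abs (s x).
  rewrite (reindex_onto (fun x => half_abs (s x)) (fun x => half_abs (s^-1%g x))).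
    apply: eq_bigl => x; apply/andP/idP => [[h]|hx].
      rewrite half_abs_abs ?odd_mapV // permK => /eqP <-; apply: half_abs_half.
      by rewrite -(odd_map_eq0 _ so); apply: contraTneq h => ->;
        rewrite /half_abs half0 oppr0 half0.
    split; last by rewrite half_abs_abs ?odd_mapV // permK half_abs_id.
    by apply: half_abs_half; rewrite odd_map_eq0 // half_neq0.
  by move=> x hx; rewrite half_abs_abs // permKV half_abs_id.
rewrite -big_split; apply: eq_bigr => x _ /=; rewrite /half_abs.
by case: half; rewrite ?mul1r // mulN1r opprK.
Qed.

End OddPermutations.

Section CountOddPermutations.

Variable p : nat.
Hypotheses (p_pr : prime p) (p_odd : odd p).
Implicit Types (x y : 'F_p) (s t : {perm 'F_p}) (B : {set 'F_p}).

Definition half_sign x : 'F_p := if half x then 1 else -1.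

Lemma half_sign_abs x : half_sign x * half_abs x = x.
Proof. by rewrite /half_sign /half_abs; case: half; rewrite ?mul1r // mulN1r opprK. Qed.

Lemma half_signN x : x != 0 -> half_sign (- x) = - half_sign x.
Proof. by move=> x0; rewrite /half_sign halfN //; case: half; rewrite /= ?opprK. Qed.

Lemma half_abs_sign x y : half_abs (half_sign x * y) = half_abs y.
Proof. by rewrite /half_sign; case: half; rewrite ?mul1r // mulN1r half_absN. Qed.

Lemma half_abs0 : half_abs (0 : 'F_p) = 0.
Proof. by rewrite /half_abs half0 oppr0. Qed.

Lemma half_abs_neq0 x : x != 0 -> half_abs x != 0.
Proof. by move=> x0; apply/half_neq0/half_abs_half. Qed.

(** Odd permutations as signed permutations of the half: [t] moves the absolute values and [B] marks
    those whose sign is flipped. *)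
Definition signed_fun t B x :=
  (if half_abs x \in B then -1 else 1) * (half_sign x * t (half_abs x)).

Let P : {set 'F_p} := [set x | half x].

Lemma perm_on_half0 t : perm_on P t -> t 0 = 0.
Proof. by move=> tP; rewrite (out_perm tP) // inE half0. Qed.

Lemma perm_on_half_abs t x : perm_on P t -> half_abs (t (half_abs x)) = t (half_abs x).
Proof.
move=> tP; have [->|x0] := eqVneq x 0; first by rewrite half_abs0 perm_on_half0 // half_abs0.
apply: half_abs_id; have := perm_closed (half_abs x) tP.
by rewrite !inE half_abs_half.
Qed.

Lemma half_abs_signed t B x : perm_on P t ->
  half_abs (signed_fun t B x) = t (half_abs x).
Proof.
move=> tP; rewrite /signed_fun; case: (_ \in B).
  by rewrite mulN1r half_absN // half_abs_sign perm_on_half_abs.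
by rewrite mul1r half_abs_sign perm_on_half_abs.
Qed.

Lemma signed_fun_inj t B : perm_on P t -> injective (signed_fun t B).
Proof.
move=> tP x y e; have := congr1 (@half_abs p) e; rewrite !half_abs_signed // => /perm_inj e2.
move: e; rewrite /signed_fun e2.
have [y0|y0] := eqVneq y 0.
  by move: e2; rewrite y0 half_abs0; case: (eqVneq x 0) => // /half_abs_neq0 /eqP.
set c := if _ then _ else _; have c0 : c != 0 by rewrite /c; case: ifP;
  rewrite ?oppr_eq0 oner_eq0.
move/(mulfI c0)/mulIf => e; rewrite -[x]half_sign_abs -[y]half_sign_abs e2 e //.
by rewrite -(perm_on_half0 tP) (inj_eq perm_inj) half_abs_neq0.
Qed.

Lemma signed_fun_odd t B x : perm_on P t -> signed_fun t B (- x) = - signed_fun t B x.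
Proof.
move=> tP; rewrite /signed_fun half_absN //.
have [->|x0] := eqVneq x 0; first by rewrite half_abs0 perm_on_half0 // !mulr0 oppr0.
by rewrite half_signN // mulNr mulrN.
Qed.

(** Injectivity of [signed_fun] is known only when [t] is a permutation of the half; the default
    makes the map total. *)
Definition signed_perm (z : {perm 'F_p} * {set 'F_p}) : {perm 'F_p} :=
  odflt 1%g [pick s : {perm 'F_p} | [forall x, s x == signed_fun z.1 z.2 x]].

Lemma signed_permE t B x : perm_on P t -> signed_perm (t, B) x = signed_fun t B x.
Proof.
move=> tP; rewrite /signed_perm; case: pickP => [s /forallP/(_ x)/eqP //|].
move/(_ (perm (signed_fun_inj (B := B) tP)))/negP; case.
by apply/forallP => y; rewrite permE.
Qed.

Lemma card_odd_map : #|[set s | @odd_map p s]| = (p./2`! * 2 ^ p./2)%N.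
Proof.
rewrite -(card_half p_pr p_odd) -card_perm -card_powerset -[#|perm_on _|]cardsE -cardsX.
rewrite -(card_in_imset (f := signed_perm)); last first.
  move=> [t B] [t' B']; rewrite !inE /= => /andP[tP BP] /andP[t'P B'P] e.
  have E x : signed_fun t B x = signed_fun t' B' x by rewrite -!signed_permE // e.
  have et : t = t'.
    apply/permP => x; have [xP|xP] := boolP (half x);
      last by rewrite !(out_perm _ (_ : x \notin P)) // inE.
    by rewrite -[x]half_abs_id // -(half_abs_signed B) // E half_abs_signed.
  congr (_, _) => //; apply/setP => x.
  have [xP|xP] := boolP (half x); last first.
    have xN : x \notin P by rewrite inE.
    by rewrite (contraNF (subsetP BP x) xN) (contraNF (subsetP B'P x) xN).
  have := E x; rewrite /signed_fun -et half_abs_id //.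
  have tx : half_sign x * t x != 0.
    rewrite /half_sign xP mul1r -(perm_on_half0 tP) (inj_eq perm_inj); exact: half_neq0.
  case: (x \in B); case: (x \in B') => //; rewrite mul1r mulN1r => /eqP.
    by rewrite eq_sym -subr_eq0 opprK Fp_add_eq0 // (negPf tx).
  by rewrite -subr_eq0 opprK Fp_add_eq0 // (negPf tx).
apply: eq_card => s; rewrite inE; apply/idP/imsetP => [so|[[t B]]]; last first.
  rewrite !inE /= => /andP[tP _] ->; apply/forallP => x.
  by rewrite !signed_permE // signed_fun_odd.
pose f x := if half x then half_abs (s x) else x.
have f_half x : half x -> half (f x).
  by move=> xP; rewrite /f xP half_abs_half // odd_map_eq0 // half_neq0.
have f_inj : injective f.
  move=> x y; have [xP|xP] := boolP (half x); have [yP|yP] := boolP (half y).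
  - rewrite /f xP yP => e; have := congr1 (fun u => half_abs (s^-1%g u)) e => /=.
    by rewrite !half_abs_abs ?odd_mapV // !permK !half_abs_id.
  - by move=> e; have := f_half _ xP; rewrite e /f (negPf yP) (negPf yP).
  - by move=> e; have := f_half _ yP; rewrite -e /f (negPf xP) (negPf xP).
  by rewrite /f (negPf xP) (negPf yP).
have tP : perm_on P (perm f_inj).
  apply/subsetP => x; rewrite !inE permE /f; case: ifP => //; by rewrite eqxx.
exists (perm f_inj, [set x | half x && ~~ half (s x)]).
  rewrite inE; apply/andP; split; rewrite inE //.
  by apply/subsetP => x; rewrite !inE; case/andP.
apply/permP => x; rewrite signed_permE // /signed_fun permE inE.
have [->|x0] := eqVneq x 0; first by rewrite half_abs0 /f half0 !mulr0 odd_map0.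
rewrite /f half_abs_half //=.
have -> : s x = half_sign x * s (half_abs x).
  by rewrite /half_sign /half_abs; case: half; rewrite ?mul1r // odd_mapN // mulN1r opprK.
move: (s _) => y; rewrite mulrCA; congr (_ * _); rewrite -[LHS]half_sign_abs.
by congr (_ * _); rewrite /half_sign; case: half.
Qed.

End CountOddPermutations.

(** * Vandermonde determinants summed over starters *)

Section StarterSum.

Variable p : nat.
Hypotheses (p_pr : prime p) (p_odd : odd p).
Implicit Types (x z d : 'F_p) (y : {ffun 'F_p -> 'F_p}) (s q : {perm 'F_p}) (f : 'F_p -> 'F_p).

Local Notation n := (Zp_trunc (pdiv p)).+2.

(** ['I_n] is ['F_p] itself: rows and columns are indexed by field elements, and a column index
    doubles as an exponent from 0 to [p - 1]. *)
Definition power_mx f : 'M['F_p]_n := \matrix_(x, j) f x ^+ (j : nat).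

Lemma det_power_perm s : \det (power_mx s) = (-1) ^+ s * \det (power_mx id).
Proof.
rewrite -det_perm -det_mulmx -row_permE; congr (\det _).
by apply/matrixP => x j; rewrite !mxE.
Qed.

Lemma det_power_eq0 f x z : x != z -> f x = f z -> \det (power_mx f) = 0.
Proof.
by move=> xy e; apply: (determinant_alternate xy) => j; rewrite !mxE e.
Qed.

Definition power_diff_mx f : 'M['F_p]_n :=
  \matrix_(x, j) (f x ^+ (j : nat) -
    (if (x != 0) && ~~ half x then f (- x) ^+ (j : nat) else 0)).

(** The row operation is unitriangular, since [-x < x] as representatives outside the half. Taking
    differences lowers degrees by one, so that the later power sums vanish for all exponent sums
    below [p], not merely below [p - 1]. *)
Lemma det_power_diff f : \det (power_mx f) = \det (power_diff_mx f).
Proof.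
pose E : 'M['F_p]_n := \matrix_(x, z)
  ((x == z)%:R - ((x != 0) && ~~ half x && (z == - x))%:R).
have -> : power_diff_mx f = E *m power_mx f.
  apply/matrixP => x j; rewrite !mxE.
  under eq_bigr => z _ do rewrite !mxE mulrBl.
  rewrite sumrB (bigD1 x) //= eqxx mul1r big1 ?addr0; last first.
    by move=> z; rewrite eq_sym => /negPf->; rewrite mul0r.
  congr (_ - _); case: ifP => _; last by rewrite big1 // => z _; rewrite mul0r.
  rewrite (bigD1 (- x)) //= eqxx mul1r big1 ?addr0 //.
  by move=> z /negPf->; rewrite mul0r.
rewrite det_mulmx det_trig.
  rewrite big1 ?mul1r // => x _; rewrite mxE eqxx.
  case: (boolP (x != 0)) => x0; last by rewrite subr0.
  by rewrite -subr_eq0 opprK Fp_add_eq0 // (negPf x0) andbF subr0.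
apply/forallP => x; apply/forallP => z; apply/implyP => xz; rewrite mxE.
have -> : (x == z) = false by apply/eqP => e; rewrite e ltnn in xz.
case: (boolP (z == - x)) => [/eqP e|_]; last by rewrite andbF subr0.
by rewrite /half -e xz andbF subr0.
Qed.

(** Values on the half are free, and the starter equation forces the others. *)
Definition starter_fun (y : {ffun 'F_p -> 'F_p}) x :=
  if half x then y x else if x == 0 then 0 else y (- x) - x.

Lemma starter_fun0 y : starter_fun y 0 = 0.
Proof. by rewrite /starter_fun half0 eqxx. Qed.

Lemma starter_fun_half y x : half x -> starter_fun y x = y x.
Proof. by rewrite /starter_fun => ->. Qed.

Lemma starter_funN y x : half x -> starter_fun y (- x) = y x + x.
Proof.
move=> hx; have x0 := half_neq0 hx.
by rewrite /starter_fun halfN // hx /= oppr_eq0 (negPf x0) opprK.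
Qed.

Lemma starter_fun_starter y x : starter_fun y (- x) = starter_fun y x + x.
Proof.
have [->|x0] := eqVneq x 0; first by rewrite oppr0 !addr0.
have [hx|hx] := boolP (half x).
  by rewrite starter_funN // starter_fun_half.
have hNx : half (- x) by rewrite halfN.
by rewrite -[in X in _ = X + _](opprK x) (starter_funN y hNx) starter_fun_half // subrK.
Qed.

(** Maps that are not injective have two equal rows and add 0. Without bijectivity the values on the
    half are independent; the support condition makes each map count once. *)
Lemma sum_starter_det :
  \sum_(q | starter q) \det (power_mx q) =
  \sum_(y in pffun_on (0 : 'F_p) (@half p) predT) \det (power_mx (starter_fun y)).
Proof.
rewrite [RHS](bigID (fun y => injectiveb (starter_fun y))) /=.
rewrite [X in _ + X]big1 ?addr0; last first.
  move=> y /andP[_ /injectivePn[x [z xz e]]]; exact: det_power_eq0 xz e.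
pose h q : {ffun 'F_p -> 'F_p} := [ffun x => if half x then q x else 0].
have hE q : starter q -> starter_fun (h q) =1 q.
  move=> sq x; rewrite /starter_fun !ffunE; have [//|hx] := boolP (half x).
  case: eqP => [->|/eqP x0]; first by rewrite starter0.
  by rewrite halfN // hx starterN // addrK.
pose S := [set q | @starter p q].
rewrite (eq_bigl (mem S)) => [|q]; last by rewrite !inE.
rewrite (eq_bigr (fun q => \det (power_mx (starter_fun (h q))))); last first.
  move=> q; rewrite [mem S q]inE => sq; congr (\det _); apply/matrixP => x j.
  by rewrite !mxE hE //; move: sq; rewrite /= ?inE.
rewrite -(big_imset (h := h) (fun y => \det (power_mx (starter_fun y)))) /=; last first.
  move=> q q'; rewrite !inE => sq sq' e; apply/permP => x.
  by rewrite -hE // -[RHS]hE // e.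
apply: eq_bigl => y; apply/imsetP/andP => [[q]|[yP /injectiveP inj]].
  rewrite inE => sq ->; split.
    apply/pffun_onP; split=> //; apply/supportP => x /negPf hx.
    by rewrite ffunE [half x]hx.
  by apply/injectiveP => x z; rewrite !hE //; apply: perm_inj.
exists (perm inj); first rewrite inE.
  rewrite /starter permE starter_fun0 eqxx; apply/forallP => d.
  by rewrite !permE starter_fun_starter.
apply/ffunP => x; rewrite ffunE permE; case: ifP => hx; first by rewrite starter_fun_half.
by case/pffun_onP: yP => /supportP-> //; rewrite [_ \in _]hx.
Qed.

End StarterSum.

Section StarterSumSquare.

Variable p : nat.
Hypotheses (p_pr : prime p) (p_odd : odd p).
Implicit Types (x z d : 'F_p) (y : {ffun 'F_p -> 'F_p}) (s q : {perm 'F_p}).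

Local Notation n := (Zp_trunc (pdiv p)).+2.

(** By Wilson the differences of ordered pairs of distinct elements multiply to [(-1) ^ p];
    reversing half of them costs [(-1) ^ 'C(p, 2)]. *)
Lemma det_power_sqr : \det (power_mx (@id 'F_p)) ^+ 2 = - (-1) ^+ p./2.
Proof.
set W := \det _.
have WE : W = \prod_(i : 'F_p) \prod_(j : 'F_p | (i < j)%N) (j - i).
  have -> : W = \det (Vandermonde n (\row_(x < n) (x : 'F_p))).
    by rewrite -det_tr; congr (\det _); apply/matrixP => i j; rewrite !mxE.
  by rewrite det_Vandermonde; apply: eq_bigr => i _; apply: eq_bigr => j _; rewrite !mxE.
have WW : W * \prod_(i : 'F_p) \prod_(j : 'F_p | (i < j)%N) (i - j) = -1.
  rewrite [X in _ * X](exchange_big_dep predT) //= WE -big_split /=.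
  rewrite (eq_bigr (fun=> -1)).
    by rewrite prodr_const card_Fp // -signr_odd p_odd expr1.
  move=> i _; transitivity (\prod_(x : 'F_p | x != 0) x); last exact: Fp_wilson.
  rewrite [RHS](reindex_inj (addIr (- i))) /=.
  rewrite [RHS](bigID (fun j : 'F_p => (i < j)%N)) /=; congr (_ * _); apply: eq_bigl => j.
    by rewrite subr_eq0 andb_idl // => ij; apply: contraTneq ij => ->; rewrite ltnn.
  rewrite subr_eq0 -leqNgt ltn_neqAle; congr (~~ _ && _).
have sg : \prod_(i : 'F_p) \prod_(j : 'F_p | (i < j)%N) (i - j) = (-1) ^+ p./2 * W.
  transitivity (\prod_(i : 'F_p) \prod_(j : 'F_p | (i < j)%N) (-1 : 'F_p) * W).
    rewrite WE -big_split /=; apply: eq_bigr => i _; rewrite -big_split /=.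
    by apply: eq_bigr => j _; rewrite mulN1r opprB.
  congr (_ * _); rewrite (exchange_big_dep predT) //=.
  rewrite (eq_bigr (fun j : 'F_p => (-1) ^+ (j : nat))); last first.
    move=> j _; rewrite -(big_ord_widen _ (fun=> -1 : 'F_p)) ?prodr_const ?card_ord //.
    exact: ltnW.
  rewrite -(big_mkord predT (fun j => (-1) ^+ j : 'F_p)).
  rewrite -(big_morph (fun j => (-1) ^+ j) (@exprD _ _) (expr0 _)) bin2_sum.
  have -> : 'C(n, 2) = 'C(p, 2) by rewrite Fp_cast.
  rewrite -signr_odd bin2odd // oddM p_odd /= signr_odd; congr (_ ^+ _); lia.
by move: WW; rewrite sg mulrCA -expr2 => e; rewrite -[LHS](signrMK p./2) e mulrN1.
Qed.

Local Notation hf := (\prod_(x : 'F_p | half x) x).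

(** Both sides add the representatives of all nonzero elements: [s] permutes these, and the
    representatives of [x] and [-x] have sum [p]. *)
Lemma sum_val_perm s : s 0 = 0 ->
  (\sum_(x : 'F_p | half x) (s x + s (- x)) = \sum_(x : 'F_p | half x) p)%N.
Proof.
have split F : (\sum_(x : 'F_p | x != 0%R) F x = \sum_(x : 'F_p | half x) (F x + F (- x)%R))%N.
  rewrite (bigID (@half p)) big_split /=; congr (_ + _)%N.
    by apply: eq_bigl => x; rewrite andb_idl //; apply: half_neq0.
  rewrite (reindex_inj oppr_inj); apply: eq_bigl => x; rewrite oppr_eq0.
  by have [->|x0] := eqVneq x 0; rewrite ?half0 // halfN // negbK.
move=> s0; rewrite -(split (fun x => s x : nat)).
transitivity (\sum_(x : 'F_p | x != 0%R) x)%N.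
  rewrite [RHS](reindex_inj (@perm_inj _ s)) /=; apply: eq_bigl => x.
  have e : (s x == 0) = (x == 0) by rewrite -[RHS](inj_eq (@perm_inj _ s)) s0.
  by rewrite e.
rewrite (split (fun x => x : nat)); apply: eq_bigr => x hx.
by rewrite Fp_oppE ?half_neq0 // subnKC // ltnW // Fp_ltn.
Qed.

(** Row 0 forces [s 0 = 0]. The sum over [t] vanishes if [s x + s (- x) < p]. By [sum_val_perm]
    these sums average [p], so in a surviving term all equal [p], that is, [s] is odd; the factor of
    [x] is then [s x * x]. *)
Lemma starter_term s :
  (-1) ^+ s * (0 ^+ (s 0 : nat) * \prod_(x : 'F_p | half x)
     \sum_(t : 'F_p) t ^+ (s x : nat) * ((t + x) ^+ (s (- x) : nat) - t ^+ (s (- x) : nat)))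
  = if odd_map s then hf ^+ 2 else 0.
Proof.
have [s0|s0] := eqVneq (s 0) 0; last first.
  rewrite expr0n (_ : (s 0 == 0 :> nat) = false) ?mul0r ?mulr0.
    by case: ifP => // /(odd_map0 p_pr p_odd) e; rewrite e eqxx in s0.
  by apply/negbTE; apply: contraNneq s0 => h; apply/eqP/val_inj.
rewrite s0 expr0 mul1r.
have [/existsP[x /andP[hx sx]]|] := boolP [exists x : 'F_p, half x && (s x + s (- x) < p)%N].
  rewrite (bigD1 x) //= Fp_sum_difference //; last exact: ltnW.
  rewrite (ltn_eqF sx) mul0r mulr0; case: ifP => // so; move: sx.
  rewrite odd_mapN // Fp_oppE ?odd_map_eq0 ?half_neq0 //.
  by rewrite subnKC ?ltnn // ltnW // Fp_ltn.
rewrite negb_exists => /forallP h.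
have eqp x : half x -> (s x + s (- x) = p)%N.
  have le z : half z -> (p <= s z + s (- z) ?= iff (s z + s (- z) == p))%N.
    by move=> hz; have := h z; rewrite hz -leqNgt => hp; apply/leqifP; rewrite eq_sym; 
      case: eqP => // /eqP ne; rewrite ltn_neqAle ne.
  have [_] := leqif_sum le; rewrite sum_val_perm // eqxx => /esym/forall_inP al hx.
  exact/eqP/al.
have so : odd_map s.
  have N x : half x -> s (- x) = - s x.
    move=> hx; apply/val_inj; have sx0 : s x != 0.
      by rewrite -[X in _ != X]s0 (inj_eq perm_inj) half_neq0.
    by rewrite [RHS](Fp_oppE p_pr) //; apply: canRL (addKn _) (eqp _ hx).
  apply/forallP => x; apply/eqP; have [->|x0] := eqVneq x 0; first by rewrite oppr0 s0 oppr0.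
  have [/N //|hx] := boolP (half x).
  have hNx : half (- x) by rewrite halfN.
  by rewrite -[in RHS](opprK x) (N _ hNx) opprK.
rewrite so (eq_bigr (fun x => s x * x)) => [|x hx]; last first.
  rewrite Fp_sum_difference ?eqp // eqxx Fp_natr_val odd_mapN //.
  by rewrite mulNr opprK.
by rewrite big_split /= odd_map_prod_half // mulrA mulrA -expr2 sqrr_sign mul1r expr2.
Qed.

(** In the Leibniz expansion the rows [x] and [-x] share the single variable [t = y x], so the sum
    over [y] distributes over the half. *)
Lemma sum_starter_det_val :
  \sum_(q | starter q) \det (power_mx q) = hf ^+ 2 *+ #|[set s | @odd_map p s]|.
Proof.
rewrite sum_starter_det //.
under eq_bigr => y _ do rewrite det_power_diff //.
rewrite /(\det _) exchange_big /=.
rewrite (eq_bigr (fun s => if odd_map s then hf ^+ 2 else 0)).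
  by rewrite -big_mkcond /= -sumr_const; apply: eq_bigl => s; rewrite inE.
move=> s _; rewrite -starter_term -mulr_sumr; congr (_ * _).
rewrite (big_distr_big (0 : 'F_p)) mulr_sumr; apply: eq_bigr => y _.
rewrite (bigD1 0) //= !mxE starter_fun0 eqxx /= subr0; congr (_ * _).
rewrite prod_half //; apply: eq_bigr => x hx.
have x0 := half_neq0 hx.
rewrite !mxE x0 hx subr0 starter_fun_half // oppr_eq0 x0 halfN // hx /= opprK.
by rewrite starter_funN // starter_fun_half.
Qed.

(** As [hf] is the factorial of [p./2], [A * W = hf ^ 3 * 2 ^ p./2]. Both [W ^ 2] and [hf ^ 2] equal
    [- (-1) ^ p./2], whose square is 1, and [2 ^ p.-1 = 1]; squaring gives the claim. *)
Lemma starter_sum_sqr_Fp : (\sum_(q | @starter p q) (-1) ^+ q) ^+ 2 = 1 :> 'F_p.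
Proof.
set A := \sum_(q | _) _; set W := \det (power_mx (@id 'F_p)).
have AW : A * W = hf ^+ 3 * 2%:R ^+ p./2.
  rewrite mulr_suml (eq_bigr (fun q => \det (power_mx q))); last first.
    by move=> q _; rewrite det_power_perm.
  rewrite sum_starter_det_val card_odd_map // -mulr_natr natrM natrX mulrA.
  by rewrite -prod_half_fact // -exprSr.
have := congr1 (fun u => u ^+ 2) AW.
rewrite !exprMn det_power_sqr prod_half_sqr // -[2%:R ^+ _ ^+ 2]exprM.
have -> : 2%:R ^+ (p./2 * 2) = 1 :> 'F_p.
  have -> : (p./2 * 2 = p.-1)%N by lia.
  apply: Fp_fermat => //; rewrite -(dvdn_pcharf (pchar_Fp p_pr)).
  by apply/negP => /(dvdn_leq (isT : (0 < 2)%N)); have := prime_gt1 p_pr; lia.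
have uu : (- (-1) ^+ p./2) * (- (-1) ^+ p./2) = 1 :> 'F_p.
  by rewrite mulrNN -expr2 sqrr_sign.
rewrite mulr1 uu mulr1 -[X in _ = X -> _]mul1r => /mulIf -> //.
by rewrite oppr_eq0 signr_eq0.
Qed.

Lemma starter_sum_sqr :
  (p %| (\sum_(q | @starter p q) (-1) ^+ q : int) ^+ 2 - 1)%Z.
Proof.
set A := \sum_(q | _) _.
have : (A ^+ 2 - 1)%:~R = 0 :> 'F_p.
  rewrite rmorphB rmorphXn rmorph1 /= rmorph_sum /= -[X in _ - X]starter_sum_sqr_Fp.
  apply/eqP; rewrite subr_eq0; apply/eqP; congr (_ ^+ _); apply: eq_bigr => q _.
  by rewrite rmorphXn rmorphN1.
case: (A ^+ 2 - 1) => m /eqP.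
  by rewrite -[_%:~R]/(m%:R) -(dvdn_pcharf (pchar_Fp p_pr)).
by rewrite NegzE rmorphN /= oppr_eq0 -[_%:~R]/(m.+1%:R) -(dvdn_pcharf (pchar_Fp p_pr)) rpredN.
Qed.

End StarterSumSquare.

Lemma sum_one_fact_two_copies (p : nat) : prime p -> odd p ->
  ((p ^ 2)%N%:Z %| \sum_(F : {set {perm 'F_p * bool}} | one_fact F)
     fact_sign (@two_copies_key p) F + p%:Z)%Z.
Proof.
move=> p_pr p_odd; have := sum_one_fact_mod p_pr p_odd.
rewrite sum_fixed_base // sum_base_fact //.
set S := \sum_(F | one_fact F) _; set T := \sum_(z | _) _.
have -> : T = (\sum_(q | @starter p q) (-1) ^+ q) ^+ 2.
  rewrite expr2 big_distrlr /= pair_big /=.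
  by apply: eq_bigr => -[q r] /andP[sq sr]; rewrite fact_sign_assemble.
case/dvdzP: (starter_sum_sqr p_pr p_odd) => c /eqP; rewrite subr_eq => /eqP ->.
case/dvdzP => a /eqP; rewrite subr_eq => /eqP ->; apply/dvdzP.
(* The total is [a p ^ 2 + (p - 1) p (1 + c p) + p], and [(p - 1) p + p = p ^ 2]. *)
exists (a + 1 + (p.-1)%:Z * c).
have [q ->] : exists q, p = q.+1 by exists p.-1; rewrite prednK ?prime_gt0.
rewrite -mulr_natr -[_ *+ q.+1]mulr_natr /= !natz -mulnn PoszM intS; ring.
Qed.

(** * One-factorizations of the complete graph *)

Section PerfectMatchings.

Variables (V : finType) (v0 : V) (n : nat) (f : V -> 'I_n).
Hypothesis f_bij : bijective f.
Implicit Types (m : {perm V}) (F : {set {perm V}}).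

Local Notation f_inj := (bij_inj f_bij).

Definition perm_matching m : {set {set 'K_n}} := [set [set f v; f (m v)] | v : V].

Lemma complete_edgeP (e : {set 'K_n}) :
  reflect (exists u v : 'I_n, u != v /\ e = [set u; v]) (e \in edges 'K_n).
Proof.
apply: (iffP imsetP) => [[[u v]]|[u [v [uv ->]]]].
  by rewrite inE /= => uv ->; exists u, v.
by exists (u, v); rewrite ?inE.
Qed.

Lemma set2_eqP (T : finType) (a b c d : T) : [set a; b] = [set c; d] ->
  (a = c /\ b = d) \/ (a = d /\ b = c).
Proof.
move=> e; have := set21 a b; have := set22 a b; rewrite e !inE.
have := set21 c d; have := set22 c d; rewrite -e !inE.
by do 4![case/orP => /eqP ?]; subst; auto.
Qed.

Lemma perm_matching_edge m v w : fpf_involution m ->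
  ([set f v; f w] \in perm_matching m) = (w == m v).
Proof.
move=> fm; apply/imsetP/eqP => [[u _]|->]; last by exists v.
by case/set2_eqP => -[/f_inj -> /f_inj ->] //; rewrite fpfK.
Qed.

Lemma perm_matching_inj m m' : fpf_involution m -> fpf_involution m' ->
  perm_matching m = perm_matching m' -> m = m'.
Proof.
by move=> fm fm' e; apply/permP => v; apply/eqP;
  rewrite -perm_matching_edge // -e perm_matching_edge.
Qed.

Lemma perm_matching_perfect m : fpf_involution m -> perfect_matching (perm_matching m).
Proof.
move=> fm; apply/andP; split.
  apply/subsetP => _ /imsetP[v _ ->]; apply/complete_edgeP; exists (f v), (f (m v)).
  by rewrite (inj_eq f_inj) eq_sym fpf_neq.
apply/and3P; split.
- apply/eqP/setP => u; rewrite inE; apply/bigcupP.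
  have [g _ fK] := f_bij; exists [set f (g u); f (m (g u))]; first by apply: imset_f.
  by rewrite fK set21.
- apply/trivIsetP => _ _ /imsetP[v _ ->] /imsetP[w _ ->]; apply: contraR.
  case/pred0Pn => u /=; rewrite !inE => /andP[/orP[]/eqP-> /orP[]];
    rewrite (inj_eq f_inj) => /eqP.
  - by move=> ->.
  - by move=> ->; rewrite fpfK // setUC.
  - by move=> <-; rewrite fpfK // setUC.
  by move=> /perm_inj ->.
by apply/imsetP => -[v _ /setP/(_ (f v))]; rewrite !inE eqxx.
Qed.

Lemma perfect_matching_perm (M : {set {set 'K_n}}) : perfect_matching M ->
  exists2 m, fpf_involution m & M = perm_matching m.
Proof.
case/andP=> /subsetP ME /and3P[/eqP cM tM _]; have [g gK fK] := f_bij.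
have exm v : exists w, (v != w) && ([set f v; f w] \in M).
  have : f v \in cover M by rewrite cM inE.
  case/bigcupP => e eM ve; have /complete_edgeP[a [b [ab eE]]] := ME _ eM.
  move: ve; rewrite eE !inE => /orP[] /eqP e1.
    by exists (g b); rewrite -(inj_eq f_inj) fK e1 ab -eE.
  by exists (g a); rewrite -(inj_eq f_inj) fK e1 eq_sym ab setUC -eE.
pose h v := odflt v [pick w | (v != w) && ([set f v; f w] \in M)].
have hP v : (v != h v) && ([set f v; f (h v)] \in M).
  by rewrite /h; case: pickP => [w|no] //=; have [w] := exm v; rewrite no.
have uniq v w w' : v != w -> v != w' ->
    [set f v; f w] \in M -> [set f v; f w'] \in M -> w = w'.
  move=> vw vw' e1 e2; have e : [set f v; f w] = [set f v; f w'].
    apply/eqP; apply: contraT => /(trivIsetP tM _ _ e1 e2)/pred0P/(_ (f v)).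
    by rewrite /= !set21.
  case/set2_eqP: e => -[] => [_ /f_inj //|/f_inj e _].
  by rewrite e eqxx in vw'.
have hK : involutive h.
  move=> v; have /andP[v1 e1] := hP v; have /andP[v2 e2] := hP (h v).
  by apply: (uniq (h v)) => //; [rewrite eq_sym | rewrite setUC].
exists (perm (inv_inj hK)).
  by apply/forallP => v; rewrite !permE hK eqxx andbT eq_sym; case/andP: (hP v).
apply/setP => e; apply/idP/imsetP => [eM|[v _ ->]]; last by rewrite permE; case/andP: (hP v).
have /complete_edgeP[a [b [ab eE]]] := ME _ eM.
exists (g a) => //; rewrite permE fK eE; congr [set _; _]; rewrite -[LHS]fK; congr (f _).
have /andP[v1 e1] := hP (g a).
apply: uniq _ v1 _ e1; first by rewrite -(inj_eq f_inj) !fK.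
by rewrite !fK -eE.
Qed.

Lemma cr_perm_matching m : fpf_involution m ->
  sign_matching (perm_matching m) = match_sign (fun v => f v : nat) m.
Proof.
move=> fm; rewrite /sign_matching /match_sign /cr.
set A := [set z : V * V | _]; set B := [set P in _ | _].
pose h (z : V * V) := [set [set f z.1; f (m z.1)]; [set f z.2; f (m z.2)]].
have h_inj : {in A &, injective h}.
  move=> [a b] [a' b']; rewrite !inE /= => /and3P[h1 h2 h3] /and3P[h1' h2' h3'].
  rewrite /h /= => /set2_eqP[] [] /set2_eqP e1 /set2_eqP e2.
    case: e1 => -[] /f_inj e1 /f_inj e1'; case: e2 => -[] /f_inj e2 /f_inj e2'; subst=> //;
      by rewrite ?(fpfK fm) in h1 h2 h3 h1' h2' h3'; lia.
  case: e1 => -[] /f_inj e1 /f_inj e1'; case: e2 => -[] /f_inj e2 /f_inj e2'; subst;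
    by rewrite ?(fpfK fm) in h1 h2 h3 h1' h2' h3'; lia.
rewrite -(card_in_imset h_inj); suff -> : h @: A = B by [].
have [g gK fK] := f_bij.
apply/setP => P; apply/imsetP/idP => [[[a b]]|].
  rewrite !inE /= => /and3P[h1 h2 h3] ->; apply/andP; split.
    by apply/subsetP => e; rewrite !inE => /orP[] /eqP ->; apply: imset_f.
  apply/existsP; exists (f a); apply/existsP; exists (f b).
  apply/existsP; exists (f (m a)); apply/existsP; exists (f (m b)).
  by rewrite h1 h2 h3 eqxx.
rewrite !inE => /andP[/subsetP PM].
case/existsP => a /existsP[b] /existsP[c] /existsP[d] /and4P[ab bc cd /eqP PE].
have : [set a; c] \in perm_matching m by apply: PM; rewrite PE set21.
have : [set b; d] \in perm_matching m by apply: PM; rewrite PE set22.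
rewrite -[a]fK -[b]fK -[c]fK -[d]fK !perm_matching_edge // => /eqP dE /eqP cE.
exists (g a, g b); last by rewrite /h /= -cE -dE !fK PE.
by rewrite inE /= -cE -dE !fK ab bc cd.
Qed.

Definition perm_factorization F : {set {set {set 'K_n}}} := [set perm_matching m | m in F].

Lemma perm_factorizationP F : one_fact F -> one_factorization (perm_factorization F).
Proof.
move=> oF; apply/andP; split; last first.
  by apply/forall_inP => _ /imsetP[m mF ->]; apply: perm_matching_perfect (one_fact_fpf oF mF).
have [g gK fK] := f_bij; apply/and3P; split.
- apply/eqP/setP => e; apply/bigcupP/complete_edgeP.
    case=> _ /imsetP[m mF ->] /imsetP[v _ ->]; exists (f v), (f (m v)).
    by rewrite (inj_eq f_inj) eq_sym fpf_neq // (one_fact_fpf oF mF).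
  case=> u [v [uv ->]]; have [|m mF e1] := one_fact_ex (u := g u) (v := g v) oF.
    by rewrite -(inj_eq f_inj) !fK.
  exists (perm_matching m); first exact: imset_f.
  by rewrite -[u]fK -[v]fK perm_matching_edge ?e1 // (one_fact_fpf oF mF).
- apply/trivIsetP => _ _ /imsetP[m mF ->] /imsetP[m' m'F ->]; apply: contraR.
  have fm := one_fact_fpf oF mF; have fm' := one_fact_fpf oF m'F.
  case/pred0Pn => _ /andP[/imsetP[v _ ->] /=]; rewrite perm_matching_edge // => /eqP e.
  by rewrite (one_fact_inj oF mF m'F e).
(* Blocks of a partition are nonempty: every factor has an edge at [v0]. *)
apply/imsetP => -[m mF]; move=> e.
have : [set f v0; f (m v0)] \in perm_matching m by apply: imset_f.
by rewrite -e inE.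
Qed.

Lemma factorization_perm (FF : {set {set {set 'K_n}}}) : one_factorization FF ->
  exists2 F, one_fact F & FF = perm_factorization F.
Proof.
case/andP=> /and3P[/eqP cFF tFF _] /forall_inP pFF; have [g gK fK] := f_bij.
exists [set m | fpf_involution m & perm_matching m \in FF]; last first.
  apply/setP => M; apply/idP/imsetP => [MF|[m]]; last by rewrite inE => /andP[_ mF] ->.
  have [m fm e] := perfect_matching_perm (pFF _ MF).
  by exists m => //; rewrite inE fm -e.
apply: one_factP => [m|u v uv|m m' u].
- by rewrite inE => /andP[].
- have : [set f u; f v] \in cover FF.
    by rewrite cFF; apply/complete_edgeP; exists (f u), (f v); rewrite (inj_eq f_inj).
  case/bigcupP => M MF uvM; have [m fm e] := perfect_matching_perm (pFF _ MF).
  exists m; first by rewrite inE fm -e.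
  by apply/esym/eqP; rewrite -perm_matching_edge // -e.
rewrite !inE => /andP[fm mF] /andP[fm' m'F] e; apply: perm_matching_inj => //.
apply/eqP; apply: contraT => /(trivIsetP tFF _ _ mF m'F)/pred0P/(_ [set f u; f (m u)]) /=.
by rewrite !perm_matching_edge // e eqxx.
Qed.

Lemma signed_countE :
  signed_count n = \sum_(F | one_fact F) fact_sign (fun v => f v : nat) F.
Proof.
rewrite /signed_count.
have inj F : one_fact F -> {in F &, injective perm_matching}.
  move=> oF m m' mF m'F; exact: perm_matching_inj (one_fact_fpf oF mF) (one_fact_fpf oF m'F).
rewrite [RHS](eq_bigr (fun F => sign_factorization (perm_factorization F))); last first.
  move=> F oF; rewrite /sign_factorization big_imset; last exact: inj.
  by apply: eq_bigr => m mF; rewrite cr_perm_matching // (one_fact_fpf oF mF).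
rewrite [RHS](eq_bigl (mem [set F | one_fact F])) => [|F]; last by rewrite !inE.
rewrite -(big_imset (h := perm_factorization) (@sign_factorization n)) /=; last first.
  move=> F F'; rewrite !inE => oF oF' e; apply/setP => m.
  have h G G' : one_fact G -> one_fact G' -> perm_factorization G = perm_factorization G' ->
      m \in G -> m \in G'.
    move=> oG oG' eG mG; have : perm_matching m \in perm_factorization G' by rewrite -eG
      imset_f.
    case/imsetP => m' m'G e'.
    by rewrite (perm_matching_inj (one_fact_fpf oG mG) (one_fact_fpf oG' m'G) e').
  by apply/idP/idP; apply: h.
apply: eq_bigl => FF; apply/idP/imsetP => [/factorization_perm[F oF ->]|[F]].
  by exists F; rewrite ?inE.
by rewrite inE => oF ->; apply: perm_factorizationP.
Qed.

End PerfectMatchings.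

Lemma signed_count_mod (p : nat) : prime p -> odd p ->
  (signed_count (2 * p) = - p%:Z %[mod (p ^ 2)%N%:Z])%Z.
Proof.
move=> p_pr p_odd; apply/eqP; rewrite eqz_mod_dvd opprK.
have cV := card_two_copies p_pr.
pose f (v : 'F_p * bool) : 'I_(2 * p) := cast_ord cV (enum_rank v).
have f_bij : bijective f.
  exists (fun i => enum_val (cast_ord (esym cV) i)) => x.
    by rewrite /f cast_ordK enum_rankK.
  by rewrite /f enum_valK cast_ordKV.
rewrite (signed_countE (0, false) f_bij).
have -> : \sum_(F | one_fact F) fact_sign (fun v => f v : nat) F =
    \sum_(F | one_fact F) fact_sign (@two_copies_key p) F.
  apply: eq_bigr => F oF; apply: (fact_sign_key (card_two_copies_even p_pr) oF).
    by move=> x y /val_inj /(bij_inj f_bij).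
  exact: two_copies_key_inj.
exact: sum_one_fact_two_copies.
Qed.

(** * Choosability and paintability *)

Section EdgeGames.

Variable G : sgraph.
Implicit Types (e : {set G}) (U A M : {set {set G}}) (t : {set G} -> nat).

Definition proper_on U (c : {set G} -> nat) :=
  forall e e', e \in U -> e' \in U -> e != e' -> ~~ [disjoint e & e'] -> c e != c e'.

(** Lister simulates the lists: each round takes a color from the list of an uncolored edge and
    marks all uncolored edges whose lists contain it. Painter's matching receives this color, which
    then leaves the lists, so tokens keep counting list entries. *)
Lemma painter_wins_choosable U t : painter_wins U t ->
  forall L : {set G} -> seq nat, (forall e, e \in U -> uniq (L e) /\ size (L e) = t e) ->
  exists2 c : {set G} -> nat, proper_on U c & forall e, e \in U -> c e \in L e.
Proof.
elim=> {}U {}t s t_gt0 sP _ IH L LP.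
have [->|[e0 e0U]] := set_0Vmem U.
  by exists (fun=> 0%N) => [e e'|e]; rewrite inE.
have [col colL] : exists col, col \in L e0.
  have [_ sz] := LP _ e0U; have := t_gt0 _ e0U; rewrite -sz.
  by case: (L e0) => // x l _; exists x; rewrite mem_head.
pose A := [set e in U | col \in L e].
have A0 : A != set0 by apply/set0Pn; exists e0; rewrite inE e0U.
have AU : A \subset U by apply/subsetP => e; rewrite inE => /andP[].
have [sA /andP[_ /trivIsetP sM]] := sP _ A0 AU.
pose L' e := rem col (L e).
have [e /setDP[eU _]|c cP cL] := IH A A0 AU L'.
  have [uL sL] := LP _ eU; split; first exact: rem_uniq.
  rewrite /L' inE eU /=; case: (boolP (col \in L e)) => h; last by rewrite rem_id // subn0.
  by rewrite size_rem // sL subn1.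
exists (fun e => if e \in s A then col else c e).
  move=> e e' eU e'U ee' dj; case: ifP => es; case: ifP => e's.
  - by rewrite sM ?ee' // in dj.
  - have e'D : e' \in U :\: s A by rewrite inE e's.
    have := cL _ e'D; rewrite /L' mem_rem_uniq; last by have [] := LP _ e'U.
    by rewrite !inE eq_sym => /andP[].
  - have eD : e \in U :\: s A by rewrite inE es.
    have := cL _ eD; rewrite /L' mem_rem_uniq; last by have [] := LP _ eU.
    by rewrite !inE => /andP[].
  by apply: cP; rewrite // inE ?es ?e's.
move=> e eU; case: ifP => es.
  by have := subsetP sA _ es; rewrite inE => /andP[].
by apply: mem_rem (cL e _); rewrite inE es.
Qed.

Lemma paintable_choosable k : edge_paintable G k -> edge_choosable G k.
Proof. by move=> w L LP; apply: painter_wins_choosable w L LP. Qed.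

Lemma choosable_colorable k : edge_choosable G k -> edge_colorable G k.
Proof.
move=> /(_ (fun=> iota 0 k))[e _|c cP cL]; first by rewrite iota_uniq size_iota.
by exists c => // e /cL; rewrite mem_iota.
Qed.

End EdgeGames.

(** The [n - 1] edges at one vertex need distinct colors. *)
Lemma colorable_complete n k : edge_colorable 'K_n k -> (n - 1 <= k)%N.
Proof.
case: n => [|n] // [c cP cK]; rewrite subn1 /=.
pose e (i : 'I_n) : {set 'K_n.+1} := [set ord0; lift ord0 i].
have eE i : e i \in edges 'K_n.+1.
  by apply/complete_edgeP; exists ord0, (lift ord0 i); rewrite neq_lift.
have e_inj : injective e.
  move=> i j /set2_eqP[[_ /lift_inj //]|[h _]].
  by have := neq_lift ord0 j; rewrite -h eqxx.
pose h i : 'I_k := Ordinal (cK _ (eE i)).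
have /leq_card : injective h.
  move=> i j /(congr1 val) /= hc; apply/e_inj/eqP; apply: contraT => ne.
  have dj : ~~ [disjoint e i & e j] by apply/pred0Pn; exists ord0; rewrite /= !set21.
  by have := cP _ _ (eE i) (eE j) ne dj; rewrite hc eqxx.
by rewrite !card_ord.
Qed.

(** * The Alon-Tarsi argument *)

Section DifferenceProducts.

Variable E : finType.
Local Notation exponent := {ffun E -> nat}.
Implicit Types (w : exponent -> int) (d : exponent) (l : seq (E * E)) (e : E).

Definition exponent_incr e d : exponent := [ffun x => (d x + (x == e))%N].

Definition exponent_add d d' : exponent := [ffun x => (d x + d' x)%N].

(* The value at [\prod_((e, f) <- l) (x_e - x_f)] of the linear functional on
   polynomials that sends the monomial with exponent vector [d] to [w d]. *)
Fixpoint diff_prod w l : int :=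
  if l is z :: l' then
    diff_prod (w \o exponent_incr z.1) l' - diff_prod (w \o exponent_incr z.2) l'
  else w [ffun => 0%N].

Lemma exponent_incrC e e' d :
  exponent_incr e (exponent_incr e' d) = exponent_incr e' (exponent_incr e d).
Proof. by apply/ffunP => x; rewrite !ffunE addnAC. Qed.

Lemma exponent_add_incr e d d' :
  exponent_add d (exponent_incr e d') = exponent_incr e (exponent_add d d').
Proof. by apply/ffunP => x; rewrite !ffunE addnA. Qed.

Lemma exponent_incr_add e d d' :
  exponent_add (exponent_incr e d) d' = exponent_incr e (exponent_add d d').
Proof. by apply/ffunP => x; rewrite !ffunE addnAC. Qed.

Lemma sum_exponent_incr e d :
  (\sum_x exponent_incr e d x = (\sum_x d x).+1)%N.
Proof.
under eq_bigr => x _ do rewrite ffunE.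
rewrite big_split /= -addn1; congr (_ + _)%N.
by rewrite (bigD1 e) //= eqxx big1 // => x /negPf->.
Qed.

(** The product is homogeneous, so only monomials of degree [size l] are seen. *)
Lemma diff_prod_homog w w' l :
  (forall d, (\sum_x d x = size l)%N -> w d = w' d) -> diff_prod w l = diff_prod w' l.
Proof.
elim: l w w' => [|z l IH] w w' ww' /=.
  by apply: ww'; rewrite big1 // => x _; rewrite ffunE.
by congr (_ - _); apply: IH => d dl; apply: ww'; rewrite sum_exponent_incr dl.
Qed.

Lemma eq_diff_prod w w' l : w =1 w' -> diff_prod w l = diff_prod w' l.
Proof. by move=> ww'; apply: diff_prod_homog. Qed.

Lemma diff_prod0 l : diff_prod (fun=> 0) l = 0.
Proof. by elim: l => //= z l IH; rewrite !(eq_diff_prod (w' := fun=> 0)) // IH subrr. Qed.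

Lemma diff_prod_sum (I : finType) (w : I -> exponent -> int) l :
  diff_prod (fun d => \sum_i w i d) l = \sum_i diff_prod (w i) l.
Proof. by elim: l w => //= z l IH w; rewrite !IH sumrB. Qed.

Lemma diff_prodB w w' l :
  diff_prod (fun d => w d - w' d) l = diff_prod w l - diff_prod w' l.
Proof.
elim: l w w' => //= z l IH w w'.
rewrite (IH (w \o exponent_incr z.1) (w' \o exponent_incr z.1)).
rewrite (IH (w \o exponent_incr z.2) (w' \o exponent_incr z.2)); ring.
Qed.

Lemma diff_prodZ c w l : diff_prod (fun d => c * w d) l = c * diff_prod w l.
Proof.
elim: l w => //= z l IH w.
by rewrite (IH (w \o exponent_incr z.1)) (IH (w \o exponent_incr z.2)) mulrBr.
Qed.

Lemma diff_prod_eval (x : E -> int) l :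
  diff_prod (fun d => \prod_e x e ^+ d e) l = \prod_(z <- l) (x z.1 - x z.2).
Proof.
elim: l => [|z l IH] /=.
  by rewrite big_nil big1 // => e _; rewrite ffunE.
have incrE e d : \prod_a x a ^+ exponent_incr e d a = x e * \prod_a x a ^+ d a.
  under eq_bigr => a _ do rewrite ffunE exprD.
  rewrite big_split /= mulrC (bigD1 e) //= eqxx expr1 big1 ?mulr1 //.
  by move=> a /negPf->.
rewrite (eq_diff_prod _ (incrE z.1)) (eq_diff_prod _ (incrE z.2)) !diff_prodZ IH.
by rewrite big_cons mulrBl.
Qed.

Lemma diff_prod_neq0 w l : diff_prod w l != 0 -> exists d, w d != 0.
Proof.
elim: l w => [|z l IH] w /= ; first by exists [ffun => 0%N].
have [->|/IH[d dw] _] := eqVneq (diff_prod (w \o exponent_incr z.1) l) 0.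
  by rewrite sub0r oppr_eq0 => /IH[d dw]; exists (exponent_incr z.2 d).
by exists (exponent_incr z.1 d).
Qed.

(** The functional does not distinguish [x_e] from [x_e'], so it kills the multiples of
    [x_e - x_e']. *)
Lemma diff_prod_vanish w l e e' : (e, e') \in l ->
  (forall d, w (exponent_incr e d) = w (exponent_incr e' d)) -> diff_prod w l = 0.
Proof.
elim: l w => // z l IH w; rewrite inE => /orP[/eqP<-|el] wE /=.
  by rewrite (eq_diff_prod _ wE) subrr.
by rewrite !IH ?subrr // => d; rewrite /= exponent_incrC wE exponent_incrC.
Qed.

Lemma diff_prod_filter (P : pred (E * E)) w l :
  diff_prod w l = diff_prod (fun d =>
    diff_prod (w \o exponent_add d) (filter P l)) (filter (predC P) l).
Proof.
elim: l w => [|z l IH] w /=.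
  by congr w; apply/ffunP => x; rewrite !ffunE.
rewrite (IH (w \o exponent_incr z.1)) (IH (w \o exponent_incr z.2)).
case: (P z) => /=.
  rewrite -diff_prodB; apply: eq_diff_prod => d.
  by congr (_ - _); apply: eq_diff_prod => d' /=; rewrite exponent_add_incr.
congr (_ - _); apply: eq_diff_prod => d /=; apply: eq_diff_prod => d' /=;
  by rewrite exponent_incr_add.
Qed.

(** The value is the sum over monomials of weight times coefficient. Exponents are at most [size l],
    so the monomials in the finite box [T] suffice. *)
Lemma diff_prod_coef_neq0 w l : diff_prod w l != 0 ->
  exists d, [/\ w d != 0, diff_prod (fun d' => (d' == d)%:R) l != 0 &
    (\sum_x d x = size l)%N].
Proof.
pose T := {ffun E -> 'I_(size l).+1}; pose tr (f : T) : exponent := [ffun x => f x : nat].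
have tr_inj : injective tr.
  by move=> f g /ffunP e; apply/ffunP => x; apply/val_inj; have := e x; rewrite !ffunE.
have -> : diff_prod w l = \sum_(f : T) w (tr f) * diff_prod (fun d' => (d' == tr f)%:R) l.
  under eq_bigr => f _ do rewrite -diff_prodZ.
  rewrite -diff_prod_sum; apply: diff_prod_homog => d dl.
  have dlt x : (d x < (size l).+1)%N by rewrite ltnS -dl (bigD1 x) //= leq_addr.
  pose f : T := [ffun x => Ordinal (dlt x)].
  have df : d = tr f by apply/ffunP => x; rewrite !ffunE.
  rewrite (bigD1 f) //= -df eqxx mulr1 big1 ?addr0 // => g gf.
  by rewrite df (inj_eq tr_inj) eq_sym (negPf gf) mulr0.
move=> nz; have [f] : exists f : T, w (tr f) * diff_prod (fun d' => (d' == tr f)%:R) l != 0.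
  apply/existsP; apply: contraR nz; rewrite negb_exists => /forallP h.
  by rewrite big1 // => f _; apply/eqP; have := h f; rewrite negbK.
rewrite mulf_eq0 negb_or => /andP[wf df]; exists (tr f); split=> //.
apply/eqP; apply: contraR df => ne; rewrite (diff_prod_homog (w' := fun=> 0)) ?diff_prod0 //.
by move=> d dl; case: eqP => // e; rewrite -e dl eqxx in ne.
Qed.

End DifferenceProducts.

(** * Painter's strategy from a nonzero coefficient *)

Section PainterStrategy.

Variable G : sgraph.
Local Notation edge := {set G}.
Implicit Types (U A J : {set edge}) (t : edge -> nat) (d : {ffun edge -> nat}).

Definition adjacent_pairs U : seq (edge * edge) :=
  [seq z <- enum {: edge * edge} | [&& z.1 \in U, z.2 \in U,
     (enum_rank z.1 < enum_rank z.2)%N & ~~ [disjoint z.1 & z.2]]].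

(** The Alon-Tarsi condition for the line graph on [U]: the [diff_prod] is the coefficient of its
    graph polynomial at [d]. *)
Definition alon_tarsi U t := exists d, (forall e, e \in U -> (d e < t e)%N) /\
  diff_prod (fun d' => (d' == d)%:R) (adjacent_pairs U) != 0.

Lemma adjacent_pairs_mem U e e' : e \in U -> e' \in U -> e != e' ->
  ~~ [disjoint e & e'] ->
  ((e, e') \in adjacent_pairs U) || ((e', e) \in adjacent_pairs U).
Proof.
move=> eU e'U ee' dj; rewrite [in X in X || _]mem_filter [in X in _ || X]mem_filter !mem_enum
  /= eU e'U dj disjoint_sym dj !andbT /=.
by have := ee'; rewrite -(inj_eq enum_rank_inj) -(inj_eq val_inj) /=; case: ltngtP.
Qed.

(* Restricting the exponents in [A] to values at least [d] keeps only the monomial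
   [d], by homogeneity; writing each such restriction as [1 - (smaller than d)] and
   expanding, some term survives, and its set [J] of unrestricted edges is a matching:
   a term that does not see the exponents of two adjacent edges vanishes. *)
Lemma alon_tarsi_step U t A : alon_tarsi U t -> A \subset U ->
  exists J, [/\ J \subset A, trivIset J &
    alon_tarsi (U :\: J) (fun e => t e - (e \in A))%N].
Proof.
case=> d0 [d0t nz] AU; set l := adjacent_pairs U in nz.
have [d [/= dd0 _ d0l]] := diff_prod_coef_neq0 nz.
have {d dd0} d0l : (\sum_x d0 x = size l)%N.
  by move: dd0; have [<-|_] := eqVneq d d0; rewrite ?eqxx.
pose F e : int := (e \in A)%:R.
pose K d e : int := if e \in A then - (d e < d0 e)%N%:R else (d e == d0 e)%:R.
pose w J d : int := \prod_e (if e \in J then F e else K d e).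
have : diff_prod (fun d => \sum_J w J d) l != 0.
  rewrite (diff_prod_homog (w' := fun d => (d == d0)%:R)) // => d dl.
  rewrite -bigA_distr; case: eqP => [->|ne].
    rewrite big1 // => e _; rewrite /F /K ltnn eqxx; case: (e \in A);
      rewrite ?oppr0 ?addr0 ?add0r //.
  apply/eqP; rewrite prodf_seq_eq0; apply: contra_notT ne.
  rewrite -all_predC => /allP h.
  have le e : (d0 e <= d e)%N.
    have := h e (mem_index_enum _); rewrite /= /F /K; case: (e \in A) => /=.
      by case: (ltnP (d e) (d0 e)) => // _; rewrite mulr1n subrr eqxx.
    by rewrite add0r; have [->|_] := eqVneq (d e) (d0 e); rewrite ?eqxx.
  apply/ffunP => e; apply/eqP; apply: contraT => ne.
  have : (\sum_x d0 x < \sum_x d x)%N.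
    rewrite (bigD1 e) //= [X in (_ < X)%N](bigD1 e) //= -addSn leq_add ?leq_sum //.
    by rewrite ltn_neqAle eq_sym ne le.
  by rewrite d0l dl ltnn.
rewrite diff_prod_sum => nzs; have [J nzJ] : exists J, diff_prod (w J) l != 0.
  apply/existsP; apply: contraR nzs; rewrite negb_exists => /forallP h.
  by rewrite big1 // => J _; apply/eqP; have := h J; rewrite negbK.
have JA : J \subset A.
  apply/subsetP => e eJ; apply: contraR nzJ => eA.
  rewrite (eq_diff_prod (w' := fun=> 0)) ?diff_prod0 // => d.
  by rewrite /w (bigD1 e) //= eJ /F (negPf eA) mul0r.
have w_incr e d : e \in J -> w J (exponent_incr e d) = w J d.
  move=> eJ; apply: eq_bigr => e' _; case: ifP => // e'J; rewrite /K ffunE.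
  have -> : (e' == e) = false by apply/eqP => ee; rewrite ee eJ in e'J.
  by rewrite addn0.
exists J; split=> //.
  apply/trivIsetP => e e' eJ e'J ee'; apply: contraR nzJ => dj.
  have [eU e'U] : e \in U /\ e' \in U by split; apply: (subsetP AU); apply: (subsetP JA).
  case/orP: (adjacent_pairs_mem eU e'U ee' dj) => /diff_prod_vanish -> // d;
    by rewrite !w_incr.
(* The factors that involve [J] contribute a monomial [d1]; the others form the polynomial of
   [U :\: J] and contribute [d2]. Outside [J], [d1 + d2] is below [d0] on marked edges and equal to
   it on the others, which bounds [d2] by the remaining tokens. *)
pose P (z : edge * edge) := (z.1 \notin J) && (z.2 \notin J).
rewrite (diff_prod_filter P) in nzJ.
have [d1 nz1] := diff_prod_neq0 nzJ.
have lE : filter P l = adjacent_pairs (U :\: J).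
  rewrite -filter_predI; apply: eq_filter => z /=; rewrite /P !inE.
  by case: (_ \in J); case: (_ \in J); rewrite ?andbF.
rewrite lE in nz1; have [d2 [/= w2 nz2 _]] := diff_prod_coef_neq0 nz1.
exists d2; split=> // e; rewrite inE => /andP[eJ eU].
have : K (exponent_add d1 d2) e != 0.
  by apply: contraNneq w2 => K0; rewrite /w (bigD1 e) //= (negPf eJ) K0 mul0r.
rewrite /K ffunE; have := d0t _ eU; case: (e \in A).
  case: (ltnP (d1 e + d2 e)%N (d0 e)) => [h dt _|_ _]; last by rewrite oppr0 eqxx.
  by move: h dt; move: (d1 e) (d2 e) (d0 e) (t e) => a b c u; rewrite subn1; lia.
case: ((d1 e + d2 e)%N =P d0 e) => [h dt _|_ _]; last by rewrite eqxx.
by move: h dt; move: (d1 e) (d2 e) (d0 e) (t e) => a b c u; rewrite subn0; lia.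
Qed.

(** Induction on the tokens of the uncolored edges: every nonempty marked set lowers their
    number. *)
Lemma alon_tarsi_painter_wins U t : U \subset edges G -> alon_tarsi U t ->
  painter_wins U t.
Proof.
have [k] := ubnP (\sum_(e in U) t e)%N; elim: k U t => // k IH U t ltk UE AT.
have ex A : exists J : {set edge}, A != set0 -> A \subset U ->
    [/\ J \subset A, trivIset J & alon_tarsi (U :\: J) (fun e => t e - (e \in A))%N].
  have [AU|] := boolP (A \subset U); last by exists set0.
  by have [J] := alon_tarsi_step AT AU; exists J.
have t_gt0 e : e \in U -> (0 < t e)%N.
  by case: AT => d [dt _] /dt; apply: leq_trans.
have [s sP] := fin_all_exists ex.
apply: (PainterWins (s := s)) => // A A0 AU; have [sA tA ATA] := sP A A0 AU.
  split=> //; apply/andP; split=> //.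
  exact: subset_trans sA (subset_trans AU UE).
apply: IH ATA; last exact: subset_trans (subsetDl _ _) UE.
have [e eA] := set0Pn _ A0; have eU := subsetP AU _ eA.
rewrite -ltnS; apply: leq_trans ltk; rewrite ltnS.
apply: (@leq_ltn_trans (\sum_(x in U) (t x - (x \in A)))%N).
  by rewrite [X in (_ <= X)%N](big_setID (s A)) leq_addl.
rewrite (bigD1 e) //= [X in (_ < X)%N](bigD1 e) //= eA -addSn leq_add //.
  by rewrite subn1 prednK // t_gt0.
by apply: leq_sum => x _; apply: leq_subr.
Qed.

End PainterStrategy.

(** * Proper colorings of the complete graph *)

(** An [N]-th finite difference kills powers below [N]. The offset [a] serves the induction:
    Pascal's rule yields the difference of the sums at [a] and [a + 1]. *)
Lemma alternating_binomial_sum N j a : (j < N)%N ->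
  \sum_(c < N.+1) (-1) ^+ c * 'C(N, c)%:R * (c%:R + a) ^+ j = 0 :> int.
Proof.
elim: N j a => // N IH j a jN.
pose S b i := \sum_(c < N.+1) (-1) ^+ c * 'C(N, c)%:R * (c%:R + b) ^+ i : int.
have -> : \sum_(c < N.+2) (-1) ^+ c * 'C(N.+1, c)%:R * (c%:R + a) ^+ j = S a j - S (a + 1) j.
  rewrite big_ord_recl /= bin0 /S.
  under eq_bigr => i _ do rewrite /bump /= add1n binS natrD mulrDr mulrDl.
  rewrite big_split /= addrA; congr (_ + _).
    rewrite [RHS]big_ord_recl /= bin0; congr (_ + _).
    by rewrite big_ord_recr /= bin_small // mulr0 mul0r addr0.
  rewrite -sumrN; apply: eq_bigr => i _.
  by rewrite exprS mulN1r !mulNr -natr1 -addrA [1 + a]addrC.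
move: jN; rewrite ltnS leq_eqVlt => /orP[/eqP ->|jN]; last by rewrite /S !IH ?subrr.
rewrite -sumrB (eq_bigr (fun c : 'I_N.+1 => - \sum_(i < N) 'C(N, i)%:R *
    ((-1) ^+ c * 'C(N, c)%:R * (c%:R + a) ^+ i))); last first.
  move=> c _; rewrite -mulrBr addrA; move: (c%:R + a) => y;
    rewrite [y + 1]addrC exprDn big_ord_recr /= subnn expr0 mul1r.
  rewrite binn mulr1n opprD addrCA subrr addr0 mulrN mulr_sumr; congr (- _).
  by apply: eq_bigr => i _; rewrite expr1n mul1r -mulr_natl; ring.
rewrite sumrN exchange_big big1 ?oppr0 //= => i _.
by rewrite -mulr_sumr IH ?mulr0.
Qed.

Section CompleteGraph.

Variable k : nat.
Local Notation n := k.+2.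
Local Notation edge := {set 'K_n}.
Local Notation color := 'I_k.+1.

(** An edge meets [k] others at each end, and every unordered pair is listed once. *)
Lemma size_adjacent_pairs :
  (size (adjacent_pairs (edges 'K_n)) <= #|edges 'K_n| * k)%N.
Proof.
set U := edges 'K_n.
pose Lt := [set z : edge * edge | [&& z.1 \in U, z.2 \in U,
     (enum_rank z.1 < enum_rank z.2)%N & ~~ [disjoint z.1 & z.2]]].
pose Gt := [set (z.2, z.1) | z in Lt].
pose Adj := [set z : edge * edge | [&& z.1 \in U, z.2 \in U, z.2 != z.1 & ~~ [disjoint z.1 &
  z.2]]].
have -> : size (adjacent_pairs U) = #|Lt|.
  rewrite size_filter -sum1_count big_enum_cond /= -[RHS]sum1_card.
  by apply: eq_bigl => z; rewrite !inE.
have dj : [disjoint Lt & Gt].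
  apply/pred0P => z /=; apply/negbTE/negP => /andP[zL /imsetP[y yG e]].
  by move: zL yG; rewrite e !inE /= => /and4P[_ _ h _] /and4P[_ _ h' _];
    rewrite ltnNge ltnW in h.
have GtE : #|Gt| = #|Lt| by apply: card_imset => -[e1 e2] [e3 e4] [-> ->].
have sub : Lt :|: Gt \subset Adj.
  apply/subsetP => z; rewrite !inE => /orP[/and4P[-> -> h ->]|/imsetP[y]].
    by rewrite andbT /=; apply: contraTneq h => ->; rewrite ltnn.
  rewrite inE => /and4P[h1 h2 h h4] ->; rewrite /= h1 h2 disjoint_sym h4 andbT /=.
  by apply: contraTneq h => ->; rewrite ltnn.
suff le : (#|Adj| <= #|U| * (2 * k))%N.
  have := leq_trans (subset_leq_card sub) le.
  by rewrite cardsU (disjoint_setI0 dj) cards0 subn0 GtE; lia.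
rewrite -sum1_card (eq_bigl (fun z : edge * edge => (z.1 \in U) &&
  [&& z.2 \in U, z.2 != z.1 & ~~ [disjoint z.1 & z.2]])) => [|z]; last by rewrite inE.
rewrite -(pair_big_dep (mem U) (fun e e' => [&& e' \in U, e' != e & ~~ [disjoint e & e']])
  (fun _ _ => 1%N)) /= -sum_nat_const.
apply: leq_sum => e /complete_edgeP[u [v [uv ->]]].
pose star (a : 'I_n) : {set edge} := [set [set a; b] | b in ~: [set u; v]].
have cstar a : (#|star a| <= k)%N.
  apply: leq_trans (leq_imset_card _ _) _.
  by have := cardsC [set u; v]; rewrite cards2 uv card_ord; lia.
rewrite sum1dep_card; apply: (@leq_trans #|star u :|: star v|); last first.
  by apply: leq_trans (leq_card_setU _ _) _; rewrite mul2n -addnn leq_add.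
apply/subset_leq_card/subsetP => e'; rewrite inE => /and3P[/complete_edgeP[a [b [ab ->]]] ne].
have key c d : c \in [set u; v] -> c != d -> [set c; d] != [set u; v] ->
    [set c; d] \in star u :|: star v.
  rewrite !inE => cuv cd nuv; have dN : d \in ~: [set u; v].
    rewrite !inE negb_or; case/orP: cuv cd nuv => /eqP -> cd nuv.
      by rewrite eq_sym cd; apply: contraNneq nuv => ->.
    by rewrite [d == v]eq_sym cd andbT; apply: contraNneq nuv => ->; rewrite setUC.
  by case/orP: cuv => /eqP ->; apply/orP; [left | right]; apply/imsetP; exists d.
case/pred0Pn => c /= /andP[cuv cab].
have [ce|ce] : c = a \/ c = b by move: cab; rewrite !inE => /orP[]/eqP->; [left|right].
  by rewrite ce in cuv; apply: key.
by rewrite ce in cuv; rewrite setUC in ne *; apply: key; rewrite // eq_sym.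
Qed.

(** Up to a common factor, the Lagrange weights [1 / \prod_(c' != c) (c - c')] at the points
    [0, ..., k]. On sets that are not edges the color is pinned, so that they do not multiply the
    sum. *)
Definition color_weight (e : edge) (c : color) : int :=
  if e \in edges 'K_n then (-1) ^+ c * 'C(k, c)%:R else (c == ord0)%:R.

Definition coloring_sum : int := \sum_(x : {ffun edge -> color})
  (\prod_e color_weight e (x e)) *
  \prod_(z <- adjacent_pairs (edges 'K_n)) ((x z.1)%:R - (x z.2)%:R).

(* Quantitative form of the Combinatorial Nullstellensatz: the weights annihilate
   the powers below [k], and the number of adjacent pairs is [k] per edge. *)
Lemma coloring_sum_alon_tarsi : coloring_sum != 0 ->
  alon_tarsi (edges 'K_n) (fun=> k.+1).
Proof.
pose w (d : {ffun edge -> nat}) : int := \prod_e \sum_(c : color) color_weight e c * c%:R ^+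
  d e.
have -> : coloring_sum = diff_prod w (adjacent_pairs (edges 'K_n)).
  rewrite (eq_diff_prod (w' := fun d => \sum_(x : {ffun edge -> color})
     (\prod_e color_weight e (x e)) * \prod_e (x e)%:R ^+ d e)); last first.
    by move=> d; rewrite /w bigA_distr_bigA; apply: eq_bigr => x _; rewrite big_split.
  rewrite diff_prod_sum; apply: eq_bigr => x _; rewrite diff_prodZ.
  by rewrite (diff_prod_eval (fun e => (x e)%:R)).
case/diff_prod_coef_neq0 => d [wd nz dl]; exists d; split=> // e eU.
have ge e' : e' \in edges 'K_n -> (k <= d e')%N.
  move=> e'U; rewrite leqNgt; apply: contra_neqN wd => lt.
  suff e0 : \sum_(c : color) color_weight e' c * c%:R ^+ d e' = 0.
    by rewrite /w (bigD1 e') //= e0 mul0r.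
  rewrite -[RHS](@alternating_binomial_sum k (d e') 0) //; apply: eq_bigr => c _.
  by rewrite /color_weight e'U addr0.
rewrite ltnNge; apply/negP => lt.
have : (#|edges 'K_n| * k < \sum_x d x)%N.
  rewrite (bigID (mem (edges 'K_n))) /= -sum_nat_const.
  apply: leq_trans (leq_addr _ _); rewrite (bigD1 e) //= [X in (_ < X)%N](bigD1 e) //=.
  by rewrite -addSn leq_add // leq_sum // => x /andP[/ge].
by rewrite dl ltnNge size_adjacent_pairs.
Qed.

End CompleteGraph.

(** * Inversions between half-edges *)

Section HalfEdges.

Variables (n d : nat) (rk : 'I_n -> 'I_n -> nat).
Hypothesis rk_sym : forall u v, rk u v = rk v u.
Hypothesis rk_inj : forall u v a b, u != v -> rk u v = rk a b ->
  (u = a /\ v = b) \/ (u = b /\ v = a).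

Local Notation V := 'I_n.
Local Notation D := 'I_d.
Local Notation T := (V * D)%type.
Implicit Types (v w : V) (i j : D) (x y : T).

Definition ordered_fact (h : D -> {perm V}) :=
  [/\ forall i, fpf_involution (h i), forall v, injective (fun i => h i v) &
    forall u v, u != v -> exists i, h i u = v].

(** At each vertex, the sign of the permutation comparing the ranks of its edges with their
    colors. *)
Definition half_edge_sign (h : D -> {perm V}) : int :=
  \prod_v \prod_(z : D * D | (rk v (h z.1 v) < rk v (h z.2 v))%N)
     inversion_sign (@nat_of_ord d) z.1 z.2.

Definition vertex_first x : nat := (x.1 * d + x.2)%N.

Definition color_first x : nat := (x.2 * n + x.1)%N.

Lemma lex_ltn (a b c a' b' : nat) : (b < c)%N -> (b' < c)%N ->
  (a * c + b < a' * c + b')%N = if a == a' then (b < b')%N else (a < a')%N.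
Proof. by case: (ltngtP a a') => [h|h|->] bc b'c; rewrite ?ltn_add2l //; nia. Qed.

Lemma lex_eq (a b c a' b' : nat) : (b < c)%N -> (b' < c)%N ->
  (a * c + b = a' * c + b')%N -> a = a' /\ b = b'.
Proof.
move=> bc b'c e; have aa : a = a' by nia.
by split=> //; move: e; rewrite aa => /addnI.
Qed.

Lemma vertex_first_inj : injective vertex_first.
Proof.
by move=> [v i] [w j] /lex_eq[] // /val_inj /= -> /val_inj /= ->.
Qed.

Lemma color_first_inj : injective color_first.
Proof.
by move=> [v i] [w j] /lex_eq[] // /val_inj /= -> /val_inj /= ->.
Qed.

Lemma inversion_vertex_first v i w j : inversion_sign vertex_first (v, i) (w, j) =
  if v == w then inversion_sign (@nat_of_ord d) i j else inversion_sign (@nat_of_ord n) v w.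
Proof.
by rewrite /inversion_sign /vertex_first lex_ltn //= [v == w]eq_sym -val_eqE /=;
  case: (nat_of_ord w == v).
Qed.

Lemma inversion_color_first v i w j : inversion_sign color_first (v, i) (w, j) =
  if i == j then inversion_sign (@nat_of_ord n) v w else inversion_sign (@nat_of_ord d) i j.
Proof.
by rewrite /inversion_sign /color_first lex_ltn //= [i == j]eq_sym -val_eqE /=;
  case: (nat_of_ord j == i).
Qed.

Lemma prod_half_edges (F : T -> T -> int) :
  \prod_(z : T * T) F z.1 z.2 = \prod_v \prod_w \prod_i \prod_j F (v, i) (w, j).
Proof.
transitivity (\prod_x \prod_y F x y); first by rewrite pair_bigA.
transitivity (\prod_v \prod_i \prod_w \prod_j F (v, i) (w, j)).
  rewrite [RHS]pair_bigA; apply: eq_bigr => -[v i] _ /=.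
  by rewrite [RHS]pair_bigA; apply: eq_bigr => -[w j].
by apply: eq_bigr => v _; rewrite exchange_big.
Qed.

Lemma prod_half_edges_color (F : T -> T -> int) :
  \prod_(z : T * T) F z.1 z.2 = \prod_i \prod_j \prod_v \prod_w F (v, i) (w, j).
Proof.
rewrite prod_half_edges; under eq_bigr => v _ do rewrite exchange_big /=.
rewrite exchange_big /=; apply: eq_bigr => i _.
by under eq_bigr => v _ do rewrite exchange_big /=; rewrite exchange_big.
Qed.

Definition order_constant : int :=
  \prod_(z : T * T | (vertex_first z.1 < vertex_first z.2)%N)
    relative_sign vertex_first color_first z.1 z.2.

(** The contribution of half-edges at different vertices [v], [w]: whatever the coloring, their
    partners run over all [a != v] and all [b != w]. *)
Definition vertex_constant : int := \prod_v \prod_(w | w != v)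
  \prod_(a | a != v) \prod_(b | b != w)
    if (rk v a < rk w b)%N then inversion_sign (@nat_of_ord n) v w else 1.

(** A half-edge is a vertex with a color, and [g] is the rank of its edge. Inversions of [g] against
    [vertex_first] give the signs at the vertices and a constant. Against [color_first] they give
    the signs of the factors, since for two colors the halves of each edge cancel. Comparing the two
    orders along [g] gives a constant, as the halves of one edge have relative sign 1. *)
Lemma half_edge_signE h : ordered_fact h ->
  half_edge_sign h * vertex_constant * \prod_i match_sign (@nat_of_ord n) (h i) =
  order_constant.
Proof.
case=> fh h_inj h_ex; pose g x := rk x.1 (h x.2 x.1).
have gE v i w j : g (v, i) = g (w, j) -> i = j /\ (w = v \/ w = h i v).
  rewrite /g /= => /rk_inj[|[vw hh]|[vh hv]].
  - by rewrite eq_sym fpf_neq.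
  - by subst w; split; [apply: h_inj hh|left].
  subst w; have ij : i = j.
    by apply: (h_inj (h i v)) => /=; rewrite -vh fpfK.
  by split=> //; right.
have g_partner v i : g (h i v, i) = g (v, i) by rewrite /g /= fpfK // rk_sym.
have reidx v (F : V -> int) : \prod_i F (h i v) = \prod_(a | a != v) F a.
  rewrite (eq_bigl (mem [set h i v | i : D])) => [|a]; last first.
    apply/idP/imsetP => [|[i _ ->]]; last by rewrite fpf_neq.
    by rewrite eq_sym => /h_ex[i <-]; exists i.
  by rewrite big_imset //=; move=> i j _ _; apply: h_inj.
have -> : half_edge_sign h * vertex_constant =
    \prod_(z : T * T | (g z.1 < g z.2)%N) inversion_sign vertex_first z.1 z.2.
  rewrite [RHS]big_mkcond (prod_half_edges (fun x y => if (g x < g y)%N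
    then inversion_sign vertex_first x y else 1)) -big_split /=.
  apply: eq_bigr => v _; rewrite [RHS](bigD1 v) //=; congr (_ * _).
    rewrite big_mkcond /= [RHS]pair_bigA; apply: eq_bigr => -[i j] _ /=.
    by rewrite inversion_vertex_first eqxx.
  apply: eq_bigr => w wv; rewrite -(reidx v (fun a => \prod_(b | b != w) _)).
  apply: eq_bigr => i _; rewrite -(reidx w (fun b => if (_ < rk w b)%N then _ else _)).
  by apply: eq_bigr => j _; rewrite inversion_vertex_first eq_sym (negPf wv).
have -> : \prod_i match_sign (@nat_of_ord n) (h i) =
    \prod_(z : T * T | (g z.1 < g z.2)%N) inversion_sign color_first z.1 z.2.
  rewrite [RHS]big_mkcond (prod_half_edges_color (fun x y => if (g x < g y)%N
    then inversion_sign color_first x y else 1)) /=.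
  apply: eq_bigr => i _; rewrite (bigD1 i) //= [X in _ * X]big1 ?mulr1; last first.
    move=> j ji; rewrite (prod_fpf_involution _ (fh i) val_inj) big1 // => v _.
    rewrite g_partner -big_split big1 //= => w _;
      rewrite !inversion_color_first eq_sym (negPf ji).
    by case: ifP => // _; rewrite inversion_sign_sqr.
  have gi : edge_key (fun v => g (v, i)) (h i).
    move=> v w; apply/eqP/orP => [/gE[_ [->|->]]|[]/eqP->]; rewrite ?eqxx ?g_partner //;
      by [left|right].
  rewrite (match_signE val_inj (fh i) gi) big_mkcond /=.
  rewrite [RHS]pair_bigA; apply: eq_bigr => -[v w] _ /=.
  by rewrite inversion_color_first eqxx.
rewrite -big_split /= /order_constant.
apply: prod_key_order => [x y|[v i] [w j]].
  by apply: relative_signC; [apply: vertex_first_inj|apply: color_first_inj].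
rewrite (inj_eq vertex_first_inj) /=; have [/gE[ij]|] := eqVneq (g (v, i)) (g (w, j));
  last first.
  by move=> ne _; apply/esym/negbTE; apply: contraNneq ne => ->.
subst j; case=> ->; first by rewrite eqxx.
rewrite /relative_sign inversion_vertex_first inversion_color_first eqxx.
by rewrite [v == _]eq_sym (negPf (fpf_neq _ (fh i))) inversion_sign_sqr.
Qed.

End HalfEdges.

(** * Proper colorings as ordered one-factorizations *)

Section ColoringSum.

Variable k : nat.
Local Notation n := k.+2.
Local Notation V := 'I_n.
Local Notation edge := {set 'K_n}.
Local Notation color := 'I_k.+1.
Implicit Types (h : {ffun color -> {perm V}}) (x : {ffun edge -> color}).

Let id_bij : bijective (@id V). Proof. by exists id. Qed.
Local Notation matching_of := (@perm_matching V n id).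
Local Notation edge_rank u v := (enum_rank ([set u; v] : edge) : nat).

Definition edge_rk (u v : V) : nat := edge_rank u v.

Lemma edge_rkC u v : edge_rk u v = edge_rk v u.
Proof. by rewrite /edge_rk setUC. Qed.

Lemma edge_rk_eq u v a b : edge_rk u v = edge_rk a b ->
  (u = a /\ v = b) \/ (u = b /\ v = a).
Proof. by move=> /val_inj /enum_rank_inj /set2_eqP. Qed.

(** The default [ord0] agrees with the color that [color_weight] pins outside the edges. *)
Definition factor_coloring h : {ffun edge -> color} :=
  [ffun e : edge => odflt ord0 [pick i | e \in matching_of (h i)]].

Lemma factor_coloringE h i v : ordered_fact h ->
  factor_coloring h [set v; h i v] = i.
Proof.
case=> fh h_inj _; rewrite ffunE; case: pickP => [j|/(_ i)] /=.
  by rewrite (perm_matching_edge id_bij) // => /eqP /h_inj.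
by rewrite (perm_matching_edge id_bij) // eqxx.
Qed.

Definition ordered_facts : {set {ffun color -> {perm V}}} :=
  [set h : {ffun color -> {perm V}} | injectiveb h && one_fact [set h i | i : color]].

Lemma ordered_factsP h : reflect (ordered_fact h) (h \in ordered_facts).
Proof.
rewrite inE; apply: (iffP andP) => [[/injectiveP h_inj oF]|[fh h_inj h_ex]].
  split=> [i|v i j e|u v /(one_fact_ex oF)[_ /imsetP[i _ ->]]]; last by exists i.
    by apply: one_fact_fpf oF _; apply: imset_f.
  by apply/h_inj/(one_fact_inj (u := v) oF); rewrite ?imset_f.
split; first by apply/injectiveP => i j e; apply: (h_inj ord0); rewrite e.
apply: one_factP => [_ /imsetP[i _ ->]//|u v /h_ex[i <-]|_ _ u /imsetP[i _ ->] /imsetP[j _ ->]].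
  by exists (h i); rewrite ?imset_f.
by move/h_inj ->.
Qed.

Lemma factor_coloring_inj : {in ordered_facts &, injective factor_coloring}.
Proof.
move=> h h' /ordered_factsP oh /ordered_factsP oh' e.
apply/ffunP => i; apply/permP => v; have [fh _ _] := oh; have [_ _ ex'] := oh'.
have [j hj] : exists j, h' j v = h i v by apply: ex'; rewrite eq_sym fpf_neq.
have := factor_coloringE i v oh; rewrite e -hj factor_coloringE // => ij.
by rewrite ij.
Qed.

Definition coloring_term x : int := (\prod_e color_weight e (x e)) *
  \prod_(z <- adjacent_pairs (edges 'K_n)) ((x z.1)%:R - (x z.2)%:R).

Lemma edge_in (u v : V) : u != v -> [set u; v] \in edges 'K_n.
Proof. by move=> uv; apply/complete_edgeP; exists u, v. Qed.

(** The product forces a proper coloring. A vertex has [k + 1] neighbors and there are [k + 1]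
    colors, so every color occurs at every vertex and the color classes are perfect matchings. *)
Lemma coloring_term_neq0 x : coloring_term x != 0 -> x \in factor_coloring @: ordered_facts.
Proof.
rewrite mulf_eq0 negb_or => /andP[wx px].
have x_out e : e \notin edges 'K_n -> x e = ord0.
  move=> eE; apply/eqP; apply: contraR wx => xe.
  by rewrite (bigD1 e) //= /color_weight (negPf eE) (negPf xe) mul0r.
have x_adj v a b : a != v -> b != v -> x [set v; a] = x [set v; b] -> a = b.
  move=> av bv xab; apply/eqP; apply: contraR px => ab.
  have ne : [set v; a] != [set v; b] :> edge.
    by apply: contraNneq ab => /set2_eqP[[_ ->]//|[vb _]]; rewrite vb eqxx in bv.
  have dj : ~~ [disjoint [set v; a] & [set v; b]] by apply/pred0Pn; exists v; rewrite /= !set21.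
  have va : v != a by rewrite eq_sym.
  have vb : v != b by rewrite eq_sym.
  rewrite prodf_seq_eq0; apply/hasP.
  case/orP: (adjacent_pairs_mem (edge_in va) (edge_in vb) ne dj) => zin.
    by exists ([set v; a], [set v; b]); rewrite //= xab subrr.
  by exists ([set v; b], [set v; a]); rewrite //= xab subrr.
have x_ex v i : exists a, (a != v) && (x [set v; a] == i).
  have inj : injective (fun b : color => x [set v; lift v b]).
    by move=> b c /x_adj; rewrite ![lift v _ == _]eq_sym !neq_lift => /(_ isT isT)/lift_inj.
  have := inj_card_onto inj (leqnn _) i.
  by case/codomP => b ->; exists (lift v b); rewrite eq_sym neq_lift eqxx.
pose f i v := odflt v [pick a | (a != v) && (x [set v; a] == i)].
have fP i v : f i v != v /\ x [set v; f i v] = i.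
  rewrite /f; case: pickP => [a /andP[? /eqP]|no] //=.
  by have [a] := x_ex v i; rewrite no.
have fK i : involutive (f i).
  move=> v; have [h1 h2] := fP i v; have [h3 h4] := fP i (f i v).
  by apply: x_adj h3 _ _; rewrite 1?eq_sym // h4 setUC.
pose h : {ffun color -> {perm V}} := [ffun i => perm (inv_inj (fK i))].
have hE i v : h i v = f i v by rewrite ffunE permE.
have oh : ordered_fact h.
  split=> [i|v i j|u v uv].
  - by apply/forallP => v; rewrite !hE fK eqxx andbT; case: (fP i v).
  - by rewrite !hE => e; have [_ <-] := fP i v; have [_ <-] := fP j v; rewrite e.
  exists (x [set u; v]); rewrite hE; have [h1 h2] := fP (x [set u; v]) u.
  by apply: x_adj h1 _ h2; rewrite eq_sym.
apply/imsetP; exists h; first exact/ordered_factsP.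
apply/ffunP => e; have [/complete_edgeP[u [v [uv ->]]]|eE] := boolP (e \in edges 'K_n).
  have [_ _ /(_ _ _ uv)[i <-]] := oh; rewrite factor_coloringE // hE.
  by have [_ ->] := fP i u.
rewrite x_out // ffunE; case: pickP => //= i; have [fh _ _] := oh.
case/andP: (perm_matching_perfect id_bij (fh i)) => /subsetP sub _ /sub.
by rewrite (negPf eE).
Qed.

Definition weight_constant : int :=
  \prod_(i : color) ((-1) ^+ i * 'C(k, i)%:R) ^+ n./2.

Definition color_constant : int := \prod_(z : color * color | (z.1 < z.2)%N) (z.1%:R - z.2%:R).

Lemma card_perm_matching (m : {perm V}) : fpf_involution m -> #|matching_of m| = n./2.
Proof.
move=> fm; have /andP[sub part] := perm_matching_perfect id_bij fm.
have c2 : {in matching_of m, forall A : edge, #|A| = 2}.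
  by move=> _ /imsetP[v _ ->]; rewrite cards2 eq_sym fpf_neq.
by have := card_uniform_partition c2 part; rewrite cardsT card_ord; lia.
Qed.

Lemma prod_color_weight h : ordered_fact h ->
  \prod_e color_weight e (factor_coloring h e) = weight_constant.
Proof.
move=> oh; have [fh h_inj h_ex] := oh.
rewrite (bigID (mem (edges 'K_n))) /= [X in _ * X]big1 ?mulr1; last first.
  move=> e eE; rewrite /color_weight (negPf eE) ffunE; case: pickP => //= i.
  case/andP: (perm_matching_perfect id_bij (fh i)) => /subsetP sub _ /sub.
  by rewrite (negPf eE).
rewrite (partition_big (factor_coloring h) predT) //=; apply: eq_bigr => i _.
rewrite -(card_perm_matching (fh i)) -prodr_const; apply: eq_big => [e|e /andP[eE /eqP ->]].
  apply/andP/idP => [[/complete_edgeP[u [v [uv ->]]]]|].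
    have [j <-] := h_ex _ _ uv; rewrite factor_coloringE // => /eqP ->.
    by rewrite (perm_matching_edge id_bij).
  case/imsetP=> v _ ->; rewrite factor_coloringE // eqxx; split=> //.
  by apply: edge_in; rewrite eq_sym fpf_neq.
by rewrite /color_weight eE.
Qed.

(** Adjacent pairs correspond to a common vertex and two colors. At each vertex, ordering the pairs
    by color instead of edge rank produces [color_constant] and the sign of the reordering. *)
Lemma prod_adjacent_pairs h : ordered_fact h ->
  \prod_(z <- adjacent_pairs (edges 'K_n))
     ((factor_coloring h z.1)%:R - (factor_coloring h z.2)%:R) =
  color_constant ^+ n * half_edge_sign edge_rk h.
Proof.
move=> oh; have [fh h_inj h_ex] := oh.
pose Q := [set t : V * (color * color) |
  (edge_rk t.1 (h t.2.1 t.1) < edge_rk t.1 (h t.2.2 t.1))%N].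
pose Lt := [set z : edge * edge | [&& z.1 \in edges 'K_n, z.2 \in edges 'K_n,
     (enum_rank z.1 < enum_rank z.2)%N & ~~ [disjoint z.1 & z.2]]].
pose pr (t : V * (color * color)) : edge * edge :=
  ([set t.1; h t.2.1 t.1], [set t.1; h t.2.2 t.1]).
have pr_inj : {in Q &, injective pr}.
  move=> [v [i j]] [v' [i' j']]; rewrite !inE /= => lt lt' [] e1 e2.
  have ii : i = i' by rewrite -(factor_coloringE i v oh) e1 factor_coloringE.
  have jj : j = j' by rewrite -(factor_coloringE j v oh) e2 factor_coloringE.
  (* With two common vertices [v] and [v'] both edges would be [{v, v'}], against the strict order
     of their ranks. *)
  case/set2_eqP: e1 => -[vv e1]; first by rewrite vv ii jj.
  case/set2_eqP: e2 => -[vv2 e2]; first by rewrite vv2 ii jj.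
  by move: lt'; rewrite -vv -vv2 ltnn.
have LtE : Lt = pr @: Q.
  apply/setP => -[e e']; apply/idP/imsetP => [|[[v [i j]]]]; rewrite !inE /=; last first.
    move=> lt [-> ->]; rewrite !edge_in ?[v == _]eq_sym ?fpf_neq //=; apply/andP; split=> //.
    by apply/pred0Pn; exists v; rewrite /= !set21.
  case/and4P => /complete_edgeP[a [b [ab eE]]] /complete_edgeP[c [d [cd e'E]]] lt.
  case/pred0Pn => v /= /andP[ve ve'].
  have star (A : edge) a' b' : a' != b' -> A = [set a'; b'] -> v \in A ->
      exists i, A = [set v; h i v].
    move=> ab' ->; rewrite !inE => /orP[] /eqP ->.
      by have [i <-] := h_ex _ _ ab'; exists i.
    by rewrite eq_sym in ab'; have [i <-] := h_ex _ _ ab'; exists i; rewrite setUC.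
  have [i ei] := star _ _ _ ab eE ve; have [j ej] := star _ _ _ cd e'E ve'.
  by exists (v, (i, j)); rewrite ?inE /= /edge_rk /pr /= -?ei -?ej.
rewrite /adjacent_pairs big_filter big_enum_cond /=.
rewrite (eq_bigl (mem Lt)) => [|z]; last by rewrite !inE.
rewrite LtE big_imset //=.
transitivity (\prod_v \prod_(z : color * color | (edge_rk v (h z.1 v) < edge_rk v (h z.2 v))%N)
    (z.1%:R - z.2%:R : int)).
  rewrite pair_big_dep /=; apply: eq_big => [t|t _]; first by rewrite !inE.
  by rewrite !factor_coloringE.
rewrite -[X in _ ^+ X]card_ord -prodr_const -big_split; apply: eq_bigr => v _ /=.
pose s (i j : color) : int := (i%:R - j%:R) * inversion_sign (@nat_of_ord _) i j.
transitivity (\prod_(z : color * color | (edge_rk v (h z.1 v) < edge_rk v (h z.2 v))%N)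
  (s z.1 z.2 * inversion_sign (@nat_of_ord _) z.1 z.2)).
  by apply: eq_bigr => z _; rewrite /s -mulrA inversion_sign_sqr mulr1.
rewrite big_split /=; congr (_ * _).
rewrite (@prod_key_order _ _ (fun i => edge_rk v (h i v)) (@nat_of_ord _) s).
- apply: eq_bigr => z zlt; rewrite /s /inversion_sign ltnNge ltnW //= mulr1 //.
- move=> i j; rewrite /s; have [->|ij] := eqVneq i j; first by rewrite subrr !mul0r.
  rewrite (inversion_signC (v := i) (w := j)) ?(inj_eq val_inj) //; ring.
move=> i j _; rewrite [RHS](inj_eq val_inj); apply/eqP/eqP => [/edge_rk_eq|-> //].
case=> [[_ /h_inj //]|[e _]]; have := fpf_neq v (fh j); rewrite -e eqxx //.
Qed.

End ColoringSum.

Section Paintability.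

Variable k : nat.
Local Notation n := k.+2.
Local Notation V := 'I_n.
Local Notation color := 'I_k.+1.

Lemma card_ordered_facts (F : {set {perm V}}) : one_fact F ->
  #|[set h in ordered_facts k | [set h i | i : color] == F]| = (k.+1)`!.
Proof.
move=> oF; have cF : #|F| = k.+1 by rewrite (card_one_fact ord0 oF) card_ord.
have := card_inj_ffuns_on color (mem F); rewrite cF card_ord ffactnn => <-.
apply: eq_card => h; rewrite !inE; apply/andP/andP => [[/andP[inj _] /eqP <-]|[hF inj]].
  by split=> //; apply/ffun_onP => i; apply: imset_f.
have hE : [set h i | i : color] = F.
  apply/eqP; rewrite eqEcard card_imset ?card_ord ?cF ?leqnn ?andbT; last exact/injectiveP.
  by apply/subsetP => _ /imsetP[i _ ->]; apply: (ffun_onP hF).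
by rewrite inj hE oF eqxx.
Qed.

Lemma half_edge_sign_match (h : {ffun color -> {perm V}}) : ordered_fact h ->
  half_edge_sign (@edge_rk k) h =
  order_constant n k.+1 * vertex_constant (@edge_rk k) *
    \prod_i match_sign (@nat_of_ord n) (h i).
Proof.
move=> oh; have := half_edge_signE (@edge_rkC k) (fun u v a b _ => @edge_rk_eq k u v a b) oh.
set vc := vertex_constant _; set E := \prod_i _ => <-.
have vc1 : vc * vc = 1.
  rewrite -big_split big1 //= => v _; rewrite -big_split big1 //= => w _.
  rewrite -big_split big1 //= => a _; rewrite -big_split big1 //= => b _.
  by case: ifP => // _; rewrite inversion_sign_sqr.
have E1 : E * E = 1 by rewrite -big_split big1 //= => i _; rewrite match_sign_sqr.
transitivity (half_edge_sign (@edge_rk k) h * (vc * vc) * (E * E)); last by ring.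
by rewrite vc1 E1 !mulr1.
Qed.

Lemma sum_ordered_facts :
  \sum_(h in ordered_facts k) \prod_i match_sign (@nat_of_ord n) (h i) =
  (k.+1)`!%:R * signed_count n.
Proof.
rewrite (signed_countE ord0 (f := id)); last by exists id.
rewrite (partition_big (fun h : {ffun color -> {perm V}} => [set h i | i : color])
  (@one_fact V)) /=; last by move=> h; rewrite inE => /andP[].
rewrite mulr_sumr; apply: eq_bigr => F oF.
rewrite (eq_bigr (fun=> fact_sign (@nat_of_ord n) F)) => [|h /andP[hin /eqP <-]].
  rewrite (eq_bigl (mem [set h in ordered_facts k | [set h i | i : color] == F])) => [|h].
    by rewrite sumr_const card_ordered_facts // mulr_natl.
  by rewrite !inE.
rewrite /fact_sign big_imset //= => i j _ _.
by move: hin; rewrite inE => /andP[/injectiveP inj _]; apply: inj.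
Qed.

Lemma coloring_sumE : coloring_sum k =
  weight_constant k * color_constant k ^+ n *
  (order_constant n k.+1 * vertex_constant (@edge_rk k)) *
  ((k.+1)`!%:R * signed_count n).
Proof.
rewrite -sum_ordered_facts /coloring_sum.
rewrite (bigID (mem (@factor_coloring k @: ordered_facts k))) /= [X in _ + X]big1 ?addr0.
  rewrite big_imset /=; last exact: factor_coloring_inj.
  rewrite mulr_sumr; apply: eq_bigr => h /ordered_factsP oh.
  rewrite prod_color_weight // prod_adjacent_pairs // half_edge_sign_match //; ring.
move=> x; apply: contraNeq => nz; exact: coloring_term_neq0.
Qed.

Lemma paintable_complete : signed_count n != 0 -> edge_paintable 'K_n k.+1.
Proof.
move=> Sn; apply: alon_tarsi_painter_wins => //; apply: coloring_sum_alon_tarsi.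
have sign_neq0 (a b : int) : a * b = 1 -> b != 0.
  by move=> ab; apply/eqP => b0; move: ab; rewrite b0 mulr0.
have w0 : weight_constant k != 0.
  apply/prodf_neq0 => i _; rewrite expf_neq0 // mulf_neq0 ?signr_eq0 //.
  by rewrite pnatr_eq0 -lt0n bin_gt0 -ltnS.
have c0 : color_constant k ^+ n != 0.
  rewrite expf_neq0 //; apply/prodf_neq0 => -[i j] /= ij.
  by rewrite subr_eq0 eqr_nat neq_ltn ij.
have o0 : order_constant n k.+1 != 0.
  apply: (sign_neq0 (order_constant n k.+1)).
  by rewrite -big_split big1 //= => z _; apply: relative_sign_sqr.
have v0 : vertex_constant (@edge_rk k) != 0.
  apply: (sign_neq0 (vertex_constant (@edge_rk k))).
  rewrite -big_split big1 //= => v _; rewrite -big_split big1 //= => w _.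
  rewrite -big_split big1 //= => a _; rewrite -big_split big1 //= => b _.
  by case: ifP => // _; rewrite inversion_sign_sqr.
have f0 : (k.+1)`!%:R != 0 :> int by rewrite pnatr_eq0 -lt0n fact_gt0.
by rewrite coloring_sumE (mulf_neq0 (mulf_neq0 (mulf_neq0 w0 c0) (mulf_neq0 o0 v0))
  (mulf_neq0 f0 Sn)).
Qed.

End Paintability.

(** The value 0 would make [p ^ 2] divide [p]. *)
Lemma signed_count_neq0 (p : nat) : prime p -> odd p -> signed_count (2 * p) != 0.
Proof.
move=> p_pr p_odd; apply/eqP => S0; have := signed_count_mod p_pr p_odd.
move/eqP; rewrite S0 eqz_mod_dvd sub0r opprK => /dvdn_leq.
by have := prime_gt1 p_pr; rewrite /= -mulnn; nia.
Qed.

Close Scope ring_scope.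

Theorem theorem1p2 (p : nat) (p_prime : prime p) (p_odd : odd p) :
  (signed_count (2 * p) = - p%:Z %[mod (p ^ 2)%N%:Z])%Z /\
  [/\ is_chromatic_index 'K_(2 * p) (2 * p - 1),
      is_list_chromatic_index 'K_(2 * p) (2 * p - 1) &
      is_paintability_index 'K_(2 * p) (2 * p - 1)].
Proof.
split; first exact: signed_count_mod.
have paint : edge_paintable 'K_(2 * p) (2 * p - 1).
  have := signed_count_neq0 p_prime p_odd; have p_gt1 := prime_gt1 p_prime.
  have -> : 2 * p = (2 * p - 2).+2 by lia.
  by rewrite subn1; apply: paintable_complete.
have choose := paintable_choosable paint; have color := choosable_colorable choose.
split; split=> // j.
- exact: colorable_complete.
- by move/choosable_colorable/colorable_complete.
by move/paintable_choosable/choosable_colorable/colorable_complete.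
Qed.
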